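(* Let $(E,C)$ be a finite bipartite separated graph. Then the dynamical system $(\Omega(E,C),\alpha^* )$ is the universal $(E,C)$-dynamical system; that is, $(\Omega(E,C),\alpha^* )$ is an $(E,C)$-dynamical system and for every $(E,C)$-dynamical system there is a unique continuous equivariant map from it to $(\Omega(E,C),\alpha^* )$.
   Context: A separated graph is a pair $(E,C)$, where $E=(E^0,E^1,r,s)$ is a directed graph and $C=\bigsqcup_{v\in E^0}C_v$ with $C_v$ a partition of $r^{-1}(v)$ into nonempty subsets ($C_v=\emptyset$ if $r^{-1}(v)=\emptyset$). It is finite if $E^0,E^1$ are finite. It is bipartite if $E^0=E^{0,0}\sqcup E^{0,1}$, all arrows go from $E^{0,1}$ to $E^{0,0}$, $r(E^1)=E^{0,0}$ and $s(E^1)=E^{0,1}$. $C^*(E,C)$ is the universal C*-algebra with generators $v\in E^0$, $e\in E^1$ and relations: $vv'=\delta_{v,v'}v$, $v=v^*$; $r(e)e=e=es(e)$; $e^*e'=\delta_{e,e'}s(e)$ for $e,e'\in X$, $X\in C$; $v=\sum_{e\in X}ee^*$ for $X\in C_v$, $v\in E^0$. Canonical sequence: $(E_0,C^0)=(E,C)$; given $(E_n,C^n)$ with $C^n_u=\{X_1^u,\dots,X_{k_u}^u\}$ for $u\in E_n^{0,0}$, set $E_{n+1}^{0,0}=E_n^{0,1}$; $E_{n+1}^{0,1}=\{v(x_1,\dots,x_{k_u}):u\in E_n^{0,0},x_i\in X_i^u\}$ (distinct new vertices); $E_{n+1}^1$ consists of arrows $\alpha^{x_i}(x_1,\dots,\widehat{x_i},\dots,x_{k_u})$,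 for $u\in E_n^{0,0}$, $1\le i\le k_u$, $(x_1,\dots,x_{k_u})\in\prod_jX_j^u$, with range $s(x_i)$ and source $v(x_1,\dots,x_{k_u})$; and for $w\in E_{n+1}^{0,0}$, $C^{n+1}_w=\{X(x): x\in E_n^1, s(x)=w\}$ where for $x=x_i\in X_i^u$, $X(x_i)=\{\alpha^{x_i}(x_1,\dots,\widehat{x_i},\dots,x_{k_u}):x_j\in X_j^u,\ j\neq i\}$. There are surjective $*$-homomorphisms $\phi_n\colon C^*(E_n,C^n)\to C^*(E_{n+1},C^{n+1})$ with $\phi_n(w)=w$ ($w\in E_n^{0,1}$), $\phi_n(u)=\sum v(x_1,\dots,x_{k_u})$ (sum over $\prod_iX_i^u$, $u\in E_n^{0,0}$), $\phi_n(x_i)=\sum_{x_j\in X_j^u,\,j\ne i}(\alpha^{x_i}(x_1,\dots,\widehat{x_i},\dots,x_{k_u}))^*$ ($x_i\in X_i^u$). Put $\mathcal O(E,C)=\varinjlim(C^*(E_n,C^n),\phi_n)$ (a quotient of $C^*(E,C)$), and let $\underline x$ be the image of $x\in E^1$ in it. Let $\mathcal B_0$ be the commutative C*-subalgebra of $\mathcal O(E,C)$ generated by the images of all vertices in $\bigcup_nE_n^0$. Then $\Omega(E,C)$ is the spectrum of $\mathcal B_0$ (a zero-dimensional metrizable compact space), $\mathcal B_0\cong C(\Omega(E,C))$. Its structure, denoted $\alpha^*$, is: for $v\in E^0$, $\Omega(E,C)_v$ is the set of characters $\xi$ of $\mathcal B_0$ with $\xi(v)=1$; for $x\in E^1$,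 $H_x$ is the set of characters with $\xi(\underline x\,\underline x^* )=1$ (one has $\underline x\,\underline x^*\in\mathcal B_0$); and $\theta_x\colon\Omega(E,C)_{s(x)}\to H_x$ is dual to the isomorphism $\alpha_x\colon s(x)\mathcal B_0\to\underline x\,\underline x^*\mathcal B_0$, $b\mapsto\underline xb\underline x^*$, i.e. $\theta_x(\xi)(b)=\xi(\underline x^*b\underline x)$. An $(E,C)$-dynamical system is a compact Hausdorff space $\Omega$ with clopen subsets $\Omega_v$ ($v\in E^0$) with $\Omega=\bigsqcup_{v\in E^0}\Omega_v$, and for each $v\in E^{0,0}$ clopen subsets $H_x\subseteq\Omega_v$ ($x\in r^{-1}(v)$) with $\Omega_v=\bigsqcup_{x\in X}H_x$ for all $X\in C_v$, together with homeomorphisms $\theta_x\colon\Omega_{s(x)}\to H_x$ for all $x\in E^1$. A map $f\colon(\Omega,\theta)\to(\Omega',\theta')$ between such systems is equivariant if $f(\Omega_w)\subseteq\Omega'_w$ for all $w\in E^0$, $f(H_x)\subseteq H'_x$ for all $x\in E^1$ and $f(\theta_x(y))=\theta'_x(f(y))$ for all $y\in\Omega_{s(x)}$. *)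

(* Defs.v *)
From HB Require Import structures.
From mathcomp Require Import all_boot all_order all_algebra.
From mathcomp Require Import complex.
From mathcomp Require Import all_classical all_reals topology normedtype.

Set Implicit Arguments.
Unset Strict Implicit.
Unset Printing Implicit Defensive.

Import Order.TTheory GRing.Theory Num.Theory.
Import numFieldNormedType.Exports.

Local Open Scope ring_scope.

(* [finset.partition] already requires the blocks to be nonempty; it forces
   [sep v = set0] when no edge has range [v]. *)
Record sepGraph := SepGraph {
  vert : finType;
  edge : finType;
  rng : edge -> vert;
  src : edge -> vert;
  sep : vert -> {set {set edge}};
  sepP : forall v, finset.partition (sep v) [set e | rng e == v]%SET }.

(* A finite bipartite separated graph. The decomposition of the vertex set into
   E^{0,0} and E^{0,1} is carried by two types, [sepGraph_of_bip] below has the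
   disjoint sum [bvert0 + bvert1] as its set of vertices. No edge has its range
   in E^{0,1}, so [bsep] only needs to be given on E^{0,0}. *)
Record bipSepGraph := BipSepGraph {
  bvert0 : finType;
  bvert1 : finType;
  bedge : finType;
  brng : bedge -> bvert0;
  bsrc : bedge -> bvert1;
  bsep : bvert0 -> {set {set bedge}};
  bsepP : forall u, finset.partition (bsep u) [set e | brng e == u]%SET;
  brng_surj : forall u, exists e, brng e = u;
  bsrc_surj : forall w, exists e, bsrc e = w }.

Section OfBip.
Variable G : bipSepGraph.

Definition bip_sep (v : bvert0 G + bvert1 G) : {set {set bedge G}} :=
  match v with inl u => bsep u | inr _ => finset.set0 end.

Lemma bip_sepP v :
  finset.partition (bip_sep v)
    [set e | inl (brng e) == v :> bvert0 G + bvert1 G]%SET.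
Proof.
case: v => [u|w] /=; first exact: bsepP.
have -> : [set e : bedge G | inl (brng e) == inr w :> bvert0 G + bvert1 G]%SET
          = finset.set0 by apply/setP => e; rewrite !inE.
by rewrite finset.partition_set0.
Qed.

Definition sepGraph_of_bip : sepGraph :=
  @SepGraph (bvert0 G + bvert1 G)%type (bedge G)
    (fun e => inl (brng e)) (fun e => inr (bsrc e)) bip_sep bip_sepP.
End OfBip.

Coercion sepGraph_of_bip : bipSepGraph >-> sepGraph.

Section Next.
Variable G : bipSepGraph.

(* [block u] is the index set {1, ..., k_u} of C_u, and [choices u] is the
   product of the blocks X in C_u. *)
Definition block (u : bvert0 G) : finType := {X : {set bedge G} | X \in bsep u}.

Definition choices (u : bvert0 G) : finType :=
  {dffun forall X : block u, {x : bedge G | x \in val X}}.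

(* [Tagged _ x : next_vert1] is the vertex v(x_1, ..., x_{k_u}). *)
Definition next_vert1 : finType := {u : bvert0 G & choices u}.

(* The arrow alpha^{x_i}(x_1, ..., \hat{x_i}, ..., x_{k_u}) is given by its
   source v(x_1, ..., x_{k_u}) together with the index i. *)
Definition next_edge : finType := {v : next_vert1 & block (tag v)}.

(* The edge x_i of alpha^{x_i}(x_1, ..., \hat{x_i}, ..., x_{k_u}). *)
Definition marked (a : next_edge) : bedge G :=
  val ((tagged (tag a) : choices (tag (tag a))) (tagged a)).

Definition next_rng (a : next_edge) : bvert1 G := bsrc (marked a).
Definition next_src (a : next_edge) : next_vert1 := tag a.

(* The block X(x). *)
Definition next_block (x : bedge G) : {set next_edge} :=
  [set a | marked a == x]%SET.

Definition next_sep (w : bvert1 G) : {set {set next_edge}} :=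
  [set next_block x | x : bedge G & bsrc x == w]%SET.

Lemma block_of_edge (x : bedge G) : {X : block (brng x) | x \in val X}.
Proof.
have /and3P[/eqP covC _ _] := bsepP (brng x).
have : x \in finset.cover (bsep (brng x)) by rewrite covC inE.
by move=> /bigcupP/sig2_eqW[X XC xX]; exists (exist _ X XC).
Qed.

Lemma block_inhabited u (X : block u) : {x : bedge G | x \in val X}.
Proof.
have /and3P[_ _ nX] := bsepP u.
have /set0Pn/sigW[x xX] : val X != finset.set0.
  by apply: contraNneq nX => <-; exact: (valP X).
by exists x.
Qed.

Lemma marked_surj (x : bedge G) : exists a, marked a = x.
Proof.
have [X xX] := block_of_edge x.
pose c : choices (brng x) :=
  finfun (fun Y : block (brng x) => if x \in val Y =P true is ReflectT h
                   then exist _ x h else block_inhabited Y).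
exists (@existT _ (fun v : next_vert1 => block (tag v))
          (@existT _ choices (brng x) c) X).
by rewrite /marked /= ffunE; case: eqP.
Qed.

Lemma next_rng_surj w : exists a, next_rng a = w.
Proof.
by have [x <-] := bsrc_surj w; have [a <-] := marked_surj x; exists a.
Qed.

Lemma next_src_surj v : exists a, next_src a = v.
Proof.
case: v => u c; have [x xu] := brng_surj u; case: u / xu c => c.
have [X _] := block_of_edge x.
by exists (@existT _ (fun v : next_vert1 => block (tag v)) (@existT _ choices _ c) X).
Qed.

Lemma next_sepP w :
  finset.partition (next_sep w) [set a | next_rng a == w]%SET.
Proof.
apply/and3P; split.
- apply/eqP/setP => a; rewrite !inE; apply/bigcupP/idP.
    by move=> [_ /imsetP[x xw ->]]; rewrite !inE /next_rng in xw * => /eqP->.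
  move=> aw; exists (next_block (marked a)); last by rewrite inE.
  by apply/imsetP; exists (marked a); rewrite ?inE.
- apply/finset.trivIsetP => _ _ /imsetP[x _ ->] /imsetP[y _ ->] nxy.
  rewrite -setI_eq0; apply/eqP/setP => a; rewrite !inE.
  by apply/negP => /andP[/eqP-> /eqP xy]; rewrite xy eqxx in nxy.
- apply/imsetP => -[x _ x0]; have [a ax] := marked_surj x.
  by move/setP/(_ a): x0; rewrite !inE ax eqxx.
Qed.

Definition next_graph : bipSepGraph :=
  BipSepGraph next_sepP next_rng_surj next_src_surj.
End Next.

Fixpoint canon_graph (G : bipSepGraph) (n : nat) : bipSepGraph :=
  if n is m.+1 then next_graph (canon_graph G m) else G.

(* Not necessarily unital, and possibly zero. *)
HB.mixin Record isCStarAlgebra (R : realType) A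
    & CompleteNormedModule R[i] A := {
  cmul : A -> A -> A;
  cstar : A -> A;
  cmulA : associative cmul;
  cmulDl : left_distributive cmul +%R;
  cmulDr : right_distributive cmul +%R;
  cmulZl : forall (k : R[i]) a b, cmul (k *: a) b = k *: cmul a b;
  cmulZr : forall (k : R[i]) a b, cmul a (k *: b) = k *: cmul a b;
  cstarK : involutive cstar;
  cstarD : {morph cstar : a b / a + b};
  cstarZ : forall (k : R[i]) a, cstar (k *: a) = conjc k *: cstar a;
  cstarM : forall a b, cstar (cmul a b) = cmul (cstar b) (cstar a);
  cnormM : forall a b, `|cmul a b| <= `|a| * `|b|;
  cnorm_star : forall a, `|cmul (cstar a) a| = `|a| ^+ 2 }.

#[short(type="cstarAlgType")]
HB.structure Definition CStarAlgebra (R : realType) :=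
  {A of isCStarAlgebra R A & CompleteNormedModule R[i] A}.

Definition star_hom (R : realType) (A B : cstarAlgType R) (f : A -> B) : Prop :=
  [/\ linear f,
      {morph f : a b / cmul a b} &
      {morph f : a / cstar a}].

(* The images [p] of the vertices and [t] of the edges satisfy the defining
   relations of C*(E,C). *)
Definition sep_rep (R : realType) (G : sepGraph) (A : cstarAlgType R)
    (p : vert G -> A) (t : edge G -> A) : Prop :=
  [/\ forall v w, cmul (p v) (p w) = if v == w then p v else 0,
      forall v, cstar (p v) = p v,
      forall e, cmul (p (rng e)) (t e) = t e /\ cmul (t e) (p (src e)) = t e,
      forall v X e f, X \in sep v -> e \in X -> f \in X ->
        cmul (cstar (t e)) (t f) = if e == f then p (src e) else 0 &
      forall v X, X \in sep v -> p v = \sum_(e in X) cmul (t e) (cstar (t e))].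

Definition is_graph_algebra (R : realType) (G : sepGraph) (A : cstarAlgType R)
    (p : vert G -> A) (t : edge G -> A) : Prop :=
  sep_rep p t /\
  forall (B : cstarAlgType R) (q : vert G -> B) (s : edge G -> B),
    sep_rep q s ->
    exists! f : A -> B,
      [/\ star_hom f, forall v, f (p v) = q v & forall e, f (t e) = s e].

Definition is_direct_limit (R : realType) (A : nat -> cstarAlgType R)
    (phi : forall n, A n -> A n.+1)
    (O : cstarAlgType R) (psi : forall n, A n -> O) : Prop :=
  [/\ forall n, star_hom (psi n),
      forall n a, psi n.+1 (phi n a) = psi n a &
      forall (B : cstarAlgType R) (chi : forall n, A n -> B),
        (forall n, star_hom (chi n)) ->
        (forall n a, chi n.+1 (phi n a) = chi n a) ->
        exists! f : O -> B, star_hom f /\ forall n a, f (psi n a) = chi n a].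

(* A choice of the C*-algebras C*(E_n,C^n), with their canonical generators, of
   the connecting maps phi_n, and of their direct limit O(E,C). All of it is
   determined by (E,C) up to a unique compatible isomorphism. *)
Record limitAlgebra (R : realType) (G : bipSepGraph) := LimitAlgebra {
  la_alg : nat -> cstarAlgType R;
  la_vert : forall n, vert (canon_graph G n) -> la_alg n;
  la_edge : forall n, edge (canon_graph G n) -> la_alg n;
  la_algP : forall n, is_graph_algebra (@la_vert n) (@la_edge n);
  la_phi : forall n, la_alg n -> la_alg n.+1;
  la_phi_hom : forall n, star_hom (@la_phi n);
  la_phi_vert1 : forall n (w : bvert1 (canon_graph G n)),
    la_phi (la_vert (inr w)) = la_vert (inl w : vert (canon_graph G n.+1));
  la_phi_vert0 : forall n (u : bvert0 (canon_graph G n)),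
    la_phi (la_vert (inl u)) =
    \sum_(v : next_vert1 (canon_graph G n) | tag v == u)
       la_vert (inr v : vert (canon_graph G n.+1));
  la_phi_edge : forall n (x : bedge (canon_graph G n)),
    la_phi (la_edge x) =
    \sum_(a : next_edge (canon_graph G n) | marked a == x)
       cstar (la_edge (a : edge (canon_graph G n.+1)));
  la_lim : cstarAlgType R;
  la_psi : forall n, la_alg n -> la_lim;
  la_limP : is_direct_limit la_phi la_psi }.
Arguments la_vert {R G} l n v.
Arguments la_edge {R G} l n e.
Arguments la_psi {R G} l {n} a.

Local Open Scope classical_set_scope.

(* The map theta_x is represented by a total function; only its restriction to
   Omega_{s(x)} is meaningful. *)
Record dynData (G : bipSepGraph) := DynData {
  dspace :> topologicalType;
  dvert : vert G -> set dspace;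
  dedge : edge G -> set dspace;
  dtheta : edge G -> dspace -> dspace }.
Arguments dvert {G} d v.
Arguments dedge {G} d x.

Definition homeo_on (T U : topologicalType) (A : set T) (B : set U)
    (f : T -> U) : Prop :=
  set_bij A B f /\ {within A, continuous f} /\
  exists g : U -> T,
    [/\ forall y, A y -> g (f y) = y & {within B, continuous g}].

Record is_dynsys (G : bipSepGraph) (S : dynData G) : Prop := IsDynsys {
  dyn_compact : compact [set: S];
  dyn_hausdorff : hausdorff_space S;
  dyn_vert_clopen : forall v, clopen (dvert S v);
  dyn_vert_cover : \bigcup_v dvert S v = [set: S];
  dyn_vert_disj : classical_sets.trivIset [set: vert G] (dvert S);
  dyn_edge_clopen : forall x, clopen (dedge S x);
  dyn_edge_sub : forall x, dedge S x `<=` dvert S (rng x);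
  dyn_edge_cover : forall (u : bvert0 G) X, X \in bsep u ->
    \bigcup_(x in [set` X]) dedge S x = dvert S (inl u);
  dyn_edge_disj : forall (u : bvert0 G) X, X \in bsep u ->
    classical_sets.trivIset [set` X] (dedge S);
  dyn_theta : forall x, homeo_on (dvert S (src x)) (dedge S x) (dtheta x) }.

Definition equivariant (G : bipSepGraph) (S T : dynData G) (f : S -> T) : Prop :=
  [/\ forall w y, dvert S w y -> dvert T w (f y),
      forall x y, dedge S x y -> dedge T x (f y) &
      forall x y, dvert S (src x) y -> f (dtheta x y) = dtheta x (f y)].

Definition cstar_subalg (R : realType) (A : cstarAlgType R) (S : set A) : Prop :=
  [/\ closed S, S 0,
      forall (k : R[i]) a b, S a -> S b -> S (k *: a + b),
      forall a b, S a -> S b -> S (cmul a b) &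
      forall a, S a -> S (cstar a)].

(* Nonzero multiplicative linear functionals on (the subtype of) [S]. As the
   type [S] carries no operations, these are taken in [A]. *)
Definition character (R : realType) (A : cstarAlgType R) (S : set A)
    (xi : S -> R[i]) : Prop :=
  [/\ exists b, xi b != 0,
      forall (k : R[i]) (a b c : S),
        val c = k *: val a + val b -> xi c = k * xi a + xi b &
      forall a b c : S, val c = cmul (val a) (val b) -> xi c = xi a * xi b].

(* The topology is that of pointwise convergence on [S]. *)
Definition spectrum (R : realType) (A : cstarAlgType R) (S : set A) :
    topologicalType :=
  set_type [set xi : {ptws S -> R[i]^o} | character xi].

(* [a] belongs to [S] and xi(a) = z. *)
Definition char_eq (R : realType) (A : cstarAlgType R) (S : set A)
    (xi : spectrum S) (a : A) (z : R[i]) : Prop :=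
  exists b : S, val b = a /\ val xi b = z.

Section Omega.
Variables (R : realType) (G : bipSepGraph) (M : limitAlgebra R G).

Let vertO (v : vert G) : la_lim M := la_psi M (la_vert M 0 v).
Let edgeO (x : edge G) : la_lim M := la_psi M (la_edge M 0 x).

Definition B0 : set (la_lim M) :=
  smallest (@cstar_subalg R (la_lim M))
    [set b | exists n (v : vert (canon_graph G n)), b = la_psi M (la_vert M n v)].

Definition Omega : topologicalType := spectrum B0.

Definition Omega_vert (v : vert G) : set Omega :=
  [set xi | char_eq xi (vertO v) 1].

Definition Omega_edge (x : edge G) : set Omega :=
  [set xi | char_eq xi (cmul (edgeO x) (cstar (edgeO x))) 1].

(* The character eta = theta_x(xi) such that x^* b x is in B_0 and
   eta(b) = xi(x^* b x) for all b in B_0.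
   The default value xi matters only where there is no such eta; in a dynamical
   system this does not occur for xi in Omega_{s(x)}, as then
   theta_x(xi) \in H_x and H_x is disjoint from Omega_{s(x)}. *)
Definition Omega_theta (x : edge G) (xi : Omega) : Omega :=
  xget xi [set eta : Omega | forall b : B0,
    char_eq xi (cmul (cmul (cstar (edgeO x)) (val b)) (edgeO x)) (val eta b)].

Definition Omega_dyn : dynData G := DynData Omega_vert Omega_edge Omega_theta.
End Omega.

(* Main.v *)
Require Import Defs.
From HB Require Import structures.
From mathcomp Require Import all_boot all_order all_algebra.
From mathcomp Require Import complex.
From mathcomp Require Import all_classical all_reals topology normedtype sequences.
From mathcomp Require Import ring lra.

Set Implicit Arguments.
Unset Strict Implicit.
Unset Printing Implicit Defensive.

Import Order.TTheory GRing.Theory Num.Theory.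
Import numFieldNormedType.Exports.

Local Open Scope ring_scope.
Local Open Scope classical_set_scope.
Local Open Scope complex_scope.

(** The spectrum of [B0] is a dynamical system because conjugation by an edge
    [x] maps [B0] into itself ([B0_conj]) and is multiplicative there: the
    algebra [B0] is commutative and contains [x x^*] and [x^* x]. Composing
    characters with [b |-> x^* b x] and with [b |-> x b x^*] then gives mutually
    inverse homeomorphisms between the clopen sets defined by these projections.
    Stability of [B0] is shown on the vertices of level [m] by expanding [x] into
    edges of the levels up to [m]; the mixed terms vanish, as the initial and
    the final projections of an edge commute with [B0]. Characters of [B0] are
    bounded by the norm ([ev_bound]) and take the value one at the unit, so that
    their space is compact.

    For the existence of a map from a system [S], the points of [S] have to give
    characters, hence the limit algebra must be represented on something that
    remembers [S]. It acts on the Hilbert space [l2 S]: a vertex acts as the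
    projection onto the functions supported in its clopen set, an edge as the
    partial isometry that transports point masses along its homeomorphism. The
    construction of the canonical sequence can be imitated on the space [S]
    ([next_system]), which provides compatible representations of all levels
    ([system_rep], [level_rep_next]). In the resulting representation [B0] acts
    by diagonal operators ([repr_diagonal]), and the entry at [y] is the character
    attached to the point [y]. These entries depend continuously on [y]: for a
    vertex they form the indicator of a clopen set, and the elements for which
    they are continuous form a closed algebra, since a representation on a
    Hilbert space is contractive ([rep_contractive]). Equivariance holds because
    the edge [x] maps the point mass at [y] to the one at [theta_x y].

    For uniqueness, consider the elements of [B0] on which the characters given
    by two equivariant maps agree at all points. They form a closed algebra,
    which contains the vertices of the first level and is stable under
    conjugation by its edges. Both properties propagate to all levels
    ([agree_level]): a new vertex is the product of the final projections of the
    edges in its tuple, and a new edge is the adjoint of an old one, cut down by a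
    new vertex ([te_next]). Hence this algebra is [B0]. *)

(** * Real-valued norms over the complex numbers *)

Section RealNorm.
Variables (R : realType) (V : normedModType R[i]).

(** The norm of a complex normed module takes values in [R[i]], whose order is
    partial; all estimates below are made on its real part instead. *)
Definition rnorm (x : V) : R := complex.Re `|x|.

Lemma rnormE x : `|x| = (rnorm x)%:C.
Proof.
have := normr_ge0 x.
rewrite /rnorm; case: (`|x|) => a b; rewrite lecE /= => /andP[/eqP b0 _].
by rewrite b0.
Qed.

Lemma rnorm_ge0 x : 0 <= rnorm x.
Proof. by have := normr_ge0 x; rewrite rnormE -[0]/(0%:C) lecR. Qed.

Lemma rnorm0 : rnorm 0 = 0.
Proof. by rewrite /rnorm normr0. Qed.

Lemma rnorm_eq0 x : rnorm x = 0 -> x = 0.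
Proof. by move=> x0; apply: normr0_eq0; rewrite rnormE x0. Qed.

Lemma rnormB x y : rnorm (x - y) = rnorm (y - x).
Proof. by rewrite /rnorm distrC. Qed.

Lemma ler_rnormD x y : rnorm (x + y) <= rnorm x + rnorm y.
Proof. by rewrite -lecR rmorphD /= -!rnormE ler_normD. Qed.

Lemma ler_rnorm_dist z x y : rnorm (x - y) <= rnorm (x - z) + rnorm (z - y).
Proof. by rewrite -lecR rmorphD /= -!rnormE ler_distD. Qed.

Lemma rnormZ (k : R[i]) x : rnorm (k *: x) = Normc.normc k * rnorm x.
Proof. by apply/complexI; rewrite -rnormE normrZ rnormE rmorphM. Qed.

Lemma rnorm_le_eq0 x : (forall e : R, 0 < e -> rnorm x <= e) -> x = 0.
Proof.
move=> xe; apply: rnorm_eq0; apply: le_anti; rewrite rnorm_ge0 andbT.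
by apply/ler_addgt0Pl => e e0; rewrite addr0 xe.
Qed.

Lemma nbhs_rnormP (x : V) (P : set V) :
  nbhs x P <-> exists2 e : R, 0 < e & forall y, rnorm (x - y) < e -> P y.
Proof.
split=> [/nbhs_ballP[e /= e0 xP]|[e e0 xP]].
  have eE : e = (complex.Re e)%:C.
    by move: e0; rewrite ltcE => /andP[/= /eqP]; case: (e) => a b /= ->.
  exists (complex.Re e); first by rewrite -ltcR -eE.
  by move=> y xy; apply: xP; rewrite -ball_normE /= rnormE eE ltcR.
apply/nbhs_ballP; exists e%:C; first by rewrite /= ltcR.
move=> y; rewrite -ball_normE /= rnormE ltcR; exact: xP.
Qed.

Lemma closed_rnormP (P : set V) :
  closed P <->
  forall x, (forall e : R, 0 < e -> exists2 y, P y & rnorm (x - y) < e) -> P x.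
Proof.
split=> clP x xP; apply: clP.
  by move=> B /nbhs_rnormP[e /xP[y Py xy] eB]; exists y; split=> //; exact: eB.
move=> e e0; have /xP[y [Py xy]] : nbhs x [set y | rnorm (x - y) < e].
  by apply/nbhs_rnormP; exists e.
by exists y.
Qed.

End RealNorm.

Lemma lipschitz_cts (R : realType) (V W : normedModType R[i]) (F : V -> W)
    (c : R) :
  (forall x y, rnorm (F x - F y) <= c * rnorm (x - y)) -> continuous F.
Proof.
move=> Fc x B /nbhs_rnormP[e e0 eB]; apply/nbhs_rnormP.
have c1 : 0 < `|c| + 1 by rewrite ltr_wpDl.
exists (e / (`|c| + 1)); first exact: divr_gt0.
move=> y xy; apply: eB; apply: (le_lt_trans (Fc x y)).
apply: (@le_lt_trans _ _ ((`|c| + 1) * rnorm (x - y))).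
  by rewrite ler_wpM2r ?rnorm_ge0 // (le_trans (ler_norm c)) // lerDl.
by rewrite mulrC -ltr_pdivlMr.
Qed.

Lemma closed_eqfun (R : realType) (V : topologicalType) (W : normedModType R[i])
    (f g : V -> W) :
  continuous f -> continuous g -> closed [set x | f x = g x].
Proof.
move=> cf cg.
have -> : [set x | f x = g x] = (fun x => f x - g x) @^-1` [set 0].
  apply/seteqP; split=> x /=; first by move=> ->; rewrite subrr.
  by move/eqP; rewrite subr_eq0 => /eqP.
apply: closed_comp => [x _|]; first by apply: cvgB; [exact: cf | exact: cg].
apply/closed_rnormP => x x0; apply: rnorm_le_eq0 => e /x0[_ /= ->].
by rewrite subr0 => /ltW.
Qed.

(** Banach's theorem. It stands in for the functional calculus: the inverse of
    [1 - b] and the square root of [1 - h], for [b] and [h] of norm less than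
    one, are fixed points of contractions. *)
Lemma contraction_fixpoint (R : realType) (V : completeNormedModType R[i])
    (U : set V) (f : V -> V) (q : R) :
  closed U -> U !=set0 -> 0 <= q < 1 -> (forall x, U x -> U (f x)) ->
  (forall x y, U x -> U y -> rnorm (f x - f y) <= q * rnorm (x - y)) ->
  exists2 x, U x & f x = x.
Proof.
move=> clU [x0 Ux0] /andP[q0 q1] Uf fq.
pose u n := iter n f x0; pose d := rnorm (u 1%N - u 0%N).
have Uu n : U (u n) by elim: n => [//|n IHn]; exact: Uf.
have q1' : 0 < 1 - q by rewrite subr_gt0.
have step n : rnorm (u n.+1 - u n) <= q ^+ n * d.
  elim: n => [|n IHn]; first by rewrite expr0 mul1r.
  apply: (le_trans (fq (u n.+1) (u n) (Uu _) (Uu _))).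
  by rewrite exprS -mulrA ler_wpM2l.
have tail n m : rnorm (u (n + m)%N - u n) <= q ^+ n * d / (1 - q).
  (* the invariant is the partial sum of the geometric series *)
  suff : rnorm (u (n + m)%N - u n) <= q ^+ n * d * (1 - q ^+ m) / (1 - q).
    move/le_trans; apply; apply: ler_wpM2r; first by rewrite invr_ge0 ltW.
    rewrite ler_piMr ?mulr_ge0 ?exprn_ge0 ?rnorm_ge0 //.
    by rewrite gerBl exprn_ge0.
  elim: m => [|m IHm]; first by rewrite addn0 subrr rnorm0 expr0 subrr mulr0 mul0r.
  rewrite addnS (le_trans (ler_rnorm_dist (u (n + m)%N) _ _)) //.
  apply: (le_trans (lerD (step _) IHm)).
  rewrite le_eqVlt; apply/orP; left; apply/eqP.
  by rewrite exprD exprS; field; rewrite gt_eqF.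
have small e : 0 < e -> exists N : nat, q ^+ N * d / (1 - q) < e.
  move=> e0; have d0 : 0 <= d by exact: rnorm_ge0.
  have qn1 : `|q| < 1 by rewrite ger0_norm.
  have e1 : 0 < e * (1 - q) / (d + 1) by rewrite divr_gt0 ?mulr_gt0 // ltr_wpDl.
  have := cvg_expr qn1; move=> /cvgrPdist_lt/(_ _ e1)[N _ /(_ N (leqnn N))].
  rewrite sub0r normrN ger0_norm ?exprn_ge0 // => qN; exists N.
  rewrite ltr_pdivrMr //.
  apply: (@le_lt_trans _ _ (q ^+ N * (d + 1))).
    by rewrite ler_wpM2l ?exprn_ge0 // lerDl.
  by rewrite -ltr_pdivlMr // ltr_wpDl.
have cu : cvg (u @ \oo).
  apply: cauchy_cvg; apply: cauchy_exP => e.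
  move=> e0; have eE : e = (complex.Re e)%:C.
    by move: e0; rewrite ltcE => /andP[/= /eqP]; case: (e) => a b /= ->.
  rewrite eE ltcR in e0 *; have [N NP] := small _ e0.
  exists (u N), N => // n /= Nn; rewrite -ball_normE /= rnormE ltcR rnormB.
  by rewrite -(subnKC Nn) (le_lt_trans (tail _ _)).
pose l := lim (u @ \oo).
have lP (e : R) : 0 < e -> exists N : nat, forall n, (N <= n)%N -> rnorm (l - u n) < e.
  move=> e0; have /(_ [set y | rnorm (l - y) < e])[|N _ NP] := cu.
    by apply/nbhs_rnormP; exists e.
  by exists N => n; exact: NP.
have Ul : U l.
  move: clU => /closed_rnormP; apply => e /lP[N NP].
  by exists (u N); [exact: Uu | exact: NP].
exists l => //; apply/eqP; rewrite -subr_eq0; apply/eqP.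
apply: rnorm_le_eq0 => e e0.
have [N NP] := lP (e / 2) (divr_gt0 e0 (ltr0n _ 2)).
apply: (le_trans (ler_rnorm_dist (u N.+1) _ _)).
rewrite (splitr e); apply: lerD; last by rewrite rnormB ltW // NP.
apply: (le_trans (fq _ _ Ul (Uu _))); apply: (le_trans _ (ltW (NP N _))) => //.
by rewrite ler_piMl ?rnorm_ge0 // ltW.
Qed.

(** * Elementary rules in C*-algebras *)

Section CStarBasics.
Variables (R : realType) (A : cstarAlgType R).
Implicit Types a b c : A.

Lemma cmul0l a : cmul 0 a = 0 :> A.
Proof. by apply: (addrI (cmul 0 a)); rewrite -cmulDl !addr0. Qed.

Lemma cmul0r a : cmul a 0 = 0 :> A.
Proof. by apply: (addrI (cmul a 0)); rewrite -cmulDr !addr0. Qed.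

Lemma cmulNl a b : cmul (- a) b = - cmul a b.
Proof. by rewrite -scaleN1r cmulZl scaleN1r. Qed.

Lemma cmulNr a b : cmul a (- b) = - cmul a b.
Proof. by rewrite -scaleN1r cmulZr scaleN1r. Qed.

Lemma cmulBl a b c : cmul (a - b) c = cmul a c - cmul b c.
Proof. by rewrite cmulDl cmulNl. Qed.

Lemma cmulBr a b c : cmul c (a - b) = cmul c a - cmul c b.
Proof. by rewrite cmulDr cmulNr. Qed.

Lemma cmul_suml (I : Type) (r : seq I) (P : pred I) (F : I -> A) b :
  cmul (\sum_(i <- r | P i) F i) b = \sum_(i <- r | P i) cmul (F i) b.
Proof.
by apply: (big_morph (cmul^~ b)) => [x y|]; [exact: cmulDl | exact: cmul0l].
Qed.

Lemma cmul_sumr (I : Type) (r : seq I) (P : pred I) (F : I -> A) b :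
  cmul b (\sum_(i <- r | P i) F i) = \sum_(i <- r | P i) cmul b (F i).
Proof. by apply: big_morph => [x y|]; [exact: cmulDr | exact: cmul0r]. Qed.

Lemma cstar0 : cstar 0 = 0 :> A.
Proof. by apply: (addrI (cstar (0 : A))); rewrite -cstarD !addr0. Qed.

Lemma cstarN a : cstar (- a) = - cstar a.
Proof. by apply/eqP; rewrite -addr_eq0 -cstarD addNr cstar0. Qed.

Lemma cstar_sum (I : Type) (r : seq I) (P : pred I) (F : I -> A) :
  cstar (\sum_(i <- r | P i) F i) = \sum_(i <- r | P i) cstar (F i).
Proof. by apply: big_morph => [x y|]; [exact: cstarD | exact: cstar0]. Qed.

Lemma rnormM a b : rnorm (cmul a b) <= rnorm a * rnorm b.
Proof. by rewrite -lecR rmorphM /= -!rnormE cnormM. Qed.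

Lemma rnorm_starM a : rnorm (cmul (cstar a) a) = rnorm a ^+ 2.
Proof. by apply/complexI; rewrite rmorphXn /= -!rnormE cnorm_star. Qed.

Lemma rnorm_star a : rnorm (cstar a) = rnorm a.
Proof.
have le b : rnorm b <= rnorm (cstar b).
  have [->|b0] := eqVneq (rnorm b) 0; first exact: rnorm_ge0.
  have b1 : 0 < rnorm b by rewrite lt_neqAle eq_sym b0 rnorm_ge0.
  by rewrite -(ler_pM2r b1) -expr2 -rnorm_starM rnormM.
by apply: le_anti; rewrite le -{2}[a]cstarK le.
Qed.

End CStarBasics.

Section StarHomBasics.
Variables (R : realType) (A B : cstarAlgType R) (f : A -> B).
Hypothesis fP : star_hom f.

Lemma homL k a b : f (k *: a + b) = k *: f a + f b.
Proof. by have [lin _ _] := fP; exact: lin. Qed.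

Lemma homD a b : f (a + b) = f a + f b.
Proof. by rewrite -[a]scale1r homL !scale1r. Qed.

Lemma hom0 : f 0 = 0.
Proof. by apply: (addrI (f 0)); rewrite -homD !addr0. Qed.

Lemma homZ k a : f (k *: a) = k *: f a.
Proof. by rewrite -[k *: a]addr0 homL hom0 addr0. Qed.

Lemma homN a : f (- a) = - f a.
Proof. by rewrite -scaleN1r homZ scaleN1r. Qed.

Lemma homB a b : f (a - b) = f a - f b.
Proof. by rewrite homD homN. Qed.

Lemma homM a b : f (cmul a b) = cmul (f a) (f b).
Proof. by have [_ mul _] := fP; exact: mul. Qed.

Lemma hom_star a : f (cstar a) = cstar (f a).
Proof. by have [_ _ st] := fP; exact: st. Qed.

Lemma hom_sum (I : Type) (r : seq I) (P : pred I) (F : I -> A) :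
  f (\sum_(i <- r | P i) F i) = \sum_(i <- r | P i) f (F i).
Proof. by apply: big_morph => [x y|]; [exact: homD | exact: hom0]. Qed.

End StarHomBasics.

(** * Bounded operators on a Hilbert space *)

(** A complex Hilbert space presented by the real part [dot] of its inner
    product: [dot_conj] says that it is the real part of a sesquilinear form.
    With this choice only real numbers have to be summed and compared. *)
Record hilbert (R : realType) := Hilbert {
  hspace :> lmodType R[i];
  dot : hspace -> hspace -> R;
  dotC : forall x y, dot x y = dot y x;
  dotDl : forall x y z, dot (x + y) z = dot x z + dot y z;
  dotZl : forall (k : R) x y, dot (k%:C *: x) y = k * dot x y;
  dot_conj : forall (k : R[i]) x y, dot (k *: x) y = dot x (conjc k *: y);
  dot_ge0 : forall x, 0 <= dot x x;
  dot_eq0 : forall x, dot x x = 0 -> x = 0;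
  dot_complete : forall u : nat -> hspace,
    (forall e : R, 0 < e -> exists N : nat, forall m n, (N <= m)%N ->
       (N <= n)%N -> dot (u m - u n) (u m - u n) <= e) ->
    exists l, forall e : R, 0 < e -> exists N : nat, forall n, (N <= n)%N ->
       dot (l - u n) (l - u n) <= e }.
Arguments dot {R h}.

Section HilbertTheory.
Variables (R : realType) (H : hilbert R).
Implicit Types x y z : H.

Lemma dotDr x y z : dot x (y + z) = dot x y + dot x z.
Proof. by rewrite dotC dotDl !(dotC x). Qed.

Lemma dotZr (k : R) x y : dot x (k%:C *: y) = k * dot x y.
Proof. by rewrite dotC dotZl dotC. Qed.

Lemma dotNl x y : dot (- x) y = - dot x y.
Proof. by rewrite -[- x]scaleN1r -(rmorph1 (real_complex R)) -rmorphN dotZl mulN1r. Qed.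

Lemma dotNr x y : dot x (- y) = - dot x y.
Proof. by rewrite dotC dotNl dotC. Qed.

Lemma dotBl x y z : dot (x - y) z = dot x z - dot y z.
Proof. by rewrite dotDl dotNl. Qed.

Lemma dotBr x y z : dot x (y - z) = dot x y - dot x z.
Proof. by rewrite dotDr dotNr. Qed.

Lemma dot0l x : dot 0 x = 0.
Proof. by rewrite -(subrr x) dotBl subrr. Qed.

Lemma dot_conjr (k : R[i]) x y : dot x (k *: y) = dot (conjc k *: x) y.
Proof. by rewrite dotC dot_conj dotC. Qed.

Lemma dotZZ (k : R[i]) x : dot (k *: x) (k *: x) = Normc.normc k ^+ 2 * dot x x.
Proof.
rewrite dot_conj scalerA.
suff -> : conjc k * k = (Normc.normc k ^+ 2)%:C by rewrite dotZr.
case: k => a b; rewrite /= sqr_sqrtr ?addr_ge0 ?sqr_ge0 //.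
by apply/eqP; rewrite eq_complex /=; apply/andP; split; apply/eqP; ring.
Qed.

Lemma dot_inj x y : (forall z, dot x z = dot y z) -> x = y.
Proof.
move=> xy; apply/eqP; rewrite -subr_eq0; apply/eqP/dot_eq0.
by rewrite dotBl xy subrr.
Qed.

Definition hnorm x : R := Num.sqrt (dot x x).

Lemma hnorm_ge0 x : 0 <= hnorm x. Proof. exact: sqrtr_ge0. Qed.

Lemma hnormE x : hnorm x ^+ 2 = dot x x.
Proof. by rewrite sqr_sqrtr // dot_ge0. Qed.

Lemma hnorm0 : hnorm 0 = 0.
Proof. by rewrite /hnorm dot0l sqrtr0. Qed.

Lemma hnorm_eq0 x : hnorm x = 0 -> x = 0.
Proof. by move=> x0; apply: dot_eq0; rewrite -hnormE x0 expr0n. Qed.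

Lemma hnormZ (k : R[i]) x : hnorm (k *: x) = Normc.normc k * hnorm x.
Proof.
rewrite /hnorm dotZZ sqrtrM ?sqr_ge0 // sqrtr_sqr ger0_norm //.
by case: k => a b; rewrite /= sqrtr_ge0.
Qed.

Lemma dot_le x y : dot x y <= hnorm x * hnorm y.
Proof.
have [x0|x0] := eqVneq (hnorm x) 0.
  by rewrite (hnorm_eq0 x0) dot0l hnorm0 mul0r.
have [y0|y0] := eqVneq (hnorm y) 0.
  by rewrite (hnorm_eq0 y0) dotC dot0l hnorm0 mulr0.
have x1 : 0 < hnorm x by rewrite lt_neqAle eq_sym x0 hnorm_ge0.
have y1 : 0 < hnorm y by rewrite lt_neqAle eq_sym y0 hnorm_ge0.
have := dot_ge0 ((hnorm y)%:C *: x - (hnorm x)%:C *: y).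
rewrite dotBl !dotBr !dotZl !dotZr -!hnormE (dotC y x) => le0.
have xy : 0 < hnorm x * hnorm y by rewrite mulr_gt0.
by rewrite -(ler_pM2l xy); nra.
Qed.

Lemma dot_norm_le x y : `|dot x y| <= hnorm x * hnorm y.
Proof.
rewrite ler_norml dot_le andbT lerNl -dotNl.
have <- : hnorm (- x) = hnorm x by rewrite /hnorm dotNl dotNr opprK.
exact: dot_le.
Qed.

Lemma ler_hnormD x y : hnorm (x + y) <= hnorm x + hnorm y.
Proof.
rewrite -ler_sqr ?nnegrE ?addr_ge0 ?hnorm_ge0 // hnormE dotDl !dotDr (dotC y x).
by rewrite -!hnormE sqrrD; have := dot_le x y; lra.
Qed.

Lemma hnormN x : hnorm (- x) = hnorm x.
Proof. by rewrite /hnorm dotNl dotNr opprK. Qed.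

Lemma ler_hnorm_dist z x y : hnorm (x - y) <= hnorm (x - z) + hnorm (z - y).
Proof. by rewrite (le_trans _ (ler_hnormD _ _)) // addrA subrK. Qed.

Lemma hnorm_le (x : H) c : 0 <= c -> (hnorm x <= c) = (dot x x <= c ^+ 2).
Proof. by move=> c0; rewrite -hnormE ler_sqr ?nnegrE ?hnorm_ge0. Qed.

Lemma hnorm_complete (u : nat -> H) :
  (forall e : R, 0 < e -> exists N : nat, forall m n, (N <= m)%N ->
     (N <= n)%N -> hnorm (u m - u n) <= e) ->
  exists l, forall e : R, 0 < e -> exists N : nat, forall n, (N <= n)%N ->
     hnorm (l - u n) <= e.
Proof.
move=> cu; have [|l lP] := @dot_complete _ _ u.
  move=> e e0; have [|N NP] := cu (Num.sqrt e); first by rewrite sqrtr_gt0.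
  exists N => m n Nm Nn; have := NP m n Nm Nn.
  by rewrite hnorm_le ?sqrtr_ge0 // sqr_sqrtr // ltW.
exists l => e e0; have [|N NP] := lP (e ^+ 2); first by rewrite exprn_gt0.
by exists N => n /NP; rewrite hnorm_le // ltW.
Qed.

End HilbertTheory.

Section OpAlg.
Variables (R : realType) (H : hilbert R).

(** Adjointability makes the star of an operator available without the Riesz
    representation theorem. *)
Definition bounded_adjointable (T : H -> H) : Prop :=
  [/\ linear T,
      exists c : R, forall x, hnorm (T x) <= c * hnorm x &
      exists T' : H -> H, forall x y, dot (T x) y = dot x (T' y)].

Definition bops : {pred H -> H} := [pred T | `[< bounded_adjointable T >]].

Lemma bopsP T : reflect (bounded_adjointable T) (T \in bops).
Proof. exact: asboolP. Qed.

Lemma linear_scale (T : H -> H) : linear T -> forall k x, T (k *: x) = k *: T x.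
Proof.
move=> linT k x; have T0 : T 0 = 0.
  by apply: (addrI (T 0)); rewrite -[X in X + _ = _]scale1r -linT scale1r !addr0.
by rewrite -[k *: x]addr0 linT T0 addr0.
Qed.

Lemma bound_pos (f : H -> H) (c : R) : (forall x, hnorm (f x) <= c * hnorm x) ->
  forall x, hnorm (f x) <= `|c| * hnorm x.
Proof.
by move=> fc x; rewrite (le_trans (fc x)) // ler_wpM2r ?hnorm_ge0 // ler_norm.
Qed.

Lemma bops_submod : submod_closed bops.
Proof.
split=> [|k T U].
  apply/bopsP; split.
  - by move=> k x y; rewrite -[LHS]/(0 : H) -[RHS]/(k *: 0 + 0 : H) scaler0 addr0.
  - by exists 0 => x; rewrite -[(0 : H -> H) x]/(0 : H) hnorm0 mul0r.
  - by exists (fun=> 0) => x y; rewrite -[(0 : H -> H) x]/(0 : H) dot0l dotC dot0l.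
move=> /bopsP[linT [c Tc] [T' adjT]] /bopsP[linU [d Ud] [U' adjU]].
have kTU x : (k *: T + U) x = k *: T x + U x by [].
apply/bopsP; split.
- move=> l x y; rewrite !kTU linT linU !scalerDr !scalerA (mulrC l) -!addrA.
  by congr (_ + _); exact: addrCA.
- exists (Normc.normc k * c + d) => x; rewrite kTU.
  rewrite (le_trans (ler_hnormD _ _)) // mulrDl lerD // hnormZ -mulrA.
  by rewrite ler_wpM2l //; case: (k) => a b; rewrite /= sqrtr_ge0.
- exists (fun y => conjc k *: T' y + U' y) => x y.
  by rewrite kTU dotDl dotDr dot_conjr conjcK -adjT -adjU (linear_scale linT).
Qed.

HB.instance Definition _ :=
  GRing.isSubmodClosed.Build R[i] (H -> H) bops bops_submod.

Record opalg := OpAlg { opfun :> H -> H; opfunP : opfun \in bops }.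

HB.instance Definition _ := [isSub for opfun].
HB.instance Definition _ := [Choice of opalg by <:].
HB.instance Definition _ := [SubChoice_isSubLmodule of opalg by <:].

Implicit Types (T U : opalg) (x y : H).

Lemma opalg_eq T U : (forall x, T x = U x) -> T = U.
Proof. by move=> TU; apply: val_inj; apply/funext. Qed.

Lemma opZ (k : R[i]) T x : (k *: T) x = k *: T x. Proof. by []. Qed.
Lemma opD T U x : (T + U) x = T x + U x. Proof. by []. Qed.
Lemma opB T U x : (T - U) x = T x - U x. Proof. by []. Qed.
Lemma op_linear T : linear T.
Proof. by have /bopsP[] := opfunP T. Qed.

Lemma op_scale T (k : R[i]) x : T (k *: x) = k *: T x.
Proof. exact/linear_scale/op_linear. Qed.

Lemma op_sum (I : Type) (r : seq I) (P : pred I) (F : I -> opalg) x :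
  (\sum_(i <- r | P i) F i) x = \sum_(i <- r | P i) F i x.
Proof. exact: (big_morph (fun T : opalg => T x)). Qed.

Definition opnorm T : R :=
  inf [set c : R | 0 <= c /\ forall x, hnorm (T x) <= c * hnorm x].

Let bounds_ne T : [set c : R | 0 <= c /\ forall x, hnorm (T x) <= c * hnorm x] !=set0.
Proof.
have /bopsP[_ [c cP] _] := opfunP T.
by exists `|c|; split=> //; exact: bound_pos.
Qed.

Lemma opnorm_ge0 T : 0 <= opnorm T.
Proof. by apply: lb_le_inf => // c []. Qed.

Lemma opnorm_bound T x : hnorm (T x) <= opnorm T * hnorm x.
Proof.
have [x0|x0] := eqVneq (hnorm x) 0.
  rewrite x0 mulr0 (hnorm_eq0 x0) -(scale0r (0 : H)) op_scale scale0r hnorm0.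
  exact: lexx.
have x1 : 0 < hnorm x by rewrite lt_neqAle eq_sym x0 hnorm_ge0.
rewrite -ler_pdivrMr //; apply: lb_le_inf => // c [c0 cP].
by rewrite ler_pdivrMr.
Qed.

Lemma opnorm_le T c :
  0 <= c -> (forall x, hnorm (T x) <= c * hnorm x) -> opnorm T <= c.
Proof. by move=> c0 cP; apply: ge_inf; [exists 0 => d [] | split]. Qed.

Lemma opnormD T U : opnorm (T + U) <= opnorm T + opnorm U.
Proof.
apply: opnorm_le => [|x]; first by rewrite addr_ge0 ?opnorm_ge0.
by rewrite opD (le_trans (ler_hnormD _ _)) // mulrDl lerD ?opnorm_bound.
Qed.

Lemma opnorm_eq0 T : opnorm T = 0 -> T = 0.
Proof.
move=> T0; apply: opalg_eq => x; apply: hnorm_eq0; apply: le_anti.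
by rewrite hnorm_ge0 andbT; have := opnorm_bound T x; rewrite T0 mul0r.
Qed.

Lemma normc_ge0 (k : R[i]) : 0 <= Normc.normc k.
Proof. by case: k => a b; rewrite /= sqrtr_ge0. Qed.

Lemma opnormZ (k : R[i]) T : opnorm (k *: T) = Normc.normc k * opnorm T.
Proof.
have le (l : R[i]) U : opnorm (l *: U) <= Normc.normc l * opnorm U.
  apply: opnorm_le => [|x]; first by rewrite mulr_ge0 ?opnorm_ge0 ?normc_ge0.
  by rewrite opZ hnormZ -mulrA ler_wpM2l ?opnorm_bound ?normc_ge0.
apply: le_anti; rewrite le /=.
have [->|k0] := eqVneq k 0; first by rewrite Normc.normc0 mul0r opnorm_ge0.
have k1 : 0 < Normc.normc k.
  rewrite lt_neqAle normc_ge0 andbT eq_sym; apply: contra_neq k0.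
  exact: Normc.eq0_normc.
have := le k^-1 (k *: T); rewrite scalerA mulVf // scale1r Normc.normcV.
by rewrite mulrC ler_pdivlMr // mulrC.
Qed.

Let opnormC_D T U : (opnorm (T + U))%:C <= (opnorm T)%:C + (opnorm U)%:C.
Proof. by rewrite -rmorphD lecR opnormD. Qed.

Let opnormC_Z (k : R[i]) T : (opnorm (k *: T))%:C = `|k| * (opnorm T)%:C.
Proof. by rewrite opnormZ rmorphM. Qed.

Let opnormC_eq0 T : (opnorm T)%:C = 0 -> T = 0.
Proof. by move=> /complexI/opnorm_eq0. Qed.

HB.instance Definition _ :=
  Lmodule_isNormed.Build R[i] opalg opnormC_D opnormC_Z opnormC_eq0.

Lemma rnorm_op T : rnorm T = opnorm T.
Proof. by apply/complexI; rewrite -rnormE. Qed.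

Definition opstar_fun T : H -> H :=
  projT1 (cid (let: And3 _ _ ex := bopsP _ (opfunP T) in ex)).

Lemma opstar_funP T x y : dot (T x) y = dot x (opstar_fun T y).
Proof. by rewrite /opstar_fun; case: cid. Qed.

Lemma opstar_funC T x y : dot (opstar_fun T x) y = dot x (T y).
Proof. by rewrite dotC -opstar_funP dotC. Qed.

Lemma opstar_bops T : opstar_fun T \in bops.
Proof.
apply/bopsP; split.
- move=> k x y; apply: dot_inj => z.
  rewrite opstar_funC !dotDl dot_conj !opstar_funC dot_conj opstar_funC.
  by rewrite op_scale.
- exists (opnorm T) => x; have [->|Sx0] := eqVneq (hnorm (opstar_fun T x)) 0.
    by rewrite mulr_ge0 ?opnorm_ge0 ?hnorm_ge0.
  have Sx1 : 0 < hnorm (opstar_fun T x) by rewrite lt_neqAle eq_sym Sx0 hnorm_ge0.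
  rewrite -(ler_pM2l Sx1) -expr2 hnormE opstar_funC.
  rewrite (le_trans (dot_le _ _)) // (mulrC (hnorm x)) mulrA ler_wpM2r ?hnorm_ge0 //.
  by rewrite mulrC opnorm_bound.
- by exists T => x y; rewrite opstar_funC.
Qed.

Definition opstar T : opalg := OpAlg (opstar_bops T).

Lemma dot_opl T x y : dot (T x) y = dot x (opstar T y).
Proof. exact: opstar_funP. Qed.

Lemma opstar_unique T U : (forall x y, dot (T x) y = dot x (U y)) -> opstar T = U.
Proof.
move=> TU; apply: opalg_eq => x; apply: dot_inj => y.
by rewrite dotC -dot_opl TU dotC.
Qed.

Lemma opcomp_bops T U : (T \o U : H -> H) \in bops.
Proof.
apply/bopsP; split=> [k x y||] /=.
- by rewrite !op_linear.
- exists (opnorm T * opnorm U) => x.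
  rewrite (le_trans (opnorm_bound _ _)) // -mulrA ler_wpM2l ?opnorm_bound //.
  exact: opnorm_ge0.
- by exists (opstar U \o opstar T) => x y /=; rewrite !dot_opl.
Qed.

Definition opcomp T U : opalg := OpAlg (opcomp_bops T U).

Lemma opstarK : involutive opstar.
Proof. by move=> T; apply: opstar_unique => x y; rewrite dotC -dot_opl dotC. Qed.

Lemma opnorm_comp T U : opnorm (opcomp T U) <= opnorm T * opnorm U.
Proof.
apply: opnorm_le => [|x]; first by rewrite mulr_ge0 ?opnorm_ge0.
by rewrite (le_trans (opnorm_bound T (U x))) // -mulrA ler_wpM2l ?opnorm_bound ?opnorm_ge0.
Qed.

(** [|T x|^2 = <T^* T x, x>], hence [|T|^2 <= |T^* T|]. *)
Lemma opnorm_sqr_le T : opnorm T ^+ 2 <= opnorm (opcomp (opstar T) T).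
Proof.
set c := opnorm (opcomp _ _); have c0 : 0 <= c by exact: opnorm_ge0.
rewrite -[leRHS](sqr_sqrtr c0) ler_sqr ?nnegrE ?opnorm_ge0 ?sqrtr_ge0 //.
apply: opnorm_le => [|x]; first exact: sqrtr_ge0.
rewrite hnorm_le ?mulr_ge0 ?sqrtr_ge0 ?hnorm_ge0 // exprMn sqr_sqrtr // dot_opl.
rewrite (le_trans (dot_le _ _)) // expr2 (mulrC (hnorm x)) mulrA.
apply: ler_wpM2r; first exact: hnorm_ge0.
exact: (opnorm_bound (opcomp (opstar T) T)).
Qed.

Lemma opnorm_star_le T : opnorm (opstar T) <= opnorm T.
Proof.
have [->|T0] := eqVneq (opnorm (opstar T)) 0; first exact: opnorm_ge0.
have T1 : 0 < opnorm (opstar T) by rewrite lt_neqAle eq_sym T0 opnorm_ge0.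
rewrite -(ler_pM2r T1) -expr2 (le_trans (opnorm_sqr_le _)) // opstarK.
exact: opnorm_comp.
Qed.

Lemma opnorm_starM T : opnorm (opcomp (opstar T) T) = opnorm T ^+ 2.
Proof.
apply: le_anti; rewrite opnorm_sqr_le andbT (le_trans (opnorm_comp _ _)) //.
by rewrite expr2 ler_wpM2r ?opnorm_ge0 // opnorm_star_le.
Qed.

(** The pointwise limit of a Cauchy sequence of operators is adjointable with
    the limit of the adjoints as its adjoint. *)
Lemma opalg_seq_complete (u : nat -> opalg) :
  (forall e : R, 0 < e -> exists N : nat, forall m n, (N <= m)%N ->
     (N <= n)%N -> opnorm (u m - u n) <= e) ->
  exists L : opalg, forall e : R, 0 < e -> exists N : nat, forall n, (N <= n)%N ->
     opnorm (L - u n) <= e.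
Proof.
have ptlim (v : nat -> opalg) : 
    (forall e : R, 0 < e -> exists N : nat, forall m n, (N <= m)%N ->
       (N <= n)%N -> opnorm (v m - v n) <= e) ->
    {L : H -> H | forall e : R, 0 < e -> exists N : nat, forall n, (N <= n)%N ->
       forall x, hnorm (L x - v n x) <= e * hnorm x}.
  move=> cv.
  have lim x : {l | forall e : R, 0 < e -> exists N : nat, forall n, (N <= n)%N ->
      hnorm (l - v n x) <= e}.
    apply: cid; apply: hnorm_complete => e e0.
    have x1 : 0 < hnorm x + 1 by rewrite ltr_wpDl ?hnorm_ge0.
    have [N NP] := cv (e / (hnorm x + 1)) (divr_gt0 e0 x1).
    exists N => m n Nm Nn; rewrite -opB (le_trans (opnorm_bound _ _)) //.
    rewrite (le_trans (ler_wpM2r (hnorm_ge0 _) (NP _ _ Nm Nn))) //.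
    by rewrite -mulrA ler_piMr ?(ltW e0) // mulrC ler_pdivrMr // mul1r lerDl.
  exists (fun x => projT1 (lim x)) => e e0.
  have [N NP] := cv e e0; exists N => n Nn x; case: (lim x) => l lP /=.
  apply/ler_addgt0Pr => d d0; have [M MP] := lP d d0.
  rewrite (le_trans (ler_hnorm_dist (v (maxn M N) x) _ _)) // addrC lerD //.
    rewrite -opB (le_trans (opnorm_bound _ _)) // ler_wpM2r ?hnorm_ge0 //.
    by rewrite NP // leq_maxr.
  by rewrite MP // leq_maxl.
move=> cu; have [L LP] := ptlim u cu.
have [L' L'P] : {L' : H -> H | forall e : R, 0 < e -> exists N : nat,
    forall n, (N <= n)%N -> forall x, hnorm (L' x - opstar (u n) x) <= e * hnorm x}.
  apply: (ptlim (fun n => opstar (u n))) => e /cu[N NP]; exists N => m n Nm Nn.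
  apply: le_trans (NP _ _ Nm Nn); rewrite (le_trans _ (opnorm_star_le _)) //.
  rewrite le_eqVlt; apply/orP; left; apply/eqP; congr opnorm.
  apply/esym/opstar_unique => x y.
  by rewrite !opB dotBl dotBr !dot_opl.
have adjL x y : dot (L x) y = dot x (L' y).
  apply/eqP; rewrite -subr_eq0; apply/eqP/normr0_eq0/le_anti.
  rewrite normr_ge0 andbT; apply/ler_addgt0Pr => e e0; rewrite add0r.
  set c := hnorm x * hnorm y; have c0 : 0 <= c by rewrite mulr_ge0 ?hnorm_ge0.
  have c1 : 0 < 2 * (c + 1) by rewrite mulr_gt0 // ltr_wpDl.
  have d0 := divr_gt0 e0 c1; set d := e / _ in d0.
  have [N NP] := LP d d0; have [N' NP'] := L'P d d0; set n := maxn N N'.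
  have -> : dot (L x) y - dot x (L' y) =
      dot (L x - u n x) y - dot x (L' y - opstar (u n) y).
    by rewrite dotBl dotBr -dot_opl; ring.
  rewrite (le_trans (ler_normB _ _)) //.
  have -> : e = d * (c + 1) + d * (c + 1) by rewrite /d; field; rewrite gt_eqF // ltr_wpDl.
  have cc : d * c <= d * (c + 1) by rewrite ler_wpM2l ?lerDl // ltW.
  apply: lerD; apply: (le_trans (dot_norm_le _ _)); apply: (le_trans _ cc).
    by rewrite /c mulrA ler_wpM2r ?hnorm_ge0 // NP // leq_maxl.
  by rewrite /c mulrCA ler_wpM2l ?hnorm_ge0 // NP' // leq_maxr.
have bL : L \in bops.
  apply/bopsP; split; last by exists L'.
    move=> k x y; apply/eqP; rewrite -subr_eq0; apply/eqP/hnorm_eq0/le_anti.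
    rewrite hnorm_ge0 andbT; apply/ler_addgt0Pr => e e0; rewrite add0r.
    set c := hnorm (k *: x + y) + (Normc.normc k * hnorm x + hnorm y).
    have c0 : 0 <= c by rewrite !addr_ge0 ?mulr_ge0 ?hnorm_ge0 ?normc_ge0.
    have c1 : 0 < c + 1 by rewrite ltr_wpDl.
    have d0 := divr_gt0 e0 c1; set d := e / _ in d0.
    have [N NP] := LP d d0; pose D z := L z - u N z.
    have -> : L (k *: x + y) - (k *: L x + L y) =
        D (k *: x + y) - (k *: D x + D y).
      rewrite /D op_linear scalerBr addrACA -opprD opprB addrA.
      by rewrite subrK.
    apply: (@le_trans _ _ (d * c)); last first.
      by rewrite /d mulrAC ler_pdivrMr // ler_wpM2l ?lerDl // ltW.
    rewrite (le_trans (ler_hnormD _ _)) // hnormN /c !mulrDr lerD ?NP //.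
    rewrite (le_trans (ler_hnormD _ _)) // hnormZ lerD ?NP //.
    by rewrite mulrCA ler_wpM2l ?normc_ge0 // NP.
  have [N NP] := LP 1 ltr01; exists (1 + opnorm (u N)) => x.
  rewrite -[L x](subrK (u N x)) (le_trans (ler_hnormD _ _)) // mulrDl.
  by rewrite lerD ?opnorm_bound // NP.
exists (OpAlg bL) => e e0; have [N NP] := LP e e0.
by exists N => n Nn; apply: opnorm_le => [|x]; [exact: ltW | exact: NP].
Qed.

Lemma opalg_complete (F : set_system opalg) :
  ProperFilter F -> cauchy F -> cvg F.
Proof.
move=> FF Fc.
have near (e : R) : 0 < e -> exists T0 : opalg, F [set U | opnorm (T0 - U) < e].
  move=> e0; have e0C : 0 < e%:C by rewrite ltcR.
  have [T0 FT0] := (cauchyP F).1 Fc _ e0C.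
  exists T0; apply: filterS FT0 => U; rewrite -ball_normE /= rnormE ltcR.
  by rewrite rnorm_op.
have pos n : 0 < (n.+1%:R : R)^-1 by rewrite invr_gt0 ltr0n.
have [u uP] := choice (fun n => near _ (pos n)).
have inv_le m n : (n <= m)%N -> (m.+1%:R : R)^-1 <= n.+1%:R^-1.
  by move=> nm; rewrite lef_pV2 ?posrE ?ltr0n // ler_nat.
have small (e : R) : 0 < e -> exists n : nat, (n.+1%:R : R)^-1 <= e.
  move=> e0; exists (Num.truncn e^-1).
  by rewrite invf_ple ?posrE // ltW // truncnS_gt.
have [|L LP] := @opalg_seq_complete u.
  move=> e e0; have [N Ne] := small (e / 2) (divr_gt0 e0 (ltr0n _ 2)).
  exists N => m n Nm Nn.
  have [U [mU nU]] := filter_ex (filterI (uP m) (uP n)).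
  rewrite -rnorm_op (le_trans (ler_rnorm_dist U _ _)) // (splitr e) lerD //.
    rewrite rnorm_op (le_trans (ltW mU)) // (le_trans _ Ne) //; exact: inv_le.
  rewrite rnormB rnorm_op (le_trans (ltW nU)) // (le_trans _ Ne) //; exact: inv_le.
apply/cvg_ex; exists L => B /nbhs_rnormP[e e0 eB].
have e2 := divr_gt0 e0 (ltr0n R 2).
have e4 : 0 < e / 4 by rewrite divr_gt0.
have [N Ne] := small _ e4; have [M MP] := LP _ e2.
pose n := maxn N M.
apply: filterS (uP n) => U nU; apply: eB.
rewrite (le_lt_trans (ler_rnorm_dist (u n) _ _)) // (splitr e).
rewrite ler_ltD ?rnorm_op ?MP ?leq_maxr //.
rewrite (lt_le_trans nU) // (le_trans (inv_le _ _ (leq_maxl N M))) //.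
by rewrite (le_trans Ne) // ler_wpM2l ?(ltW e0) // lef_pV2 ?posrE // ler_nat.
Qed.

HB.instance Definition _ := Uniform_isComplete.Build opalg opalg_complete.

Let opcompA : associative opcomp.
Proof. by move=> T U V; apply: opalg_eq. Qed.

Let opcompDl : left_distributive opcomp +%R.
Proof. by move=> T U V; apply: opalg_eq. Qed.

Let opcompDr : right_distributive opcomp +%R.
Proof.
move=> T U V; apply: opalg_eq => x.
by have := op_linear T 1 (U x) (V x); rewrite !scale1r.
Qed.

Let opcompZl (k : R[i]) T U : opcomp (k *: T) U = k *: opcomp T U.
Proof. exact: opalg_eq. Qed.

Let opcompZr (k : R[i]) T U : opcomp T (k *: U) = k *: opcomp T U.
Proof. by apply: opalg_eq => x; rewrite /= op_scale. Qed.

Let opstarD : {morph opstar : T U / T + U}.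
Proof.
move=> T U; apply: opstar_unique => x y.
by rewrite !opD dotDl dotDr !dot_opl.
Qed.

Let opstarZ (k : R[i]) T : opstar (k *: T) = conjc k *: opstar T.
Proof.
apply: opstar_unique => x y.
by rewrite !opZ dot_conjr conjcK -dot_opl op_scale.
Qed.

Let opstarM T U : opstar (opcomp T U) = opcomp (opstar U) (opstar T).
Proof. by apply: opstar_unique => x y /=; rewrite !dot_opl. Qed.

Let opnormM T U : `|opcomp T U| <= `|T| * `|U|.
Proof. by rewrite !rnormE -rmorphM lecR !rnorm_op opnorm_comp. Qed.

Let opnorm_star T : `|opcomp (opstar T) T| = `|T| ^+ 2.
Proof. by rewrite !rnormE -rmorphXn !rnorm_op opnorm_starM. Qed.

HB.instance Definition _ := isCStarAlgebra.Build R opalg opcompA opcompDl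
  opcompDr opcompZl opcompZr opstarK opstarD opstarZ opstarM opnormM opnorm_star.

End OpAlg.

(** Representations on a Hilbert space are contractive: when [|a| < 1], the
    element [1 - a^* a] has a self-adjoint square root [1 - k], so that
    [|x|^2 - |f(a) x|^2 = |x - f(k) x|^2 >= 0]. As [A] need not be unital, [k]
    is obtained as the fixed point of [k |-> (a^* a + k^2) / 2]. *)
Lemma rep_contractive (R : realType) (A : cstarAlgType R) (H : hilbert R)
    (f : A -> opalg H) :
  star_hom f -> forall a, rnorm (f a) <= rnorm a.
Proof.
move=> fP.
suff unit_ball a : rnorm a < 1 -> rnorm (f a) <= 1.
  move=> a; apply/ler_addgt0Pr => e e0.
  have c0 : 0 < rnorm a + e by rewrite ltr_wpDl ?rnorm_ge0.
  have normV : Normc.normc (((rnorm a + e)^-1)%:C : R[i]) = (rnorm a + e)^-1.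
    by rewrite /= expr0n addr0 sqrtr_sqr ger0_norm // invr_ge0 ltW.
  have := unit_ball (((rnorm a + e)^-1)%:C *: a).
  rewrite (homZ fP) !rnormZ normV mulrC ltr_pdivrMr // mul1r ltrDl => /(_ e0).
  by rewrite mulrC ler_pdivrMr // mul1r.
move=> a1; set h := cmul (cstar a) a; set r := rnorm h.
have r0 : 0 <= r by exact: rnorm_ge0.
have r1 : r < 1 by rewrite /r rnorm_starM expr_lt1 ?rnorm_ge0.
pose half : R[i] := (2^-1)%:C.
have normhalf : Normc.normc half = 2^-1.
  by rewrite /= expr0n addr0 sqrtr_sqr ger0_norm // invr_ge0.
have clU : closed [set k : A | rnorm k <= r].
  apply/closed_rnormP => x xP; apply/ler_addgt0Pr => e /xP[y /= yr xy].
  rewrite -[x](subrK y) (le_trans (ler_rnormD _ _)) // addrC lerD //.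
  exact: ltW.
pose F (k : A) : A := half *: (h + cmul k k).
have [k /= kr Fk] : exists2 k : A, rnorm k <= r & F k = k.
  apply: (@contraction_fixpoint _ _ _ F r clU) => /=.
  - by exists 0; rewrite /= rnorm0.
  - by rewrite r0.
  - move=> k kr; rewrite rnormZ normhalf mulrC ler_pdivrMr //.
    rewrite (le_trans (ler_rnormD _ _)) // mulr_natr mulr2n lerD //.
    rewrite (le_trans (rnormM _ _)) // -[leRHS]mulr1.
    by rewrite ler_pM ?rnorm_ge0 // (le_trans kr) // ltW.
  - move=> k l kr lr; rewrite -scalerBr rnormZ normhalf mulrC ler_pdivrMr //.
    rewrite opprD addrACA subrr add0r.
    have -> : cmul k k - cmul l l = cmul k (k - l) + cmul (k - l) l.
      by rewrite cmulBr cmulBl addrA subrK.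
    rewrite (le_trans (ler_rnormD _ _)) // mulr_natr mulr2n lerD //.
      by rewrite (le_trans (rnormM _ _)) // ler_wpM2r ?rnorm_ge0.
    by rewrite (le_trans (rnormM _ _)) // mulrC ler_wpM2r ?rnorm_ge0.
have hh : cstar h = h by rewrite /h cstarM cstarK.
have ks : cstar k = k.
  apply/eqP; rewrite -subr_eq0; apply/eqP/rnorm_eq0/le_anti.
  rewrite rnorm_ge0 andbT.
  have skr : rnorm (cstar k) <= r by rewrite rnorm_star.
  have Fs : F (cstar k) = cstar k.
    rewrite -{2}Fk /F cstarZ cstarD cstarM hh.
    by congr (_ *: _); rewrite /half /= oppr0.
  suff : rnorm (cstar k - k) <= r * rnorm (cstar k - k).
    rewrite -subr_ge0 -{2}[rnorm _]mul1r -mulrBl.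
    have r1' : r - 1 < 0 by rewrite subr_lt0.
    by rewrite nmulr_rge0.
  rewrite -{1}Fs -{2}Fk -scalerBr rnormZ normhalf mulrC ler_pdivrMr //.
  rewrite opprD addrACA subrr add0r.
  have -> : cmul (cstar k) (cstar k) - cmul k k =
      cmul (cstar k) (cstar k - k) + cmul (cstar k - k) k.
    by rewrite cmulBr cmulBl addrA subrK.
  rewrite (le_trans (ler_rnormD _ _)) // mulr_natr mulr2n lerD //.
    by rewrite (le_trans (rnormM _ _)) // ler_wpM2r ?rnorm_ge0.
  by rewrite (le_trans (rnormM _ _)) // mulrC ler_wpM2r ?rnorm_ge0.
have hE : h = k + k - cmul k k.
  apply/eqP; rewrite -subr_eq opprK eq_sym -{1 2}Fk /F -scalerDl -rmorphD.
  have -> : 2^-1 + 2^-1 = 1 :> R by field.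
  by rewrite rmorph1 scale1r.
rewrite rnorm_op; apply: opnorm_le => // x; rewrite mul1r.
rewrite hnorm_le ?hnorm_ge0 // hnormE.
have -> : dot (f a x) (f a x) = dot x (f h x).
  by rewrite dot_opl /h (homM fP) (hom_star fP).
have fhx : f h x = f k x + f k x - f k (f k x).
  by rewrite hE (homB fP) (homD fP) (homM fP).
have kk y z : dot y (f k z) = dot (f k y) z.
  by rewrite dot_opl -[opstar _]/(cstar _) -(hom_star fP) ks.
have := dot_ge0 (x - f k x); rewrite fhx dotBl !dotBr dotDr -(kk x x) -kk.
by move=> le0; lra.
Qed.

(** * The Hilbert space of square summable functions *)

Section Sums.
Variables (R : realType) (S : eqType).
Implicit Types (f g : S -> R) (s t : seq S).

(** Unconditional summability along the finite sets of indices, represented by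
    duplicate-free sequences. *)
Definition has_sum f (l : R) : Prop := forall e : R, 0 < e ->
  exists s0 : seq S, forall s, uniq s -> {subset s0 <= s} ->
    `|\sum_(i <- s) f i - l| <= e.

Lemma has_sum_uniq f l m : has_sum f l -> has_sum f m -> l = m.
Proof.
move=> fl fm; apply/eqP; rewrite -subr_eq0; apply/eqP/normr0_eq0/le_anti.
rewrite normr_ge0 andbT; apply/ler_addgt0Pr => e e0; rewrite add0r.
have [s sP] := fl _ (divr_gt0 e0 (ltr0n _ 2)).
have [t tP] := fm _ (divr_gt0 e0 (ltr0n _ 2)).
pose u := undup (s ++ t).
have ul : {subset s <= u} by move=> i si; rewrite mem_undup mem_cat si.
have ur : {subset t <= u} by move=> i ti; rewrite mem_undup mem_cat ti orbT.
rewrite (le_trans (ler_distD (\sum_(i <- u) f i) _ _)) // (splitr e).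
by rewrite lerD ?tP ?undup_uniq // distrC sP ?undup_uniq.
Qed.

Lemma has_sumD f g l m : has_sum f l -> has_sum g m ->
  has_sum (fun i => f i + g i) (l + m).
Proof.
move=> fl gm e e0; have [s sP] := fl _ (divr_gt0 e0 (ltr0n _ 2)).
have [t tP] := gm _ (divr_gt0 e0 (ltr0n _ 2)).
exists (s ++ t) => u uu stu; rewrite big_split /= opprD addrACA.
rewrite (le_trans (ler_normD _ _)) // (splitr e) lerD ?sP ?tP // => i iP.
  by rewrite stu // mem_cat iP.
by rewrite stu // mem_cat iP orbT.
Qed.

Lemma has_sumZ (k : R) f l : has_sum f l -> has_sum (fun i => k * f i) (k * l).
Proof.
move=> fl e e0; have k0 : 0 < `|k| + 1 by rewrite ltr_wpDl.
have [s sP] := fl _ (divr_gt0 e0 k0); exists s => u uu su.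
rewrite -mulr_sumr -mulrBr normrM.
apply: (@le_trans _ _ ((`|k| + 1) * `|\sum_(i <- u) f i - l|)).
  by rewrite ler_wpM2r // lerDl.
by rewrite mulrC -ler_pdivlMr // sP.
Qed.

Lemma has_sum_eq f g l : f =1 g -> has_sum f l -> has_sum g l.
Proof. by move=> /funext ->. Qed.

Lemma ler_sum_subset f s t : (forall i, 0 <= f i) -> uniq s -> uniq t ->
  {subset s <= t} -> \sum_(i <- s) f i <= \sum_(i <- t) f i.
Proof.
move=> f0 us ut st.
have pst : perm_eq [seq i <- t | i \in s] s.
  apply: uniq_perm => //; first exact: filter_uniq.
  by move=> i; rewrite mem_filter andb_idr //; exact: st.
by rewrite -(perm_big _ pst) big_filter [leRHS](bigID (mem s)) /= lerDl sumr_ge0.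
Qed.

Lemma has_sum_ge f l s : (forall i, 0 <= f i) -> has_sum f l -> uniq s ->
  \sum_(i <- s) f i <= l.
Proof.
move=> f0 fl us; apply/ler_addgt0Pr => e /fl[t tP].
pose u := undup (s ++ t).
have /tP : uniq u by exact: undup_uniq.
have ul : {subset s <= u} by move=> i si; rewrite mem_undup mem_cat si.
have ur : {subset t <= u} by move=> i ti; rewrite mem_undup mem_cat ti orbT.
move=> /(_ ur); rewrite ler_distl => /andP[_]; apply: le_trans.
by apply: ler_sum_subset; rewrite ?undup_uniq.
Qed.

Lemma has_sum_le f l c : has_sum f l ->
  (forall s, uniq s -> \sum_(i <- s) f i <= c) -> l <= c.
Proof.
move=> fl fc; apply/ler_addgt0Pr => e /fl[s sP].
have := sP (undup s) (undup_uniq s); rewrite ler_distl => /(_ _)/andP[|le _].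
  by move=> i; rewrite mem_undup.
by rewrite -lerBlDr (le_trans le) // fc // undup_uniq.
Qed.

Lemma has_sum_bounded f c : (forall i, 0 <= f i) ->
  (forall s, uniq s -> \sum_(i <- s) f i <= c) -> exists l, has_sum f l.
Proof.
move=> f0 fc; pose E := [set \sum_(i <- s) f i | s in [set s | uniq s]].
have supE : has_sup E.
  split; first by exists (\sum_(i <- [::]) f i); exists [::].
  by exists c => _ [s us <-]; exact: fc.
exists (sup E) => e e0; have [_ [s us <-] lts] := sup_adherent e0 supE.
exists s => t ut st; rewrite ler_distl; apply/andP; split.
  by rewrite (le_trans (ltW lts)) // ler_sum_subset.
apply: (@le_trans _ _ (sup E)); last by rewrite lerDl ltW.
by apply: ub_le_sup; [case: supE | exists t].
Qed.

End Sums.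

Section L2.
Variables (R : realType) (S : eqType).

Definition cdot (z w : R[i]) : R :=
  complex.Re z * complex.Re w + complex.Im z * complex.Im w.

Lemma cdot_ge0 z : 0 <= cdot z z.
Proof. by rewrite addr_ge0 // -expr2 sqr_ge0. Qed.

Lemma cdotZZ (k z : R[i]) : cdot (k * z) (k * z) = cdot k k * cdot z z.
Proof. by case: k z => a b [c d]; rewrite /cdot /=; ring. Qed.

Lemma cdotDD z w : cdot (z + w) (z + w) <= 2 * cdot z z + 2 * cdot w w.
Proof.
have := cdot_ge0 (z - w); case: z w => a b [c d]; rewrite /cdot /= => h.
by lra.
Qed.

Lemma cdot_polar z w :
  cdot z w = 4^-1 * (cdot (z + w) (z + w) + - 1 * cdot (z - w) (z - w)).
Proof. by case: z w => a b [c d]; rewrite /cdot /=; field. Qed.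

Definition square_summable (x : S -> R[i]) : Prop :=
  exists c, forall s, uniq s -> \sum_(i <- s) cdot (x i) (x i) <= c.

Definition l2fun : {pred S -> R[i]} := [pred x | `[< square_summable x >]].

Lemma l2funP x : reflect (square_summable x) (x \in l2fun).
Proof. exact: asboolP. Qed.

Lemma l2fun_submod : submod_closed l2fun.
Proof.
split=> [|k x y /l2funP[c xc] /l2funP[d yd]]; apply/l2funP.
  by exists 0 => s _; rewrite big1 // => i _; rewrite /cdot /= mulr0 addr0.
exists (2 * (cdot k k * c) + 2 * d) => s us.
apply: (@le_trans _ _ (\sum_(i <- s)
    (2 * (cdot k k * cdot (x i) (x i)) + 2 * cdot (y i) (y i)))).
  by apply: ler_sum => i _; rewrite -cdotZZ; exact: cdotDD.
rewrite big_split /= -!mulr_sumr lerD // ler_wpM2l // ?yd //.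
by rewrite ler_wpM2l ?cdot_ge0 // xc.
Qed.

HB.instance Definition _ :=
  GRing.isSubmodClosed.Build R[i] (S -> R[i]) l2fun l2fun_submod.

Record l2 := L2 { l2val :> S -> R[i]; l2valP : l2val \in l2fun }.

HB.instance Definition _ := [isSub for l2val].
HB.instance Definition _ := [Choice of l2 by <:].
HB.instance Definition _ := [SubChoice_isSubLmodule of l2 by <:].

Implicit Types x y : l2.

Lemma l2_eq x y : (forall i, x i = y i) -> x = y.
Proof. by move=> xy; apply: val_inj; apply/funext. Qed.

Lemma l2D x y i : (x + y) i = x i + y i. Proof. by []. Qed.
Lemma l2B x y i : (x - y) i = x i - y i. Proof. by []. Qed.
Lemma l2Z (k : R[i]) x i : (k *: x) i = k * x i. Proof. by []. Qed.

Lemma has_sum_square x : exists l, has_sum (fun i => cdot (x i) (x i)) l.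
Proof.
have /l2funP[c xc] := l2valP x.
by apply: (has_sum_bounded _ xc) => i; exact: cdot_ge0.
Qed.

Lemma has_sum_cdot x y : exists l, has_sum (fun i => cdot (x i) (y i)) l.
Proof.
have [l lP] := has_sum_square (x + y); have [m mP] := has_sum_square (x - y).
exists (4^-1 * (l + - 1 * m)).
apply: has_sum_eq (has_sumZ _ (has_sumD lP (has_sumZ (- 1) mP))) => i.
by rewrite [RHS]cdot_polar.
Qed.

Definition l2dot x y : R := projT1 (cid (has_sum_cdot x y)).

Lemma l2dotP x y : has_sum (fun i => cdot (x i) (y i)) (l2dot x y).
Proof. by rewrite /l2dot; case: cid. Qed.

Lemma l2dot_eq x y l : has_sum (fun i => cdot (x i) (y i)) l -> l2dot x y = l.
Proof. by apply: has_sum_uniq; exact: l2dotP. Qed.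

Lemma l2dotC x y : l2dot x y = l2dot y x.
Proof.
apply: l2dot_eq; apply: has_sum_eq (l2dotP y x) => i.
by rewrite /cdot mulrC (mulrC (complex.Im _)).
Qed.

Lemma l2dotDl x y z : l2dot (x + y) z = l2dot x z + l2dot y z.
Proof.
apply: l2dot_eq; apply: has_sum_eq (has_sumD (l2dotP x z) (l2dotP y z)) => i.
by rewrite l2D; case: (x i) (y i) => a b [c d]; rewrite /cdot /=; ring.
Qed.

Lemma l2dotZl (k : R) x y : l2dot (k%:C *: x) y = k * l2dot x y.
Proof.
apply: l2dot_eq; apply: has_sum_eq (has_sumZ k (l2dotP x y)) => i.
by rewrite l2Z; case: (x i) => a b; rewrite /cdot /=; ring.
Qed.

Lemma l2dot_conj (k : R[i]) x y : l2dot (k *: x) y = l2dot x (conjc k *: y).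
Proof.
apply: l2dot_eq; apply: has_sum_eq (l2dotP x (conjc k *: y)) => i.
rewrite !l2Z; case: k (x i) (y i) => a b [c d] [c' d'].
by rewrite /cdot /=; ring.
Qed.

Lemma l2_le_dot x s : uniq s -> \sum_(i <- s) cdot (x i) (x i) <= l2dot x x.
Proof. by apply: has_sum_ge (l2dotP x x) => i; exact: cdot_ge0. Qed.

Lemma cdot_le_l2dot x i : cdot (x i) (x i) <= l2dot x x.
Proof. by have := @l2_le_dot x [:: i] isT; rewrite big_seq1. Qed.

Lemma l2dot_ge0 x : 0 <= l2dot x x.
Proof. by have := @l2_le_dot x [::] isT; rewrite big_nil. Qed.

Lemma cdot_eq0 z : cdot z z <= 0 -> z = 0.
Proof.
case: z => a b; rewrite /cdot /= -!expr2 => le0.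
have a0 := sqr_ge0 a; have b0 := sqr_ge0 b.
have /eqP : a ^+ 2 = 0 by lra.
have /eqP : b ^+ 2 = 0 by lra.
by rewrite !sqrf_eq0 => /eqP -> /eqP ->.
Qed.

Lemma l2dot_eq0 x : l2dot x x = 0 -> x = 0.
Proof.
by move=> x0; apply: l2_eq => i; apply: cdot_eq0; rewrite -x0 cdot_le_l2dot.
Qed.

Lemma real_seq_complete (v : nat -> R) :
  (forall e : R, 0 < e -> exists N : nat, forall m n, (N <= m)%N ->
     (N <= n)%N -> (v m - v n) ^+ 2 <= e) ->
  {l : R | v @ \oo --> l}.
Proof.
move=> vc; apply: cid; apply/cvg_ex; apply: cauchy_cvg; apply: cauchy_exP => e e0.
have [|N NP] := vc ((e / 2) ^+ 2); first by rewrite exprn_gt0 // divr_gt0.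
exists (v N), N => // n /= Nn; rewrite -ball_normE /=.
have := NP N n (leqnn N) Nn.
rewrite -[_ ^+ 2 in X in X <= _]real_normK ?num_real // ler_sqr ?nnegrE; last first.
- by rewrite divr_ge0 // ltW.
- exact: normr_ge0.
by move/le_lt_trans; apply; rewrite ltr_pdivrMr // ltr_pMr // ltr1n.
Qed.

Lemma l2_complete (u : nat -> l2) :
  (forall e : R, 0 < e -> exists N : nat, forall m n, (N <= m)%N ->
     (N <= n)%N -> l2dot (u m - u n) (u m - u n) <= e) ->
  exists l, forall e : R, 0 < e -> exists N : nat, forall n, (N <= n)%N ->
     l2dot (l - u n) (l - u n) <= e.
Proof.
move=> uc.
have cvgRe i : {l : R | (fun n => complex.Re (u n i)) @ \oo --> l}.
  apply: real_seq_complete => e /uc[N NP]; exists N => m n Nm Nn.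
  apply: le_trans (NP _ _ Nm Nn); apply: le_trans (cdot_le_l2dot _ i).
  rewrite l2B /cdot; case: (u m i) (u n i) => a b [c d] /=.
  by have := sqr_ge0 (b - d); lra.
have cvgIm i : {l : R | (fun n => complex.Im (u n i)) @ \oo --> l}.
  apply: real_seq_complete => e /uc[N NP]; exists N => m n Nm Nn.
  apply: le_trans (NP _ _ Nm Nn); apply: le_trans (cdot_le_l2dot _ i).
  rewrite l2B /cdot; case: (u m i) (u n i) => a b [c d] /=.
  by have := sqr_ge0 (a - c); lra.
pose L i : R[i] := projT1 (cvgRe i) +i* projT1 (cvgIm i).
have partial (e : R) n s : 
    (\forall m \near \oo, l2dot (u m - u n) (u m - u n) <= e) -> uniq s ->
    \sum_(i <- s) cdot (L i - u n i) (L i - u n i) <= e.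
  move=> near_e us.
  suff cvgs : (fun m => \sum_(i <- s) cdot (u m i - u n i) (u m i - u n i)) @ \oo
      --> \sum_(i <- s) cdot (L i - u n i) (L i - u n i).
    apply: (cvgr_to_le cvgs); apply: filterS near_e => m; apply: le_trans.
    exact: (l2_le_dot (u m - u n)).
  elim: s {us} => [|i s IHs].
    by under eq_cvg do rewrite big_nil; rewrite big_nil; exact: cvg_cst.
  under eq_cvg do rewrite big_cons; rewrite big_cons; apply: cvgD => // {IHs}.
  rewrite /cdot /L; case: (cvgRe i) (cvgIm i) => a ca [b cb] /=.
  have reB (z w : R[i]) : complex.Re (z - w) = complex.Re z - complex.Re w.
    by case: z w => ? ? [? ?].
  have imB (z w : R[i]) : complex.Im (z - w) = complex.Im z - complex.Im w.
    by case: z w => ? ? [? ?].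
  under eq_cvg do rewrite !reB !imB; rewrite !reB !imB /=.
  by apply: cvgD; apply: cvgM; apply: cvgB => //; exact: cvg_cst.
have near_small (e : R) : 0 < e -> exists N : nat, forall n, (N <= n)%N ->
    \forall m \near \oo, l2dot (u m - u n) (u m - u n) <= e.
  by move=> /uc[N NP]; exists N => n Nn; exists N => // m /= Nm; exact: NP.
have Ll2 : L \in l2fun.
  have [N /(_ N (leqnn N)) NP] := near_small 1 ltr01.
  have LN : (fun i => L i - u N i) \in l2fun.
    by apply/l2funP; exists 1 => s; exact: partial.
  have -> : L = (L2 LN + u N : l2).
    by apply/funext => i; rewrite l2D subrK.
  exact: l2valP.
exists (L2 Ll2) => e /near_small[N NP]; exists N => n Nn.
by apply: has_sum_le (l2dotP _ _) _ => s us; exact: partial (NP n Nn) us.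
Qed.

Definition l2_hilbert : hilbert R :=
  Hilbert l2dotC l2dotDl l2dotZl l2dot_conj l2dot_ge0 l2dot_eq0 l2_complete.

End L2.

(** * Partial isometries from partial injections *)

Record pinj (S : Type) := Pinj {
  prel :> S -> S -> Prop;
  prel_fun : forall y z z', prel y z -> prel y z' -> z = z';
  prel_inj : forall y y' z, prel y z -> prel y' z -> y = y' }.

Section PinjOperators.
Variables (R : realType) (S : eqType).
Implicit Types (r : pinj S) (x : l2 R S).

Definition pinv r : pinj S :=
  Pinj (fun y z z' h h' => @prel_inj _ r z z' y h h')
       (fun y y' z h h' => @prel_fun _ r z y y' h h').

Lemma pcomp_fun (q r : pinj S) y z z' : (exists2 u, r y u & q u z) ->
  (exists2 u, r y u & q u z') -> z = z'.
Proof.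
move=> [u yu uz] [u' yu' uz']; rewrite -(prel_fun yu yu') in uz'.
exact: prel_fun uz uz'.
Qed.

Lemma pcomp_inj (q r : pinj S) y y' z : (exists2 u, r y u & q u z) ->
  (exists2 u, r y' u & q u z) -> y = y'.
Proof.
move=> [u yu uz] [u' yu' uz']; rewrite -(prel_inj uz uz') in yu'.
exact: prel_inj yu yu'.
Qed.

Definition pcomp (q r : pinj S) : pinj S := Pinj (@pcomp_fun q r) (@pcomp_inj q r).

Lemma pdiag_fun (D : set S) (y z z' : S) : D y /\ y = z -> D y /\ y = z' -> z = z'.
Proof. by move=> [_ <-] [_ <-]. Qed.

Lemma pdiag_inj (D : set S) (y y' z : S) : D y /\ y = z -> D y' /\ y' = z -> y = y'.
Proof. by move=> [_ ->] [_ ->]. Qed.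

Definition pdiag (D : set S) : pinj S := Pinj (@pdiag_fun D) (@pdiag_inj D).

Definition preimage r (z : S) : option S :=
  if pselect (exists y, r y z) is left ex then Some (projT1 (cid ex)) else None.

Lemma preimageP r y z : preimage r z = Some y <-> r y z.
Proof.
rewrite /preimage; case: pselect => [ex|nex]; last first.
  by split=> // yz; case: nex; exists y.
case: (cid ex) => y' y'z /=; split=> [[<-//]|yz].
by rewrite (prel_inj y'z yz).
Qed.

Lemma preimageN r z : (forall y, ~ r y z) -> preimage r z = None.
Proof.
by move=> nz; case E: (preimage r z) => [y|//]; move/preimageP/nz: E.
Qed.

Lemma sum_preimage (V : nmodType) r (h : S -> V) s :
  \sum_(z <- s) oapp h 0 (preimage r z) = \sum_(y <- pmap (preimage r) s) h y.
Proof.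
elim: s => [|z s IHs]; first by rewrite !big_nil.
by rewrite big_cons IHs /=; case: preimage => [y|] /=; rewrite ?big_cons ?add0r.
Qed.

Lemma mem_pmap_preimage r y s :
  reflect (exists2 z, z \in s & r y z) (y \in pmap (preimage r) s).
Proof.
rewrite mem_pmap; apply: (iffP mapP) => -[z zs].
  by move=> /esym/preimageP; exists z.
by move=> /preimageP <-; exists z.
Qed.

Lemma uniq_pmap_preimage r s : uniq s -> uniq (pmap (preimage r) s).
Proof.
elim: s => [//|z s IHs] /= /andP[zs us].
case E: (preimage r z) => [y|] /=; last exact: IHs.
rewrite IHs // andbT; apply/negP => /mem_pmap_preimage[z' z's yz'].
by move/preimageP: E => yz; rewrite (prel_fun yz yz') z's in zs.
Qed.

(** Reindexing along [r]: the terms outside the domain of [r] vanish, so only the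
    images under [r] of a large finite set of indices matter. *)
Lemma has_sum_preimage r (h : S -> R) l : (forall y, (forall z, ~ r y z) -> h y = 0) ->
  has_sum h l -> has_sum (fun z => oapp h 0 (preimage r z)) l.
Proof.
move=> h0 hl e e0; have [s0 s0P] := hl e e0.
exists (pmap (preimage (pinv r)) s0) => t ut sub.
set u := pmap (preimage r) t; rewrite sum_preimage -/u.
pose u' := u ++ [seq i <- undup s0 | i \notin u].
have uu : uniq u by exact: uniq_pmap_preimage.
have -> : \sum_(y <- u) h y = \sum_(y <- u') h y.
  rewrite big_cat /= [X in _ + X]big1_seq ?addr0 // => y.
  rewrite /= mem_filter => /andP[yu]; rewrite mem_undup => ys.
  apply: h0 => z yz; case/negP: yu; apply/mem_pmap_preimage; exists z => //.
  by apply: sub; apply/mem_pmap_preimage; exists y.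
apply: s0P; last first.
  by move=> y ys; rewrite mem_cat mem_filter mem_undup ys andbT orbN.
rewrite cat_uniq uu filter_uniq ?undup_uniq // andbT /=.
by apply/hasPn => y; rewrite mem_filter => /andP[].
Qed.

Definition pop_fun r (x : S -> R[i]) (z : S) : R[i] := oapp x 0 (preimage r z).

Lemma cdot_pop_fun r x z :
  cdot (pop_fun r x z) (pop_fun r x z) = oapp (fun y => cdot (x y) (x y)) 0 (preimage r z).
Proof.
by rewrite /pop_fun; case: preimage => [y|] //=; rewrite /cdot /= mulr0 addr0.
Qed.

Lemma pop_fun_le r x s : uniq s ->
  \sum_(z <- s) cdot (pop_fun r x z) (pop_fun r x z) <= l2dot x x.
Proof.
move=> us; under eq_bigr do rewrite cdot_pop_fun.
by rewrite (sum_preimage r (fun y => cdot (x y) (x y))) l2_le_dot // uniq_pmap_preimage.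
Qed.

Lemma pop_l2 r x : pop_fun r x \in @l2fun R S.
Proof. by apply/l2funP; exists (l2dot x x) => s; exact: pop_fun_le. Qed.

Definition pop_l2fun r x : l2 R S := L2 (pop_l2 r x).

Lemma pop_adjoint r x y : l2dot (pop_l2fun r x) y = l2dot x (pop_l2fun (pinv r) y).
Proof.
have h0 u : (forall z, ~ r u z) -> cdot (x u) (pop_fun (pinv r) y u) = 0.
  by move=> nu; rewrite /pop_fun preimageN //= /cdot /= !mulr0 addr0.
apply: l2dot_eq.
apply: has_sum_eq (has_sum_preimage h0 (l2dotP x (pop_l2fun (pinv r) y))) => z.
rewrite /= /pop_fun; case E: (preimage r z) => [u|] /=; last first.
  by rewrite /cdot /= !mul0r addr0.
move/preimageP: E => uz.
by have /preimageP -> /= : pinv r z u by [].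
Qed.

Lemma pop_bops r :
  (pop_l2fun r : l2_hilbert R S -> l2_hilbert R S) \in @bops R (l2_hilbert R S).
Proof.
apply/bopsP; split.
- move=> k x y; apply: l2_eq => z; rewrite [RHS]l2D [X in _ = X + _]l2Z /= /pop_fun.
  by case: preimage => [u|] //=; rewrite mulr0 addr0.
- exists 1 => x; rewrite hnorm_le ?mul1r ?hnorm_ge0 // hnormE.
  by apply: (has_sum_le (l2dotP _ _)) => s us; exact: pop_fun_le.
- by exists (pop_l2fun (pinv r)) => x y; exact: pop_adjoint.
Qed.

(** The operator that moves the point mass at [y] to the point mass at [z] when
    [r y z], and kills the point masses outside the domain of [r]. *)
Definition pop r : opalg (l2_hilbert R S) := OpAlg (pop_bops r).

Lemma popE r (x : l2_hilbert R S) y z : r y z -> (pop r x : l2 R S) z = (x : l2 R S) y.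
Proof. by move=> /preimageP yz; rewrite /= /pop_fun yz. Qed.

Lemma pop0 r (x : l2_hilbert R S) z : (forall y, ~ r y z) -> (pop r x : l2 R S) z = 0.
Proof. by move=> nz; rewrite /= /pop_fun preimageN. Qed.

Lemma pop_ext (q r : pinj S) : (forall y z, q y z <-> r y z) -> pop q = pop r.
Proof.
move=> qr; apply: opalg_eq => x; apply: l2_eq => z.
have [[y yz]|nz] := pselect (exists y, q y z).
  by rewrite (popE _ yz) (@popE r _ y) //; apply/qr.
by rewrite !pop0 // => y yz; apply: nz; exists y => //; apply/qr.
Qed.

Lemma pop_star r : cstar (pop r) = pop (pinv r).
Proof. by apply: opstar_unique => x y; exact: pop_adjoint. Qed.

Lemma pop_mul (q r : pinj S) : cmul (pop q) (pop r) = pop (pcomp q r).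
Proof.
apply: opalg_eq => x; apply: l2_eq => z; rewrite -[opfun (cmul _ _) x]/(pop q (pop r x)).
have [[u uz]|nz] := pselect (exists u, q u z); last first.
  by rewrite !pop0 // => y; [move=> [u _ uz]|move=> yz]; apply: nz; [exists u|exists y].
rewrite (popE _ uz); have [[y yu]|ny] := pselect (exists y, r y u).
  by rewrite (popE _ yu) (@popE _ _ y) //; exists u.
rewrite !pop0 // => y => [[u' yu' u'z]|yu]; last by apply: ny; exists y.
by apply: ny; exists y; rewrite (prel_inj uz u'z).
Qed.

Lemma pop_eq0 r : (forall y z, ~ r y z) -> pop r = 0.
Proof. by move=> r0; apply: opalg_eq => x; apply: l2_eq => z; rewrite pop0. Qed.

Lemma pop_sum (I : finType) (P : pred I) (r : I -> pinj S) (q : pinj S) :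
  (forall y z, q y z <-> exists2 i, P i & r i y z) ->
  (forall i j y z, P i -> P j -> r i y z -> r j y z -> i = j) ->
  \sum_(i | P i) pop (r i) = pop q.
Proof.
move=> qr disj; apply: opalg_eq => x; apply: l2_eq => z; rewrite op_sum.
rewrite (big_morph (fun x : l2_hilbert R S => (x : l2 R S) z) (id1 := 0) (op1 := +%R)) //.
have [[y yz]|nz] := pselect (exists y, q y z).
  rewrite (popE _ yz); have /qr[i Pi iyz] := yz.
  rewrite (bigD1 i Pi) -[RHS]addr0.
  congr (_ + _); first exact: popE.
  rewrite big1 // => j /andP[Pj ji].
  rewrite pop0 // => y' jyz.
  have yy : y = y' by apply: (@prel_inj _ q _ _ z) => //; apply/qr; exists j.
  by rewrite -yy in jyz; rewrite (disj _ _ _ _ Pi Pj iyz jyz) eqxx in ji.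
rewrite pop0 => [|y yz]; last by apply: nz; exists y.
rewrite big1 // => i Pi;  rewrite pop0 // => y yz.
by apply: nz; exists y; apply/qr; exists i.
Qed.

End PinjOperators.

(** * Dynamical systems along the canonical sequence *)

Section NextGraph.
Variable G : bipSepGraph.

Lemma block_eq (u : bvert0 G) (X Y : block u) x : x \in val X -> x \in val Y -> X = Y.
Proof.
have /and3P[_ /finset.trivIsetP triv _] := bsepP u.
move=> xX xY; apply/val_inj/eqP; apply: contraT => /(triv _ _ (valP X) (valP Y)).
by rewrite -setI_eq0 => /eqP/setP/(_ x); rewrite !inE xX xY.
Qed.

Lemma next_edge_eq (a b : next_edge G) :
  next_src a = next_src b -> marked a = marked b -> a = b.
Proof.
case: a b => [v X] [w Y]; rewrite /next_src /= => vw.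
case: w / vw Y => Y; rewrite /marked /= => xy; congr existT.
apply: block_eq (valP ((tagged v : choices (tag v)) X)) _.
have cY x : x = val ((tagged v : choices (tag v)) Y) -> x \in val Y.
  by move=> ->; exact: valP.
exact: cY xy.
Qed.

Lemma block_edge (u : bvert0 G) (X : block u) x : x \in val X -> brng x = u.
Proof.
move=> xX; have /and3P[/eqP cov _ _] := bsepP u.
have : x \in finset.cover (bsep u).
  by apply/finset.bigcupP; exists (val X); [exact: (valP X)|].
by rewrite cov inE => /eqP.
Qed.

Lemma brng_marked (a : next_edge G) : brng (marked a) = tag (next_src a).
Proof. by case: a => [v X]; apply: (@block_edge _ X); exact: valP. Qed.

End NextGraph.

(** A dynamical system without its topology, the homeomorphisms being encoded as
    partial injections of the whole space. *)
Record setSystem (G : bipSepGraph) (S : Type) := SetSystem {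
  sv : vert G -> set S;
  sr : edge G -> pinj S;
  sv_disj : forall v w y, sv v y -> sv w y -> v = w;
  sr_dom : forall e y, sv (src e) y <-> exists z, sr e y z;
  sr_rng : forall e y z, sr e y z -> sv (rng e) z;
  sr_cover : forall (u : bvert0 G) X z, X \in bsep u -> sv (inl u) z ->
    exists2 e, e \in X & exists y, sr e y z;
  sr_disj : forall (u : bvert0 G) X e f y y' z, X \in bsep u -> e \in X ->
    f \in X -> sr e y z -> sr f y' z -> e = f }.

Section NextSystem.
Variables (G : bipSepGraph) (S : Type) (Y : setSystem G S).

Definition next_sv (w : vert (next_graph G)) : set S :=
  match w with
  | inl w => sv Y (inr w)
  | inr v => [set z | forall X : block (tag v),
      exists y, sr Y (val ((tagged v : choices (tag v)) X)) y z]
  end.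

Lemma next_sr_fun (a : next_edge G) (y z z' : S) :
  next_sv (inr (next_src a)) y /\ sr Y (marked a) z y ->
  next_sv (inr (next_src a)) y /\ sr Y (marked a) z' y -> z = z'.
Proof. by move=> [_ h] [_ h']; exact: prel_inj h h'. Qed.

Lemma next_sr_inj (a : next_edge G) (y y' z : S) :
  next_sv (inr (next_src a)) y /\ sr Y (marked a) z y ->
  next_sv (inr (next_src a)) y' /\ sr Y (marked a) z y' -> y = y'.
Proof. by move=> [_ h] [_ h']; exact: prel_fun h h'. Qed.

Definition next_sr (a : edge (next_graph G)) : pinj S :=
  Pinj (@next_sr_fun a) (@next_sr_inj a).

Lemma next_sv_tag (v : next_vert1 G) z : next_sv (inr v) z -> sv Y (inl (tag v)) z.
Proof.
case: v => u c /= cz; have [x xu] := brng_surj u; case: u / xu c cz => c cz.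
have [X _] := block_of_edge x; have [y yz] := cz X.
by have := sr_rng yz; rewrite /= (block_edge (valP (c X))).
Qed.

Lemma next_sv_inr_inj (v w : next_vert1 G) z :
  next_sv (inr v) z -> next_sv (inr w) z -> v = w.
Proof.
move=> vz wz; have := sv_disj (next_sv_tag vz) (next_sv_tag wz).
case: v w vz wz => [u c] [u' c'] /= cz cz' [uu]; case: u' / uu c' cz' => c' cz'.
congr existT; apply/ffunP => X; apply: val_inj.
have [y yz] := cz X; have [y' yz'] := cz' X.
exact: (sr_disj (valP X) (valP (c X)) (valP (c' X)) yz yz').
Qed.

Lemma next_sv_disj v w y : next_sv v y -> next_sv w y -> v = w.
Proof.
case: v w => [v|v] [w|w] vy wy.
- by case: (sv_disj vy wy) => ->.
- by case: (sv_disj vy (next_sv_tag wy)).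
- by case: (sv_disj (next_sv_tag vy) wy).
- by rewrite (next_sv_inr_inj vy wy).
Qed.

Lemma next_sr_dom (a : edge (next_graph G)) y :
  next_sv (src a) y <-> exists z, next_sr a y z.
Proof.
split=> [ay|[z []]] //; have [z zy] := ay (tagged a).
by exists z; split.
Qed.

Lemma next_sr_rng (a : edge (next_graph G)) y z : next_sr a y z -> next_sv (rng a) z.
Proof. by move=> [_ zy]; apply/sr_dom; exists y. Qed.

(** The point [y] lies in the range of [x] and, for every other block at the range
    of [x], in the range of exactly one of its edges; these edges form the tuple
    of the required edge. *)
Lemma next_sr_exists x y z : sr Y x z y ->
  exists2 a : next_edge G, marked a = x & next_sr a y z.
Proof.
move=> zy; have yx : sv Y (inl (brng x)) y by exact: sr_rng zy.
have ex (X : block (brng x)) :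
    {e : {e : bedge G | e \in val X} | exists z, sr Y (val e) z y}.
  apply: cid; have [e eX ey] := sr_cover (valP X) yx.
  by exists (exist _ e eX).
pose c : choices (brng x) := finfun (fun X => projT1 (ex X)).
have cP X : exists z, sr Y (val (c X)) z y by rewrite ffunE; case: (ex X).
have [X xX] := block_of_edge x.
pose v : next_vert1 G := existT _ (brng x) c.
pose a : next_edge G := existT (fun v : next_vert1 G => block (tag v)) v X.
have ax : marked a = x.
  have [z' zy'] := cP X.
  exact: (sr_disj (valP X) (valP (c X)) xX zy' zy).
by exists a => //; split; [exact: cP | rewrite ax].
Qed.

Lemma next_sr_cover (w : bvert0 (next_graph G)) X z : X \in bsep w ->
  next_sv (inl w) z -> exists2 a, a \in X & exists y, next_sr a y z.
Proof.
move=> /imsetP[x]; rewrite inE => /eqP <- -> /(sr_dom Y x) [y zy].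
have [a ax ayz] := next_sr_exists zy.
by exists a; [rewrite inE ax | exists y].
Qed.

Lemma next_sr_disj (w : bvert0 (next_graph G)) X a b y y' z : X \in bsep w ->
  a \in X -> b \in X -> next_sr a y z -> next_sr b y' z -> a = b.
Proof.
move=> /imsetP[x _ ->]; rewrite !inE => /eqP ax /eqP bx [ay zy] [by' zy'].
apply: next_edge_eq; last by rewrite ax.
rewrite ax in zy; rewrite bx in zy'; rewrite -(prel_fun zy zy') in by'.
exact: next_sv_inr_inj ay by'.
Qed.

Definition next_system : setSystem (next_graph G) S :=
  SetSystem next_sv_disj next_sr_dom next_sr_rng next_sr_cover next_sr_disj.

End NextSystem.

Fixpoint canon_system (G : bipSepGraph) (S : Type) (Y : setSystem G S) (n : nat) :
    setSystem (canon_graph G n) S :=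
  if n is m.+1 then next_system (canon_system Y m) else Y.

Section SystemRep.
Variables (R : realType) (G : bipSepGraph) (S : eqType).

Definition vert_op (Y : setSystem G S) (v : vert G) : opalg (l2_hilbert R S) :=
  pop R (pdiag (sv Y v)).
Definition edge_op (Y : setSystem G S) (e : edge G) : opalg (l2_hilbert R S) :=
  pop R (sr Y e).

Lemma system_rep (Y : setSystem G S) : sep_rep (vert_op Y) (edge_op Y).
Proof.
split.
- move=> v w; rewrite pop_mul; case: eqP => [->|vw].
    apply: pop_ext => y z; split=> [[_ [wy <-] [_ <-]] //|[wy <-]].
    by exists y.
  by apply: pop_eq0 => y z [u [wy <-] [vy _]]; apply: vw; exact: sv_disj vy wy.
- move=> v; rewrite pop_star; apply: pop_ext => y z.
  by split=> -[vy zy]; split=> //; [rewrite -zy | rewrite -zy].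
- move=> e; rewrite !pop_mul; split; apply: pop_ext => y z.
    split=> [[u yu [_ <-]] //|yz]; exists z => //; split=> //.
    exact: sr_rng yz.
  split=> [[u [_ <-] //]|yz]; exists y => //; split=> //.
  by apply/sr_dom; exists z.
- move=> [u|w] X e f /=; last by rewrite inE.
  move=> Xu eX fX; rewrite pop_star pop_mul; case: eqP => [<-|ef].
    apply: pop_ext => y z; split=> [[u' yu zu]|[/sr_dom[u' yu] <-]].
      by split; [apply/sr_dom; exists u' | exact: prel_inj yu zu].
    by exists u'.
  apply: pop_eq0 => y z [u' yu zu]; apply: ef.
  exact: (sr_disj Xu eX fX zu yu).
- move=> [u|w] X /=; last by rewrite inE.
  move=> Xu; under eq_bigr do rewrite pop_star pop_mul.
  apply/esym; apply: pop_sum => [y z|e f y z eX fX [v vy vz] [v' vy' vz']].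
    split=> [[uy <-]|[e eX [v vy vz]]].
      by have [e eX [v vy]] := sr_cover Xu uy; exists e => //; exists v.
    split; last exact: (@prel_fun _ (sr Y e) v).
    have := sr_rng (vy : sr Y e v y); rewrite /= (@block_edge _ u (exist _ X Xu)) //.
  exact: (sr_disj Xu eX fX vy vy').
Qed.

End SystemRep.

Section NextRep.
Variables (R : realType) (G : bipSepGraph) (S : eqType) (Y : setSystem G S).

Lemma vert_op_next1 (w : bvert1 G) :
  vert_op R (next_system Y) (inl w : vert (next_graph G)) = vert_op R Y (inr w).
Proof. by []. Qed.

Lemma vert_op_next0 (u : bvert0 G) :
  vert_op R Y (inl u) = \sum_(v : next_vert1 G | tag v == u)
    vert_op R (next_system Y) (inr v : vert (next_graph G)).
Proof.
apply/esym/pop_sum => [y z|v w y z _ _ [vy _] [wy _]].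
  split=> [[uy <-]|[v /eqP <- [vy <-]]]; last by split=> //; exact: next_sv_tag vy.
  have [x xu] := brng_surj u; have [X xX] := block_of_edge x.
  have Xu : val X \in bsep u by rewrite -xu; exact: valP.
  have [e eX [y' ye]] := sr_cover Xu uy.
  have [a ae [ay _]] := next_sr_exists ye.
  exists (next_src a) => //; rewrite -brng_marked ae.
  by rewrite (@block_edge _ u (exist _ (val X) Xu)).
exact: next_sv_inr_inj vy wy.
Qed.

Lemma edge_op_next (x : bedge G) :
  edge_op R Y x = \sum_(a : next_edge G | marked a == x)
    cstar (edge_op R (next_system Y) (a : edge (next_graph G))).
Proof.
under eq_bigr do rewrite pop_star.
apply/esym/pop_sum => [z y|a b z y /eqP ax /eqP bx].
  split=> [zy|[a /eqP <- []] //].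
  by have [a ax ayz] := next_sr_exists zy; exists a; rewrite ?ax.
move=> [ay zy] [by' zy']; apply: next_edge_eq; last by rewrite ax.
exact: next_sv_inr_inj ay by'.
Qed.

End NextRep.

(** * Subalgebras *)

Section Subalgebras.
Variables (R : realType) (A : cstarAlgType R).
Implicit Types (a b c : A) (S T : set A).

Lemma cmull_cts a : continuous (cmul a : A -> A).
Proof.
by apply: (@lipschitz_cts _ _ _ _ (rnorm a)) => x y; rewrite -cmulBr rnormM.
Qed.

Lemma cmulr_cts a : continuous (fun b : A => cmul b a).
Proof.
apply: (@lipschitz_cts _ _ _ _ (rnorm a)) => x y.
by rewrite -cmulBl mulrC rnormM.
Qed.

Lemma cstar_cts : continuous (cstar : A -> A).
Proof.
apply: (@lipschitz_cts _ _ _ _ 1) => x y.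
by rewrite -cstarN -cstarD rnorm_star mul1r.
Qed.

Lemma cmul2_cts a b : continuous (fun x : A => cmul (cmul a x) b).
Proof.
move=> x; apply: (@continuous_comp _ _ _ (cmul a) (fun y => cmul y b)).
  exact: cmull_cts.
exact: cmulr_cts.
Qed.

Lemma smallest_subalg T : cstar_subalg (smallest (@cstar_subalg R A) T).
Proof.
split.
- by apply: closed_bigI => S [[]].
- by move=> S [[]].
- by move=> k a b Sa Sb S ST; have [[_ _ SL _ _] _] := ST; exact: SL (Sa _ ST) (Sb _ ST).
- by move=> a b Sa Sb S ST; have [[_ _ _ SM _] _] := ST; exact: SM (Sa _ ST) (Sb _ ST).
- by move=> a Sa S ST; have [[_ _ _ _ Ss] _] := ST; exact: Ss (Sa _ ST).
Qed.

Lemma smallest_ind T S : cstar_subalg S -> T `<=` S ->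
  smallest (@cstar_subalg R A) T `<=` S.
Proof. by move=> SS TS; exact: smallest_sub. Qed.

Lemma commutant_subalg T : (forall a, T a -> T (cstar a)) ->
  cstar_subalg [set b | forall a, T a -> cmul b a = cmul a b].
Proof.
move=> Ts; split=> /=.
- have -> : [set b | forall a, T a -> cmul b a = cmul a b] =
      \bigcap_(a in T) [set b | cmul b a = cmul a b] by [].
  apply: closed_bigI => a _.
  by apply: closed_eqfun; [exact: cmulr_cts | exact: cmull_cts].
- by move=> a _; rewrite cmul0l cmul0r.
- by move=> k b c bP cP a Ta; rewrite cmulDl cmulDr cmulZl cmulZr bP ?cP.
- by move=> b c bP cP a Ta; rewrite -cmulA cP // !cmulA bP.
- move=> b bP a Ta; rewrite -{1}[a]cstarK -cstarM -bP; last exact: Ts.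
  by rewrite cstarM cstarK.
Qed.

Section InSubalg.
Variable S : set A.
Hypothesis SS : cstar_subalg S.

Lemma subalg_closed : closed S. Proof. by case: SS. Qed.
Lemma subalg0 : S 0. Proof. by case: SS. Qed.
Lemma subalgL (k : R[i]) a b : S a -> S b -> S (k *: a + b).
Proof. by case: SS => _ _ SL _ _; exact: SL. Qed.
Lemma subalgM a b : S a -> S b -> S (cmul a b).
Proof. by case: SS => _ _ _ SM _; exact: SM. Qed.
Lemma subalg_star a : S a -> S (cstar a).
Proof. by case: SS => _ _ _ _ Ss; exact: Ss. Qed.
Lemma subalgZ (k : R[i]) a : S a -> S (k *: a).
Proof. by move=> Sa; rewrite -[k *: a]addr0; apply: subalgL => //; exact: subalg0. Qed.
Lemma subalgD a b : S a -> S b -> S (a + b).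
Proof. by move=> Sa Sb; rewrite -[a]scale1r; exact: subalgL. Qed.
Lemma subalg_sum (I : Type) (r : seq I) (P : pred I) (F : I -> A) :
  (forall i, P i -> S (F i)) -> S (\sum_(i <- r | P i) F i).
Proof. by move=> SF; apply: big_ind => //; [exact: subalg0 | exact: subalgD]. Qed.

End InSubalg.
End Subalgebras.

(** * Relations in the limit algebra *)

Section SepRep.
Variables (R : realType) (G : sepGraph) (A B : cstarAlgType R).
Variables (p : vert G -> A) (t : edge G -> A).
Hypothesis rep : sep_rep p t.

Lemma rep_hom (f : A -> B) : star_hom f -> sep_rep (f \o p) (f \o t).
Proof.
have [pp ps pt tt pE] := rep; move=> fP; split=> [v w|v|e|v X e f' Xv eX fX|v X Xv] /=.
- by rewrite -(homM fP) pp; case: eqP => // _; rewrite (hom0 fP).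
- by rewrite -(hom_star fP) ps.
- by rewrite -!(homM fP); have [-> ->] := pt e.
- rewrite -(hom_star fP) -(homM fP) (tt v X) //.
  by case: eqP => // _; rewrite (hom0 fP).
- rewrite (pE _ _ Xv) (hom_sum fP); apply: eq_bigr => e _.
  by rewrite (homM fP) (hom_star fP).
Qed.

Lemma repVV v w : cmul (p v) (p w) = if v == w then p v else 0.
Proof. by case: rep. Qed.
Lemma repV v : cmul (p v) (p v) = p v. Proof. by rewrite repVV eqxx. Qed.
Lemma repVs v : cstar (p v) = p v. Proof. by case: rep. Qed.
Lemma repVE e : cmul (p (rng e)) (t e) = t e.
Proof. by case: rep => _ _ /(_ e)[]. Qed.
Lemma repEV e : cmul (t e) (p (src e)) = t e.
Proof. by case: rep => _ _ /(_ e)[]. Qed.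
Lemma repEsV e : cmul (cstar (t e)) (p (rng e)) = cstar (t e).
Proof. by rewrite -[p _]repVs -cstarM repVE. Qed.
Lemma repVEs e : cmul (p (src e)) (cstar (t e)) = cstar (t e).
Proof. by rewrite -[p _]repVs -cstarM repEV. Qed.
Lemma repEsE v X e f : X \in sep v -> e \in X -> f \in X ->
  cmul (cstar (t e)) (t f) = if e == f then p (src e) else 0.
Proof. by case: rep => _ _ _ h _; exact: h. Qed.
Lemma repV_sum v X : X \in sep v -> p v = \sum_(e in X) cmul (t e) (cstar (t e)).
Proof. by case: rep => _ _ _ _ h; exact: h. Qed.

End SepRep.

Section Limit.
Variables (R : realType) (G : bipSepGraph) (M : limitAlgebra R G).
Local Notation O := (la_lim M).
Local Notation Bo := (@B0 R G M).
Local Notation CG := (canon_graph G).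

Definition pv n (v : vert (CG n)) : O := la_psi M (la_vert M n v).
Definition te n (e : edge (CG n)) : O := la_psi M (la_edge M n e).
Arguments pv : clear implicits.
Arguments te : clear implicits.

Lemma limit_rep n : sep_rep (pv n) (te n).
Proof.
have [rep _] := la_algP M n; have [psiP _ _] := la_limP M.
exact: (rep_hom rep (psiP n)).
Qed.

Lemma pvV1 n (w : bvert1 (CG n)) : pv n (inr w) = pv n.+1 (inl w).
Proof. by have [_ psiE _] := la_limP M; rewrite /pv -psiE la_phi_vert1. Qed.

Lemma pvV0 n (u : bvert0 (CG n)) :
  pv n (inl u) = \sum_(v : next_vert1 (CG n) | tag v == u) pv n.+1 (inr v).
Proof.
have [psiP psiE _] := la_limP M.
by rewrite /pv -psiE la_phi_vert0 (hom_sum (psiP _)).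
Qed.

Lemma teE n (x : bedge (CG n)) :
  te n x = \sum_(a : next_edge (CG n) | marked a == x) cstar (te n.+1 a).
Proof.
have [psiP psiE _] := la_limP M.
rewrite /te -psiE la_phi_edge (hom_sum (psiP _)).
by apply: eq_bigr => a _; rewrite (hom_star (psiP _)).
Qed.

Lemma te_starM n (x : bedge (CG n)) : cmul (cstar (te n x)) (te n x) = pv n (inr (bsrc x)).
Proof.
have [X xX] := block_of_edge x.
by rewrite (repEsE (limit_rep n) (v := inl (brng x)) (valP X) xX xX) eqxx.
Qed.

Lemma next_block_sep n (x : bedge (CG n)) :
  next_block x \in sep (inl (bsrc x) : vert (CG n.+1)).
Proof. by apply/imsetP; exists x; rewrite ?inE. Qed.

Lemma te_star_next n (a : next_edge (CG n)) (b : next_edge (CG n)) :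
  marked a = marked b ->
  cmul (cstar (te n.+1 a)) (te n.+1 b) =
    if a == b then pv n.+1 (inr (next_src a)) else 0.
Proof.
move=> ab; apply: (repEsE (limit_rep n.+1) (next_block_sep (marked a))).
  by rewrite inE.
by rewrite inE ab.
Qed.

(** Two edges with the same marked edge and the same source are equal, so the
    source of [a] isolates [a] in the expansion of its marked edge. *)
Lemma te_next n (a : next_edge (CG n)) :
  te n.+1 a = cmul (cstar (te n (marked a))) (pv n.+1 (inr (next_src a))).
Proof.
rewrite (teE (marked a)) cstar_sum cmul_suml (bigD1 a) //= cstarK.
rewrite (repEV (limit_rep n.+1) a) big1 ?addr0 // => b /andP[/eqP ba nba].
rewrite cstarK -(repEV (limit_rep n.+1) b) -cmulA (repVV (limit_rep n.+1)).
case: eqP => [[ab]|_]; last by rewrite cmul0r.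
by rewrite (next_edge_eq ab ba) eqxx in nba.
Qed.

(** The edges of one block of the next level satisfy [a^* b = 0] for [a <> b],
    so that only the diagonal terms survive when [x] is expanded. *)
Lemma te_proj n (x : bedge (CG n)) :
  cmul (te n x) (cstar (te n x)) =
  \sum_(a : next_edge (CG n) | marked a == x) pv n.+1 (inr (next_src a)).
Proof.
rewrite {1}(teE x) cmul_suml; apply: eq_bigr => a /eqP ax.
rewrite (teE x) cstar_sum cmul_sumr (bigD1 a) ?ax //= cstarK te_star_next // eqxx.
rewrite big1 ?addr0 // => b /andP[/eqP bx nba].
by rewrite cstarK te_star_next ?ax // eq_sym (negbTE nba).
Qed.

Definition parent n (v : vert (CG n.+1)) : vert (CG n) :=
  match v with inl w => inr w | inr v => inl (tag v) end.

Lemma pv_parent n (v : vert (CG n.+1)) : cmul (pv n (parent v)) (pv n.+1 v) = pv n.+1 v.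
Proof.
case: v => [w|v] /=; first by rewrite pvV1 (repV (limit_rep n.+1)).
rewrite pvV0 cmul_suml (bigD1 v) //= (repV (limit_rep n.+1)) big1 ?addr0 //.
move=> w /andP[_ vw]; rewrite (repVV (limit_rep n.+1)); case: eqP => // -[wv].
by rewrite wv eqxx in vw.
Qed.

Lemma pv_star n v : cstar (pv n v) = pv n v.
Proof. exact: (repVs (limit_rep n)). Qed.

(** Every vertex lies below its parent, and the vertices of one level are
    orthogonal. *)
Lemma pv_below n m v w : (n <= m)%N ->
  exists b : bool, cmul (pv n v) (pv m w) = if b then pv m w else 0.
Proof.
move=> /subnKC; move: (m - n)%N => k; move: m w.
elim: k => [|k IHk] m w; first by rewrite addn0 => nm; case: m / nm w => w;
  exists (v == w); rewrite (repVV (limit_rep n)); case: eqP => // ->.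
case: m w => [|m] w; first by rewrite addnS.
rewrite addnS => -[nm]; have [b bE] := IHk m (parent w) nm; exists b.
rewrite -{1}(pv_parent w) cmulA bE; case: (b); last by rewrite cmul0l.
exact: pv_parent.
Qed.

Lemma pv_comm n m v w : cmul (pv n v) (pv m w) = cmul (pv m w) (pv n v).
Proof.
wlog nm : n m v w / (n <= m)%N => [h|].
  by have [/h|/ltnW/h] := leqP n m.
have [b bE] := pv_below v w nm.
by rewrite -{2}(pv_star w) -{2}(pv_star v) -cstarM bE; case: (b); rewrite ?pv_star ?cstar0.
Qed.

Lemma B0_subalg : cstar_subalg (Bo).
Proof. exact: smallest_subalg. Qed.

Lemma B0_pv n v : Bo (pv n v).
Proof. by apply: sub_gen_smallest; exists n, v. Qed.

Lemma B0_ind (S : set O) : cstar_subalg S -> (forall n v, S (pv n v)) -> Bo `<=` S.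
Proof. by move=> SS Sp; apply: smallest_ind => // _ [n [v ->]]; exact: Sp. Qed.

(** The commutant of a self-adjoint set is a closed algebra. It contains [B0]
    for the set of vertices, and therefore also for the set [B0]. *)
Lemma B0_comm a b : Bo a -> Bo b -> cmul a b = cmul b a.
Proof.
have star_gen c : (exists n v, c = pv n v) -> exists n v, cstar c = pv n v.
  by move=> [n [v ->]]; exists n, v; rewrite pv_star.
have B0p : Bo `<=` [set b | forall c, (exists n v, c = pv n v) -> cmul b c = cmul c b].
  apply: B0_ind => [|n v _ [m [w ->]]]; last exact: pv_comm.
  exact: (@commutant_subalg _ _ [set c | exists n v, c = pv n v] star_gen).
suff sub : Bo `<=` [set a | forall b, Bo b -> cmul a b = cmul b a].
  by move=> Ba Bb; exact: sub.
apply: B0_ind => [|n v c Bb].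
  by apply: commutant_subalg => c; exact: (subalg_star B0_subalg).
by rewrite /= (B0p c Bb) //; exists n, v.
Qed.

Lemma B0_proj n (x : bedge (CG n)) : Bo (cmul (te n x) (cstar (te n x))).
Proof.
by rewrite te_proj; apply: (subalg_sum B0_subalg) => a _; exact: B0_pv.
Qed.

(** The unit of [B0]. *)
Definition unitO : O := \sum_v pv 0 v.

Lemma B0_unitO : Bo unitO.
Proof. by apply: (subalg_sum B0_subalg) => v _; exact: B0_pv. Qed.

Lemma unitO_pv n v : cmul unitO (pv n v) = pv n v.
Proof.
elim: n v => [v|n IHn v]; last by rewrite -{1}(pv_parent v) cmulA IHn pv_parent.
rewrite /unitO cmul_suml (bigD1 v) //= (repV (limit_rep 0)) big1 ?addr0 // => w wv.
by rewrite (repVV (limit_rep 0)) (negbTE wv).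
Qed.

Lemma unitO_mul b : Bo b -> cmul unitO b = b.
Proof.
have us : cstar unitO = unitO.
  by rewrite /unitO cstar_sum; apply: eq_bigr => v _; exact: pv_star.
suff sub : Bo `<=` [set b | cmul unitO b = b] by apply: sub.
suff sub : Bo `<=` Bo `&` [set b | cmul unitO b = b] by move=> c /sub[].
apply: B0_ind => [|n v]; last by split; [exact: B0_pv | exact: unitO_pv].
have [clB B00 BL BM Bs] := B0_subalg; split=> /=.
- apply: closedI => //; apply: closed_eqfun; first exact: cmull_cts.
  by move=> x; exact: cvg_id.
- by split=> //; rewrite cmul0r.
- move=> k a c [Ba ua] [Bc uc]; split; first exact: BL.
  by rewrite cmulDr cmulZr ua uc.
- by move=> a c [Ba ua] [Bc uc]; split; [exact: BM | rewrite cmulA ua].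
- move=> a [Ba ua]; split; first exact: Bs.
  rewrite -{1}us -cstarM -(B0_comm B0_unitO) ?ua //.
Qed.

(** Conjugation by the edges of all levels preserves [B0]. Expanding an edge
    into edges of the following levels, the mixed terms vanish because the
    initial and final projections of the latter commute with [B0]. *)
Lemma conj_next n (x : bedge (CG n)) b : Bo b ->
  cmul (cmul (te n x) b) (cstar (te n x)) =
    \sum_(a : next_edge (CG n) | marked a == x)
      cmul (cmul (cstar (te n.+1 a)) b) (te n.+1 a).
Proof.
move=> Bb; rewrite {1}(teE x) !cmul_suml; apply: eq_bigr => a /eqP ax.
rewrite (teE x) cstar_sum cmul_sumr (bigD1 a) ?ax //= cstarK.
rewrite big1 ?addr0 // => c /andP[/eqP cx nca]; rewrite cstarK.
have aE : cstar (te n.+1 a) =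
    cmul (cstar (te n.+1 a)) (cmul (te n.+1 a) (cstar (te n.+1 a))).
  by rewrite cmulA (te_starM (n := n.+1)) (repVEs (limit_rep n.+1) a).
rewrite {1}aE -(cmulA _ _ b) (B0_comm (B0_proj (n := n.+1) a) Bb) !cmulA -cmulA.
by rewrite te_star_next ?ax // eq_sym (negbTE nca) cmul0r.
Qed.

Lemma conj_star_next n (x : bedge (CG n)) b : Bo b ->
  cmul (cmul (cstar (te n x)) b) (te n x) =
    \sum_(a : next_edge (CG n) | marked a == x)
      cmul (cmul (te n.+1 a) b) (cstar (te n.+1 a)).
Proof.
move=> Bb; rewrite {1}(teE x) cstar_sum !cmul_suml; apply: eq_bigr => a /eqP ax.
rewrite (teE x) cmul_sumr (bigD1 a) ?ax //= cstarK.
rewrite big1 ?addr0 // => c /andP[/eqP cx nca].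
rewrite -{1}(repEV (limit_rep n.+1) a) -{1}(repVEs (limit_rep n.+1) c).
rewrite -[X in cmul X _]cmulA -(B0_comm Bb (B0_pv _)) !cmulA.
rewrite -[X in cmul X _]cmulA (repVV (limit_rep n.+1)).
case: eqP => [[ca]|_]; last by rewrite cmul0r cmul0l.
by rewrite -(next_edge_eq ca) ?eqxx ?ax in nca.
Qed.

Lemma B0_conj_pv n m (x : bedge (CG n)) (w : vert (CG m)) : (n <= m)%N ->
  Bo (cmul (cmul (cstar (te n x)) (pv m w)) (te n x)) /\
  Bo (cmul (cmul (te n x) (pv m w)) (cstar (te n x))).
Proof.
move=> /subnKC; move: (m - n)%N => k; elim: k => [|k IHk] in n x *.
  rewrite addn0 => nm; case: m / nm w => w; split.
    rewrite -{2}[te n x](repVE (limit_rep n)) cmulA -(cmulA _ (pv n w)).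
    rewrite (repVV (limit_rep n)); case: eqP => [->|_].
      by rewrite (repEsV (limit_rep n)) te_starM; exact: B0_pv.
    by rewrite cmul0r cmul0l; exact: subalg0 B0_subalg.
  rewrite -{1}[te n x](repEV (limit_rep n)) -(cmulA (te n x)).
  rewrite (repVV (limit_rep n)); case: eqP => [_|_].
    by rewrite (repEV (limit_rep n)); exact: B0_proj.
  by rewrite cmul0r cmul0l; exact: subalg0 B0_subalg.
rewrite addnS => nm; split.
  rewrite conj_star_next; last exact: B0_pv.
  by apply: (subalg_sum B0_subalg) => a _; have [] := IHk n.+1 a nm.
rewrite conj_next; last exact: B0_pv.
by apply: (subalg_sum B0_subalg) => a _; have [] := IHk n.+1 a nm.
Qed.

Lemma te_starM_B0 n (x : bedge (CG n)) : Bo (cmul (cstar (te n x)) (te n x)).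
Proof. by rewrite te_starM; exact: B0_pv. Qed.

(** The final projection [t t^*] can be inserted next to [t^*] and then moved
    past [b], with which it commutes. *)
Lemma conj_starM n (x : bedge (CG n)) b c : Bo b ->
  cmul (cmul (cstar (te n x)) (cmul b c)) (te n x) =
  cmul (cmul (cmul (cstar (te n x)) b) (te n x))
       (cmul (cmul (cstar (te n x)) c) (te n x)).
Proof.
move=> Bb; set t := te n x.
have tE : cstar t = cmul (cstar t) (cmul t (cstar t)).
  by rewrite cmulA te_starM (repVEs (limit_rep n) x).
rewrite {1}tE -!cmulA; congr cmul; rewrite !cmulA.
have tb : cmul (cmul t (cstar t)) b = cmul b (cmul t (cstar t)).
  exact: B0_comm (B0_proj x) Bb.
by rewrite tb !cmulA.
Qed.

Lemma conjM n (x : bedge (CG n)) b c : Bo b ->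
  cmul (cmul (te n x) (cmul b c)) (cstar (te n x)) =
  cmul (cmul (cmul (te n x) b) (cstar (te n x)))
       (cmul (cmul (te n x) c) (cstar (te n x))).
Proof.
move=> Bb; set t := te n x.
have tE : t = cmul t (cmul (cstar t) t).
  by rewrite te_starM (repEV (limit_rep n) x).
rewrite {1}tE -!cmulA; congr cmul; rewrite !cmulA.
have tb : cmul (cmul (cstar t) t) b = cmul b (cmul (cstar t) t).
  exact: B0_comm (te_starM_B0 x) Bb.
by rewrite tb !cmulA.
Qed.

Lemma B0_conj (x : bedge (CG 0)) b : Bo b ->
  Bo (cmul (cmul (cstar (te 0 x)) b) (te 0 x)) /\
  Bo (cmul (cmul (te 0 x) b) (cstar (te 0 x))).
Proof.
set t := te 0 x; move: b.
pose S := [set b | Bo (cmul (cmul (cstar t) b) t)] `&`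
          [set b | Bo (cmul (cmul t b) (cstar t))].
suff sub : Bo `<=` Bo `&` S by move=> b /sub[].
have [clB B00 BL BM Bs] := B0_subalg.
apply: B0_ind => [|n v]; last by split; [exact: B0_pv | exact: B0_conj_pv].
split.
- apply: closedI => //; apply: closedI;
    by apply: closed_comp => // y _; exact: cmul2_cts.
- by split=> //; split; rewrite /= cmul0r cmul0l.
- move=> k a b [Ba [/= a1 a2]] [Bb [/= b1 b2]].
  by split; [exact: BL|split]; rewrite /= cmulDr cmulDl cmulZr cmulZl; exact: BL.
- move=> a b [Ba [/= a1 a2]] [Bb [/= b1 b2]]; split; first exact: BM.
  by split; rewrite /= ?conj_starM ?conjM //; exact: BM.
- move=> a [Ba [/= a1 a2]]; split; first exact: Bs.
  by split=> /=; rewrite -cmulA; [have := Bs _ a1 | have := Bs _ a2];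
    rewrite !cstarM ?cstarK.
Qed.

End Limit.
Arguments pv {R G} M n v.
Arguments te {R G} M n e.

(** * Spectra of subalgebras *)

Lemma closed_forall (T : topologicalType) (I : Type) (D : I -> set T) :
  (forall i, closed (D i)) -> closed [set x | forall i, D i x].
Proof.
move=> clD; have -> : [set x | forall i, D i x] = \bigcap_(i in setT) D i.
  by apply/seteqP; split=> x /= h i //; exact: h.
by apply: closed_bigI => i _; exact: clD.
Qed.

Lemma rnorm_complex (R : realType) (z : R[i]) : rnorm (z : R[i]^o) = Normc.normc z.
Proof. by apply/complexI; rewrite -rnormE. Qed.

(** The disc is a closed subset of the image of a square. *)
Lemma compact_disc (R : realType) (r : R) : compact [set z : R[i]^o | Normc.normc z <= r].
Proof.
pose f (ab : R * R) : R[i]^o := ab.1 +i* ab.2.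
have norm2_le (x y : R) : x ^+ 2 + y ^+ 2 <= (`|x| + `|y|) ^+ 2.
  rewrite sqrrD !real_normK ?num_real // addrAC lerDl.
  by rewrite mulrn_wge0 // mulr_ge0.
have near_f (a b c d e : R) : `|a - c| < e / 2 -> `|b - d| < e / 2 ->
    rnorm (f (a, b) - f (c, d)) < e.
  move=> ac bd; rewrite rnorm_complex /f /= (splitr e).
  rewrite (le_lt_trans _ (ltrD ac bd)) //.
  by rewrite -ler_sqr ?nnegrE ?sqrtr_ge0 ?addr_ge0 // sqr_sqrtr ?addr_ge0 ?sqr_ge0.
have cf : continuous f.
  move=> [a b] B /nbhs_rnormP[e e0 eB].
  have e2 := divr_gt0 e0 (ltr0n R 2).
  exists (ball a (e / 2), ball b (e / 2)); first by split; exact: nbhsx_ballx.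
  by move=> [c d] /= []; rewrite -!ball_normE /= => ac bd; apply: eB; exact: near_f.
have cK : compact (f @` (`[- r, r] `*` `[- r, r])).
  apply: continuous_compact; first exact: continuous_subspaceT.
  by apply: compact_setX; exact: segment_compact.
apply: subclosed_compact cK _.
  apply/closed_rnormP => x xP; apply/ler_addgt0Pr => e /xP[y /= yr xy].
  rewrite -rnorm_complex -[x](subrK y) (le_trans (ler_rnormD _ _)) // addrC.
  by rewrite lerD ?rnorm_complex // -rnorm_complex ltW.
move=> [a b] /= abr; exists (a, b) => //=.
have r0 : 0 <= r by apply: le_trans abr; exact: sqrtr_ge0.
have abr2 : a ^+ 2 + b ^+ 2 <= r ^+ 2.
  rewrite -(sqr_sqrtr (_ : 0 <= a ^+ 2 + b ^+ 2)) ?addr_ge0 ?sqr_ge0 //.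
  by rewrite ler_sqr ?nnegrE ?sqrtr_ge0.
have le (c : R) : c ^+ 2 <= r ^+ 2 -> `[- r, r]%classic c.
  rewrite -[c ^+ 2]real_normK ?num_real // ler_sqr ?nnegrE //.
  by rewrite ler_norml /= in_itv.
by split; apply: le; apply: le_trans abr2; rewrite ?lerDl ?lerDr sqr_ge0.
Qed.

Lemma cts_add (R : realType) (T : topologicalType) (f g : T -> R[i]) :
  continuous (f : T -> R[i]^o) -> continuous (g : T -> R[i]^o) ->
  continuous ((fun x => f x + g x) : T -> R[i]^o).
Proof.
by move=> cf cg x; apply: (@cvgD _ R[i]^o); [exact: cf | exact: cg].
Qed.

Lemma cts_mul (R : realType) (T : topologicalType) (f g : T -> R[i]) :
  continuous (f : T -> R[i]^o) -> continuous (g : T -> R[i]^o) ->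
  continuous ((fun x => f x * g x) : T -> R[i]^o).
Proof. by move=> cf cg x; apply: cvgM; [exact: cf | exact: cg]. Qed.

Section Spectrum.
Variables (R : realType) (A : cstarAlgType R) (S : set A).
Hypothesis SS : cstar_subalg S.
Implicit Types (xi eta : spectrum S) (a b : A).

(** Characters are functions on the subtype [S]; [ev] extends them by zero. *)
Definition ev xi a : R[i] := oapp (val xi : S -> R[i]) 0 (insub a).

Lemma ev_val xi (b : S) : ev xi (val b) = val xi b.
Proof. by rewrite /ev valK. Qed.

Lemma ev_sub xi a (Sa : S a) : ev xi a = val xi (exist _ a (mem_set Sa)).
Proof. by rewrite -ev_val. Qed.

Lemma char_eqP xi a z : char_eq xi a z <-> S a /\ ev xi a = z.
Proof.
split=> [[b [<- <-]]|[Sa <-]]; first by rewrite ev_val; split=> //; exact/set_mem/valP.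
by exists (exist _ a (mem_set Sa)); rewrite -ev_sub.
Qed.

Lemma spectrum_char xi : character (val xi).
Proof. exact: (set_mem (valP xi)). Qed.

Lemma evL xi (k : R[i]) a b : S a -> S b -> ev xi (k *: a + b) = k * ev xi a + ev xi b.
Proof.
move=> Sa Sb; rewrite (ev_sub _ (subalgL SS k Sa Sb)) (ev_sub _ Sa) (ev_sub _ Sb).
by have [_ lin _] := spectrum_char xi; exact: lin.
Qed.

Lemma evM xi a b : S a -> S b -> ev xi (cmul a b) = ev xi a * ev xi b.
Proof.
move=> Sa Sb; rewrite (ev_sub _ (subalgM SS Sa Sb)) (ev_sub _ Sa) (ev_sub _ Sb).
by have [_ _ mul] := spectrum_char xi; exact: mul.
Qed.

Lemma ev_neq0 xi : exists2 b, S b & ev xi b != 0.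
Proof.
have [[b b0] _ _] := spectrum_char xi; exists (val b); last by rewrite ev_val.
exact/set_mem/valP.
Qed.

Lemma evD xi a b : S a -> S b -> ev xi (a + b) = ev xi a + ev xi b.
Proof. by move=> Sa Sb; rewrite -{1}[a]scale1r evL // mul1r. Qed.

Lemma ev0 xi : ev xi 0 = 0.
Proof. by apply: (addrI (ev xi 0)); rewrite -evD ?addr0 //; exact: subalg0. Qed.

Lemma evZ xi (k : R[i]) a : S a -> ev xi (k *: a) = k * ev xi a.
Proof.
by move=> Sa; rewrite -[k *: a]addr0 evL ?ev0 ?addr0 //; exact: subalg0.
Qed.

Lemma ev_sum (I : Type) (r : seq I) (P : pred I) (F : I -> A) xi :
  (forall i, P i -> S (F i)) ->
  ev xi (\sum_(i <- r | P i) F i) = \sum_(i <- r | P i) ev xi (F i).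
Proof.
move=> SF; elim: r => [|i r IHr]; first by rewrite !big_nil ev0.
rewrite !big_cons; case: ifP => // Pi; rewrite evD ?IHr //; first exact: SF.
exact: subalg_sum.
Qed.

Lemma ev_inj xi eta : (forall b, S b -> ev xi b = ev eta b) -> xi = eta.
Proof.
move=> e; apply/val_inj/funext => b; rewrite -!ev_val; apply: e.
exact/set_mem/valP.
Qed.

(** Characters are bounded: if [|b| < 1] and [xi b = 1], then a solution of
    [c = b + b c] would satisfy [xi c = 1 + xi c]. *)
Lemma ev_bound xi b : S b -> Normc.normc (ev xi b) <= rnorm b.
Proof.
move=> Sb; rewrite leNgt; apply/negP => lt.
set z := ev xi b in lt; have z0 : z != 0.
  by apply: contraTneq lt => ->; rewrite Normc.normc0 -leNgt rnorm_ge0.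
have nz : 0 < Normc.normc z by exact: le_lt_trans (rnorm_ge0 b) lt.
pose c : A := z^-1 *: b; have Sc : S c by exact: subalgZ.
have c1 : rnorm c < 1.
  by rewrite rnormZ Normc.normcV mulrC ltr_pdivrMr // mul1r.
have evc : ev xi c = 1 by rewrite evZ // mulVf.
have [x Sx /= xE] : exists2 x, S x & c + cmul c x = x.
  apply: (@contraction_fixpoint _ _ S (fun x => c + cmul c x) (rnorm c)).
  - exact: subalg_closed SS.
  - by exists 0; exact: subalg0 SS.
  - by rewrite rnorm_ge0.
  - by move=> x Sx; apply: (subalgD SS) => //; exact: subalgM.
  - by move=> x y _ _; rewrite opprD addrACA subrr add0r -cmulBr rnormM.
have : ev xi x = 1 + ev xi x.
  by rewrite -{1}xE evD ?evM ?evc ?mul1r //; exact: subalgM.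
move/eqP; rewrite -subr_eq0 opprD addrCA subrr addr0 oppr_eq0.
by rewrite oner_eq0.
Qed.

Lemma subalgN a : S a -> S (- a).
Proof. by move=> Sa; rewrite -scaleN1r; exact: subalgZ. Qed.

Lemma evB xi a b : S a -> S b -> ev xi (a - b) = ev xi a - ev xi b.
Proof.
move=> Sa Sb; have SNb := subalgN Sb; rewrite evD //; congr (_ + _).
by apply: (addrI (ev xi b)); rewrite -evD // !subrr ev0.
Qed.

Lemma ev_lipschitz xi a b : S a -> S b ->
  Normc.normc (ev xi a - ev xi b) <= rnorm (a - b).
Proof.
move=> Sa Sb; rewrite -evB //; apply: ev_bound.
by apply: (subalgD SS) => //; exact: subalgN.
Qed.

Lemma character_of (f : A -> R[i]) :
  (exists2 b, S b & f b != 0) ->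
  (forall (k : R[i]) a b, S a -> S b -> f (k *: a + b) = k * f a + f b) ->
  (forall a b, S a -> S b -> f (cmul a b) = f a * f b) ->
  {xi : spectrum S | forall b, S b -> ev xi b = f b}.
Proof.
move=> f0 fL fM.
have fS : character (fun b : S => f (val b)).
  split=> [|k a b c ->|a b c ->].
  - by case: f0 => b Sb fb; exists (exist _ b (mem_set Sb)).
  - by apply: fL; exact/set_mem/valP.
  - by apply: fM; exact/set_mem/valP.
exists (exist _ (fun b : S => f (val b)) (mem_set fS)) => b Sb.
by rewrite (ev_sub _ Sb).
Qed.

Lemma ev_cts b : continuous ((fun xi => ev xi b) : spectrum S -> R[i]^o).
Proof.
have [Sb|nSb] := pselect (S b); last first.
  have -> : (fun xi => ev xi b) = fun=> 0.
    apply/funext => xi; rewrite /ev insubF //.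
    by apply/negbTE/negP => /set_mem.
  exact: cst_continuous.
pose c : S := exist _ b (mem_set Sb).
have -> : (fun xi => ev xi b) =
    (fun x : {ptws S -> R[i]^o} => x c) \o (set_val : spectrum S -> {ptws S -> R[i]^o}).
  by apply/funext => xi; rewrite (ev_sub _ Sb).
move=> xi; apply: continuous_comp; first exact: initial_continuous.
exact: (@proj_continuous S (fun=> R[i]^o) c).
Qed.

Lemma spectrum_cts (T : topologicalType) (f : T -> spectrum S) :
  (forall b, S b -> continuous ((fun y => ev (f y) b) : T -> R[i]^o)) -> continuous f.
Proof.
move=> cf; apply: continuous_comp_initial => x; apply/pointwise_cvgP => b.
have fE : (fun y => ev (f y) (val b)) = (fun y => val (f y) b).
  by apply/funext => y; rewrite ev_val.
by have := cf (val b) (set_mem (valP b)) x; rewrite fE.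
Qed.

Lemma spectrum_hausdorff : hausdorff_space (spectrum S).
Proof.
move=> xi eta cl; apply: ev_inj => b Sb.
apply: (@norm_hausdorff _ R[i]^o) => P Q nP nQ.
have [zeta [zP zQ]] := cl _ _ (ev_cts nP) (ev_cts nQ).
by exists (ev zeta b).
Qed.

(** A unit keeps the zero functional away from the characters, which then form
    a closed subset of a product of discs. *)
Lemma spectrum_compact u : S u -> (forall b, S b -> cmul u b = b) ->
  compact [set: spectrum S].
Proof.
move=> Su uP; pose u' : S := exist _ u (mem_set Su).
have unit1 xi : ev xi u = 1.
  have [b Sb b0] := ev_neq0 xi; apply: (mulIf b0).
  by rewrite mul1r -evM // uP.
pose K := [set x : {ptws S -> R[i]^o} |
  forall b : S, Normc.normc (x b : R[i]) <= rnorm (val b)].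
have cK : compact K.
  exact: (tychonoff (I := set_type S) (T := fun=> R[i]^o)
    (fun b : S => @compact_disc R (rnorm (val b)))).
have pc (b : S) : continuous (fun x : {ptws S -> R[i]^o} => x b : R[i]^o).
  exact: (@proj_continuous S (fun=> R[i]^o) b).
pose D := [set x : {ptws S -> R[i]^o} | (x u' : R[i]^o) = 1] `&`
  ([set x | forall (k : R[i]) (a b c : S), val c = k *: val a + val b ->
      (x c : R[i]^o) = k * x a + x b] `&`
   [set x | forall (a b c : S), val c = cmul (val a) (val b) ->
      (x c : R[i]^o) = x a * x b]).
have charE : [set x : {ptws S -> R[i]^o} | character x] = D.
  apply/seteqP; split=> x /=.
    move=> xc; have [_ lin mul] := xc; split=> //.
    have := unit1 (exist _ x (mem_set xc)); by rewrite (ev_sub _ Su).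
  by move=> [x1 [lin mul]]; split=> //; exists u'; rewrite x1 oner_eq0.
have clE := @closed_eqfun R {ptws S -> R[i]^o} R[i]^o.
have clD : closed D.
  apply: closedI.
    apply: (clE (fun x => x u') (fun=> 1)); first exact: pc.
    exact: cst_continuous.
  apply: closedI.
    apply: closed_forall => k; apply: closed_forall => a; apply: closed_forall => b.
    apply: closed_forall => c; apply: closed_forall => _.
    apply: (clE (fun x => x c) (fun x => k * x a + x b)); first exact: pc.
    apply: (@cts_add R {ptws S -> R[i]^o} (fun x => k * x a) (fun x => x b)); last exact: pc.
    apply: (@cts_mul R {ptws S -> R[i]^o} (fun=> k) (fun x => x a)); last exact: pc.
    exact: cst_continuous.
  apply: closed_forall => a; apply: closed_forall => b.
  apply: closed_forall => c; apply: closed_forall => _.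
  apply: (clE (fun x => x c) (fun x => x a * x b)); first exact: pc.
  by apply: (@cts_mul R {ptws S -> R[i]^o} (fun x => x a) (fun x => x b)); exact: pc.
have cD : compact D.
  apply: (subclosed_compact clD cK) => x; rewrite -charE => xc b.
  have := @ev_bound (exist _ x (mem_set xc)) (val b) (set_mem (valP b)).
  by rewrite ev_val.
move=> F FF _; rewrite -charE in cD.
have [|x [xc clx]] := cD (set_val @ F) _.
  by apply: (@filterE _ F) => xi; exact: (spectrum_char xi).
exists (exist _ x (mem_set xc)); split=> // P Q FP [/= Q' [[W oW <-] /= Wx WQ]].
pose P' : set {ptws S -> R[i]^o} := [set y | exists2 xi : spectrum S, P xi & val xi = y].
have FP' : (set_val @ F) P' by apply: (@filterS _ F _ P) FP => xi Pxi; exists xi.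
have [_ [[xi Pxi <-] Wxi]] := clx P' W FP' (open_nbhs_nbhs (conj oW Wx)).
by exists xi; split=> //; exact: WQ.
Qed.

End Spectrum.

(** * The dynamical system on the spectrum *)

Section OmegaSystem.
Variables (R : realType) (G : bipSepGraph) (M : limitAlgebra R G).
Local Notation O := (la_lim M).
Local Notation Bo := (@B0 R G M).
Local Notation CG := (canon_graph G).
Local Notation Om := (@Omega R G M).
Local Notation p := (pv M).
Local Notation t := (te M).
Implicit Types (xi eta : Om) (b : O).

Let BS : cstar_subalg Bo := @B0_subalg R G M.

Definition eproj n (x : bedge (CG n)) : O := cmul (t n x) (cstar (t n x)).

Lemma B0_eproj n (x : bedge (CG n)) : Bo (eproj x).
Proof. exact: B0_proj. Qed.

Lemma eprojV n (x : bedge (CG n)) : cmul (p n (inl (brng x))) (eproj x) = eproj x.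
Proof. by rewrite cmulA (repVE (limit_rep M n) x). Qed.

Lemma eprojE n (x : bedge (CG n)) : cmul (eproj x) (t n x) = t n x.
Proof. by rewrite -cmulA te_starM (repEV (limit_rep M n) x). Qed.

Lemma eproj_idem n (x : bedge (CG n)) : cmul (eproj x) (eproj x) = eproj x.
Proof. by rewrite cmulA eprojE. Qed.

Lemma eproj_orth n (u : bvert0 (CG n)) X x y : X \in bsep u -> x \in X ->
  y \in X -> x <> y -> cmul (eproj x) (eproj y) = 0.
Proof.
move=> Xu xX yX xy; rewrite -cmulA [X in cmul _ X]cmulA.
rewrite (repEsE (limit_rep M n) (v := inl u) Xu xX yX).
by case: eqP => // _; rewrite cmul0l cmul0r.
Qed.

Lemma ev_idem xi b : Bo b -> cmul b b = b -> ev xi b = 0 \/ ev xi b = 1.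
Proof.
move=> Bb bb; have : ev xi b * ev xi b = ev xi b by rewrite -evM // bb.
move/eqP; rewrite -subr_eq0 -{3}[ev xi b]mulr1 -mulrBr mulf_eq0 subr_eq0.
by case/orP => /eqP; [left | right].
Qed.

Lemma ev_pv xi n v : ev xi (p n v) = 0 \/ ev xi (p n v) = 1.
Proof. by apply: ev_idem; [exact: B0_pv | exact: (repV (limit_rep M n))]. Qed.

Lemma ev_eproj xi n (x : bedge (CG n)) : ev xi (eproj x) = 0 \/ ev xi (eproj x) = 1.
Proof. by apply: ev_idem; [exact: B0_eproj | exact: eproj_idem]. Qed.

Lemma ev_absorb xi a b : Bo a -> Bo b -> cmul a b = b -> ev xi b = 1 -> ev xi a = 1.
Proof. by move=> Ba Bb ab b1; rewrite -[LHS]mulr1 -{1}b1 -evM // ab. Qed.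

Lemma ev_orth xi a b : Bo a -> Bo b -> cmul a b = 0 -> ev xi a = 1 -> ev xi b = 0.
Proof. by move=> Ba Bb ab a1; rewrite -[LHS]mul1r -a1 -evM // ab ev0. Qed.

Lemma ev_pv_disj xi n v w : ev xi (p n v) = 1 -> ev xi (p n w) = 1 -> v = w.
Proof.
move=> v1 w1; apply/eqP; apply: contraT => vw.
have : ev xi (p n w) = 0.
  apply: ev_orth v1; [exact: B0_pv|exact: B0_pv|].
  by rewrite (repVV (limit_rep M n)) (negbTE vw).
by move/eqP; rewrite w1 oner_eq0.
Qed.

Lemma ev_sum1 xi (I : finType) (P : pred I) (F : I -> O) :
  (forall i, P i -> Bo (F i)) -> (forall i, P i -> ev xi (F i) = 0 \/ ev xi (F i) = 1) ->
  ev xi (\sum_(i | P i) F i) = 1 -> exists2 i, P i & ev xi (F i) = 1.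
Proof.
move=> BF F01; rewrite (ev_sum BS) // => s1.
have [//|noi] := pselect (exists2 i, P i & ev xi (F i) = 1).
move/eqP: s1; rewrite big1 ?(eq_sym 0) ?oner_eq0 // => i Pi.
by case: (F01 i Pi) => // Fi; case: noi; exists i.
Qed.

Lemma ev_unitO xi : ev xi (unitO M) = 1.
Proof.
have [b Bb b0] := ev_neq0 xi; apply: (mulIf b0).
by rewrite mul1r -evM ?unitO_mul //; exact: B0_unitO.
Qed.

Lemma ev_pv_ex xi : exists v, ev xi (p 0 v) = 1.
Proof.
have [v _ v1] := @ev_sum1 xi _ predT (p 0) (fun v _ => @B0_pv R G M 0 v)
  (fun v _ => ev_pv xi v) (ev_unitO xi).
by exists v.
Qed.

Lemma ev_eproj_rng xi n (x : bedge (CG n)) :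
  ev xi (eproj x) = 1 -> ev xi (p n (inl (brng x))) = 1.
Proof. by apply: ev_absorb; [exact: B0_pv | exact: B0_eproj | exact: eprojV]. Qed.

Lemma ev_eproj_cover xi n (u : bvert0 (CG n)) X : X \in bsep u ->
  ev xi (p n (inl u)) = 1 -> exists2 x, x \in X & ev xi (eproj x) = 1.
Proof.
move=> Xu; rewrite (repV_sum (limit_rep M n) (v := inl u) Xu).
by apply: ev_sum1 => x _; [exact: B0_eproj | exact: ev_eproj].
Qed.

Lemma ev_eproj_disj xi n (u : bvert0 (CG n)) X x y : X \in bsep u -> x \in X ->
  y \in X -> ev xi (eproj x) = 1 -> ev xi (eproj y) = 1 -> x = y.
Proof.
move=> Xu xX yX x1 y1; apply: contrapT => xy.
have : ev xi (eproj y) = 0.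
  apply: ev_orth x1; [exact: B0_eproj | exact: B0_eproj |].
  exact: (eproj_orth Xu xX yX xy).
by move/eqP; rewrite y1 oner_eq0.
Qed.

Lemma clopen_ev b : Bo b -> cmul b b = b -> clopen [set xi : Om | ev xi b = 1].
Proof.
move=> Bb bb; have cl z : closed [set xi : Om | (ev xi b : R[i]^o) = z].
  by apply: closed_eqfun; [exact: ev_cts | exact: cst_continuous].
split; last exact: cl; rewrite -[X in open X]setCK openC.
have -> : ~` [set xi : Om | ev xi b = 1] = [set xi | ev xi b = 0]; last exact: cl.
apply/seteqP; split=> xi /=; first by case: (ev_idem xi Bb bb).
by move=> ->; apply/eqP; rewrite eq_sym oner_eq0.
Qed.

Lemma Omega_vertP xi v : Omega_vert v xi <-> ev xi (p 0 v) = 1.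
Proof.
split=> [/char_eqP[] //|v1]; apply/char_eqP; split=> //; exact: B0_pv.
Qed.

Lemma Omega_edgeP xi x : Omega_edge x xi <-> ev xi (@eproj 0 x) = 1.
Proof.
split=> [/char_eqP[] //|x1]; apply/char_eqP; split=> //; exact: (@B0_eproj 0).
Qed.

Lemma B0_conj_star (x : edge G) b : Bo b -> Bo (cmul (cmul (cstar (t 0 x)) b) (t 0 x)).
Proof. by case/(B0_conj x). Qed.

Lemma B0_conjr (x : edge G) b : Bo b -> Bo (cmul (cmul (t 0 x) b) (cstar (t 0 x))).
Proof. by case/(B0_conj x). Qed.

(** The functional is nonzero, as its value at [x x^*] is that of [xi] at the
    source of [x]. *)
Lemma theta_ex (x : edge G) xi : ev xi (p 0 (src x)) = 1 ->
  {eta : Om | forall b, Bo b -> ev eta b = ev xi (cmul (cmul (cstar (t 0 x)) b) (t 0 x))}.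
Proof.
move=> x1; apply: character_of => [|k a b Ba Bb|a b Ba Bb].
- exists (@eproj 0 x); first exact: (@B0_eproj 0).
  by rewrite -cmulA (@eprojE 0) (@te_starM _ _ M 0) x1 oner_eq0.
- by rewrite cmulDr cmulDl cmulZr cmulZl evL //; exact: B0_conj_star.
- by rewrite (@conj_starM _ _ M 0) // evM //; exact: B0_conj_star.
Qed.

Lemma theta_inv_ex (x : edge G) eta : ev eta (@eproj 0 x) = 1 ->
  {xi : Om | forall b, Bo b -> ev xi b = ev eta (cmul (cmul (t 0 x) b) (cstar (t 0 x)))}.
Proof.
move=> x1; apply: character_of => [|k a b Ba Bb|a b Ba Bb].
- exists (p 0 (src x)); first exact: B0_pv.
  by rewrite (repEV (limit_rep M 0)) x1 oner_eq0.
- by rewrite cmulDr cmulDl cmulZr cmulZl evL //; exact: B0_conjr.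
- by rewrite (@conjM _ _ M 0) // evM //; exact: B0_conjr.
Qed.

Lemma Omega_thetaP (x : edge G) xi b : ev xi (p 0 (src x)) = 1 -> Bo b ->
  ev (Omega_theta x xi) b = ev xi (cmul (cmul (cstar (t 0 x)) b) (t 0 x)).
Proof.
move=> x1 Bb; rewrite /Omega_theta; set P := (X in xget xi X).
have /(xgetPex xi) : exists eta, P eta.
  have [eta etaP] := theta_ex x1; exists eta => c.
  have Bc : Bo (val c) by exact/set_mem/valP.
  apply/char_eqP; split; first exact: B0_conj_star.
  by rewrite -ev_val etaP.
move=> /(_ (exist _ b (mem_set Bb)))/char_eqP[_ e].
by rewrite (ev_sub _ Bb) -e.
Qed.

Definition theta_inv (x : edge G) eta : Om :=
  if pselect (ev eta (@eproj 0 x) = 1) is left h then projT1 (theta_inv_ex h) else eta.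

Lemma theta_invP (x : edge G) eta b : ev eta (@eproj 0 x) = 1 -> Bo b ->
  ev (theta_inv x eta) b = ev eta (cmul (cmul (t 0 x) b) (cstar (t 0 x))).
Proof.
move=> x1 Bb; rewrite /theta_inv; case: pselect => // h.
by case: (theta_inv_ex h) => xi /= ->.
Qed.

Lemma Omega_theta_edge (x : edge G) xi : ev xi (p 0 (src x)) = 1 ->
  ev (Omega_theta x xi) (@eproj 0 x) = 1.
Proof.
move=> x1; rewrite Omega_thetaP //; last exact: (@B0_eproj 0).
by rewrite -cmulA (@eprojE 0) (@te_starM _ _ M 0).
Qed.

Lemma theta_inv_vert (x : edge G) eta : ev eta (@eproj 0 x) = 1 ->
  ev (theta_inv x eta) (p 0 (src x)) = 1.
Proof.
move=> x1; rewrite theta_invP //; last exact: B0_pv.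
by rewrite (repEV (limit_rep M 0)).
Qed.

Lemma ev_cut xi a b : Bo a -> Bo b -> ev xi a = 1 -> ev xi (cmul (cmul a b) a) = ev xi b.
Proof.
move=> Ba Bb a1; rewrite evM ?evM // ?a1 ?mulr1 ?mul1r //.
exact: (subalgM BS).
Qed.

Lemma Omega_thetaK (x : edge G) xi : ev xi (p 0 (src x)) = 1 ->
  theta_inv x (Omega_theta x xi) = xi.
Proof.
move=> x1; apply: ev_inj => b Bb.
rewrite theta_invP ?Omega_theta_edge // Omega_thetaP //; last exact: B0_conjr.
rewrite !cmulA (@te_starM _ _ M 0) -cmulA (@te_starM _ _ M 0) ev_cut //.
exact: B0_pv.
Qed.

Lemma theta_invK (x : edge G) eta : ev eta (@eproj 0 x) = 1 ->
  Omega_theta x (theta_inv x eta) = eta.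
Proof.
move=> x1; apply: ev_inj => b Bb.
rewrite Omega_thetaP ?theta_inv_vert // theta_invP //; last exact: B0_conj_star.
rewrite !cmulA -/(@eproj 0 x) -cmulA -/(@eproj 0 x) ev_cut //.
exact: (@B0_eproj 0).
Qed.

Lemma within_ev_cts (D : set Om) (f : Om -> Om) (F : O -> O) :
  (forall xi b, D xi -> Bo b -> ev (f xi) b = ev xi (F b)) ->
  {within D, continuous f}.
Proof.
move=> fF; apply: spectrum_cts => b Bb.
apply: (@subspace_eq_continuous Om D R[i]^o (fun xi => ev xi (F b))); first last.
- by apply: continuous_subspaceT; exact: ev_cts.
- by move=> xi /set_mem Dxi; rewrite fF.
Qed.

Lemma Omega_homeo (x : edge G) :
  homeo_on (@Omega_vert _ _ M (src x)) (Omega_edge x) (Omega_theta x).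
Proof.
split; [split|split; last exists (theta_inv x); last split].
- by move=> xi /Omega_vertP x1; apply/Omega_edgeP/Omega_theta_edge.
- move=> xi eta /set_mem/Omega_vertP xi1 /set_mem/Omega_vertP eta1 e.
  by rewrite -(Omega_thetaK xi1) e Omega_thetaK.
- move=> eta /Omega_edgeP x1; exists (theta_inv x eta); last exact: theta_invK.
  exact/Omega_vertP/theta_inv_vert.
- apply: within_ev_cts => xi b /Omega_vertP; exact: Omega_thetaP.
- by move=> xi /Omega_vertP; exact: Omega_thetaK.
- by apply: within_ev_cts => xi b /Omega_edgeP; exact: theta_invP.
Qed.

Lemma Omega_dynsys : is_dynsys (Omega_dyn M).
Proof.
have vE v : @Omega_vert _ _ M v = [set xi | ev xi (p 0 v) = 1].
  by apply/seteqP; split=> xi /Omega_vertP.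
have eE x : @Omega_edge _ _ M x = [set xi | ev xi (@eproj 0 x) = 1].
  by apply/seteqP; split=> xi /Omega_edgeP.
split=> /=.
- exact: (spectrum_compact BS (@B0_unitO R G M) (@unitO_mul R G M)).
- exact: spectrum_hausdorff.
- move=> v; rewrite vE; apply: clopen_ev; first exact: B0_pv.
  exact: (repV (limit_rep M 0)).
- apply/seteqP; split=> xi // _; have [v v1] := ev_pv_ex xi.
  by exists v => //; apply/Omega_vertP.
- move=> v w _ _ [xi [/Omega_vertP v1 /Omega_vertP w1]].
  exact: ev_pv_disj v1 w1.
- move=> x; rewrite eE; apply: clopen_ev; first exact: (@B0_eproj 0).
  exact: (@eproj_idem 0).
- by move=> x xi /Omega_edgeP x1; apply/Omega_vertP; exact: (@ev_eproj_rng _ 0).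
- move=> u X Xu; apply/seteqP; split=> xi.
    move=> [x /= xX /Omega_edgeP x1]; apply/Omega_vertP.
    rewrite -(@block_edge _ u (exist _ X Xu) x xX); exact: (@ev_eproj_rng _ 0).
  move=> /Omega_vertP u1; have [x xX x1] := @ev_eproj_cover xi 0 u X Xu u1.
  by exists x => //; apply/Omega_edgeP.
- move=> u X Xu x y xX yX [xi [/Omega_edgeP x1 /Omega_edgeP y1]].
  exact: (@ev_eproj_disj xi 0 u X x y Xu xX yX x1 y1).
- exact: Omega_homeo.
Qed.

End OmegaSystem.

(** * Clopen sets along the canonical sequence *)

Section ClopenSystem.

Lemma clopen_cap (T : topologicalType) (D E : set T) :
  clopen D -> clopen E -> clopen (D `&` E).
Proof. by move=> [oD cD] [oE cE]; split; [exact: openI | exact: closedI]. Qed.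

Lemma clopen_forall (T : topologicalType) (I : finType) (D : I -> set T) :
  (forall i, clopen (D i)) -> clopen [set x | forall i, D i x].
Proof.
move=> cD; have -> : [set x | forall i, D i x] = \big[setI/setT]_i D i.
  by apply/seteqP; split=> x; rewrite -bigcap_seq /= => h i; [move=> _|]; apply: h;
    rewrite /= ?mem_index_enum.
apply: (big_ind (@clopen T)) => [|D' E' |i _]; last exact: cD.
- by split; [exact: openT | exact: closedT].
- exact: clopen_cap.
Qed.

Lemma clopen_within (T U : topologicalType) (A : set T) (f : T -> U) (V : set U) :
  clopen A -> {within A, continuous f} -> clopen V -> clopen (A `&` f @^-1` V).
Proof.
move=> [oA cA] cf [oV cV].
have oI (W : set U) : open W -> open (A `&` f @^-1` W).
  move: cf; rewrite continuous_open_subspace // => cf oW.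
  rewrite openE => x [Ax Wx]; apply: filterI; first exact: open_nbhs_nbhs.
  apply: cf; first exact: mem_set.
  exact: open_nbhs_nbhs.
split; first exact: oI.
rewrite -openC.
have -> : ~` (A `&` f @^-1` V) = ~` A `|` (A `&` f @^-1` (~` V)).
  apply/seteqP; split=> x /=.
    by move=> nAV; have [Ax|] := pselect (A x); [right; split=> // Vx; exact: nAV | left].
  by move=> [nA [] //|[_ nV] [_ //]].
by apply: openU; [rewrite openC | apply: oI; rewrite openC].
Qed.

(** The partial homeomorphisms enter only through the clopen sets that they
    pull back and push forward. *)
Definition clopen_system (G : bipSepGraph) (S : topologicalType)
    (Y : setSystem G S) : Prop :=
  [/\ forall v, clopen (sv Y v),
      forall e U, clopen U -> clopen [set y | exists2 z, U z & sr Y e y z] &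
      forall e U, clopen U -> clopen [set z | exists2 y, U y & sr Y e y z]].

Lemma next_clopen (G : bipSepGraph) (S : topologicalType) (Y : setSystem G S) :
  clopen_system Y -> clopen_system (next_system Y).
Proof.
move=> [clv pull push].
have cln v : clopen (sv (next_system Y) v).
  case: v => [w|v]; first exact: clv.
  apply: clopen_forall => X.
  have := push (val ((tagged v : choices (tag v)) X)) setT.
  have -> : [set z | exists2 y, setT y & sr Y (val ((tagged v : choices (tag v)) X)) y z]
      = (fun z => exists y, sr Y (val ((tagged v : choices (tag v)) X)) y z).
    by apply/seteqP; split=> z [y]; [exists y | exists y].
  by apply; split; [exact: openT | exact: closedT].
split=> // a U clU.
- have -> : [set y | exists2 z, U z & sr (next_system Y) a y z] =
      sv (next_system Y) (inr (next_src a)) `&`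
      [set y | exists2 z, U z & sr Y (marked a) z y].
    by apply/seteqP; split=> y; [move=> [z Uz []] ay zy|move=> [ay [z Uz zy]]];
      [split=> //; exists z | exists z].
  by apply: clopen_cap => //; exact: push.
- have -> : [set z | exists2 y, U y & sr (next_system Y) a y z] =
      [set z | exists2 y, (U `&` sv (next_system Y) (inr (next_src a))) y &
        sr Y (marked a) z y].
    by apply/seteqP; split=> z; [move=> [y Uy []] ay zy|move=> [y [Uy ay] zy]];
      exists y.
  by apply: pull; exact: clopen_cap.
Qed.

Lemma canon_clopen (G : bipSepGraph) (S : topologicalType) (Y : setSystem G S) n :
  clopen_system Y -> clopen_system (canon_system Y n).
Proof. by move=> clY; elim: n => [//|n IHn]; exact: next_clopen. Qed.

End ClopenSystem.

(** * Universality *)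

Section Universal.
Variables (R : realType) (G : bipSepGraph) (M : limitAlgebra R G).
Variables (S : dynData G).
Hypothesis SP : is_dynsys S.
Local Notation O := (la_lim M).
Local Notation Bo := (@B0 R G M).
Local Notation p := (pv M).
Local Notation t := (te M).
Let BS : cstar_subalg Bo := @B0_subalg R G M.

Let theta_dom (x : edge G) : dvert S (src x) `<=` dtheta x @^-1` dedge S x.
Proof. by have [[h _ _] _] := dyn_theta SP x; exact: h. Qed.

Let theta_inj (x : edge G) y y' : dvert S (src x) y -> dvert S (src x) y' ->
  dtheta x y = dtheta x y' -> y = y'.
Proof.
have [[_ h _] _] := dyn_theta SP x.
by move=> yx yx'; apply: h; apply: mem_set.
Qed.

Let theta_surj (x : edge G) z : dedge S x z ->
  exists2 y, dvert S (src x) y & dtheta x y = z.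
Proof. by have [[_ _ h] _] := dyn_theta SP x; move/h. Qed.

Lemma dyn_rel_fun (x : edge G) (y z z' : S) : dvert S (src x) y /\ dtheta x y = z ->
  dvert S (src x) y /\ dtheta x y = z' -> z = z'.
Proof. by move=> [_ <-] [_ <-]. Qed.

Lemma dyn_rel_inj (x : edge G) (y y' z : S) : dvert S (src x) y /\ dtheta x y = z ->
  dvert S (src x) y' /\ dtheta x y' = z -> y = y'.
Proof. by move=> [yx yz] [yx' yz']; apply: theta_inj yx yx' _; rewrite yz. Qed.

Definition dyn_rel (x : edge G) : pinj S := Pinj (@dyn_rel_fun x) (@dyn_rel_inj x).

Lemma dyn_vert_eq v w y : dvert S v y -> dvert S w y -> v = w.
Proof. by move=> vy wy; apply: (dyn_vert_disj SP) => //; exists y. Qed.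

Lemma dyn_rel_dom x y : dvert S (src x) y <-> exists z, dyn_rel x y z.
Proof. by split=> [yx|[z []] //]; exists (dtheta x y). Qed.

Lemma dyn_rel_rng x y z : dyn_rel x y z -> dvert S (rng x) z.
Proof. by move=> [/theta_dom xz <-]; exact: (dyn_edge_sub SP) xz. Qed.

Lemma dyn_rel_cover (u : bvert0 G) X z : X \in bsep u -> dvert S (inl u) z ->
  exists2 x, x \in X & exists y, dyn_rel x y z.
Proof.
move=> Xu; rewrite -(dyn_edge_cover SP Xu) => -[x xX /theta_surj[y yx yz]].
by exists x => //; exists y.
Qed.

Lemma dyn_edge_eq (u : bvert0 G) X x x' z : X \in bsep u -> x \in X -> x' \in X ->
  dedge S x z -> dedge S x' z -> x = x'.
Proof. by move=> Xu xX xX' xz xz'; apply: (dyn_edge_disj SP Xu) => //; exists z. Qed.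

Lemma dyn_rel_disj (u : bvert0 G) X x x' y y' z : X \in bsep u -> x \in X ->
  x' \in X -> dyn_rel x y z -> dyn_rel x' y' z -> x = x'.
Proof.
move=> Xu xX xX' [/theta_dom xz yz] [/theta_dom xz' yz'].
by apply: (dyn_edge_eq Xu xX xX' (z := z)); [rewrite -yz | rewrite -yz'].
Qed.

Definition dyn_system : setSystem G S :=
  SetSystem dyn_vert_eq dyn_rel_dom dyn_rel_rng dyn_rel_cover dyn_rel_disj.

Lemma dyn_clopen : clopen_system dyn_system.
Proof.
split=> [v|x U clU|x U clU]; first exact: (dyn_vert_clopen SP).
- have [_ [cth _]] := dyn_theta SP x.
  have -> : [set y | exists2 z, U z & sr dyn_system x y z] =
      dvert S (src x) `&` dtheta x @^-1` U.
    apply/seteqP; split=> y; first by move=> [z Uz [yx yz]]; split=> //=; rewrite yz.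
    by move=> [yx Uy]; exists (dtheta x y).
  by apply: clopen_within => //; exact: (dyn_vert_clopen SP).
- have [_ [_ [g [gK cg]]]] := dyn_theta SP x.
  have -> : [set z | exists2 y, U y & sr dyn_system x y z] = dedge S x `&` g @^-1` U.
    apply/seteqP; split=> z.
      by move=> [y Uy [yx <-]]; split; [exact: theta_dom | rewrite /= gK].
    move=> [/theta_surj[y yx <-]] /=; rewrite gK // => Uy; by exists y.
  by apply: clopen_within => //; exact: (dyn_edge_clopen SP).
Qed.

Local Notation Y := (canon_system dyn_system).
Local Notation H := (l2_hilbert R S).

Lemma level_rep n : {f : la_alg M n -> opalg H |
  [/\ star_hom f, forall v, f (la_vert M n v) = vert_op R (Y n) v
    & forall e, f (la_edge M n e) = edge_op R (Y n) e]}.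
Proof.
have [_ univ] := la_algP M n.
by have /cid[f [fP _]] := univ _ _ _ (system_rep R (Y n)); exists f.
Qed.

(** Both sides are representations of the algebra of level [n] with the same
    values on its generators, by [vert_op_next0] and [edge_op_next]. *)
Lemma level_rep_next n a :
  projT1 (level_rep n.+1) (@la_phi _ _ M n a) = projT1 (level_rep n) a.
Proof.
have [_ univ] := la_algP M n.
have [f0 [_ uniq_f]] := univ _ _ _ (system_rep R (Y n)).
case: (level_rep n) => f fP /=; case: (level_rep n.+1) => g [gP gV gE] /=.
suff gphi : f0 = (fun a => g (@la_phi _ _ M n a)) by rewrite -(uniq_f _ fP) gphi.
apply: uniq_f; have [phiL phiM phis] := la_phi_hom M n.
split=> [|v|e].
- split=> [k b c|b c|b].
  + by rewrite phiL (homL gP).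
  + by rewrite phiM (homM gP).
  + by rewrite phis (hom_star gP).
- case: v => [u|w]; last by rewrite la_phi_vert1 gV; exact: vert_op_next1.
  rewrite la_phi_vert0 (hom_sum gP) vert_op_next0.
  by apply: eq_bigr => v _; rewrite gV.
- rewrite la_phi_edge (hom_sum gP) edge_op_next.
  by apply: eq_bigr => b _; rewrite (hom_star gP) gE.
Qed.

Lemma limit_algebra_rep : {f : O -> opalg H |
  [/\ star_hom f, forall n v, f (p n v) = vert_op R (Y n) v
    & forall n e, f (t n e) = edge_op R (Y n) e]}.
Proof.
have [_ _ univ] := la_limP M.
have chiP n : star_hom (projT1 (level_rep n)) by case: (level_rep n) => f [].
have /cid[f [[fP fE] _]] := univ _ _ chiP level_rep_next.
exists f; split=> // n v; rewrite /pv /te fE; case: (level_rep n) => g [_ gV gE] /=.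
  exact: gV.
exact: gE.
Qed.

Definition repr : O -> opalg H := projT1 limit_algebra_rep.

Lemma repr_hom : star_hom repr.
Proof. by rewrite /repr; case: limit_algebra_rep => f []. Qed.

Lemma repr_pv n v : repr (p n v) = vert_op R (Y n) v.
Proof. by rewrite /repr; case: limit_algebra_rep => f []. Qed.

Lemma repr_te n e : repr (t n e) = edge_op R (Y n) e.
Proof. by rewrite /repr; case: limit_algebra_rep => f []. Qed.

Lemma delta_l2 (y : S) : (fun z => (z == y)%:R : R[i]) \in @l2fun R S.
Proof.
apply/l2funP; exists 1 => s us; have [ys|ys] := boolP (y \in s).
  rewrite (bigD1_seq y) //= eqxx big1 ?addr0 => [|z /negbTE ->].
    by rewrite /cdot /= mulr1 mulr0 addr0.
  by rewrite /cdot /= mulr0 addr0.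
rewrite big1_seq // => z /= zs; case: eqP => [zy|_]; last by rewrite /cdot /= mulr0 addr0.
by rewrite -zy zs in ys.
Qed.

Definition delta (y : S) : H := L2 (delta_l2 y).

Definition coef (T : opalg H) (y z : S) : R[i] := (T (delta y) : l2 R S) z.

Lemma deltaE y z : (delta y : l2 R S) z = (z == y)%:R. Proof. by []. Qed.

Lemma dot_delta (x : H) (k : R[i]) z : dot x (k *: delta z) = cdot ((x : l2 R S) z) k.
Proof.
apply: l2dot_eq => e e0; exists [:: z] => s us zs.
have {}zs : z \in s by apply: zs; rewrite inE.
have E i : cdot ((x : l2 R S) i) ((k *: delta z : l2 R S) i) =
    if i == z then cdot ((x : l2 R S) z) k else 0.
  rewrite l2Z deltaE; case: eqP => [->|_]; first by rewrite mulr1.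
  by rewrite mulr0 /cdot /= !mulr0 addr0.
under eq_bigr do rewrite E.
by rewrite (bigD1_seq z) //= eqxx big1 ?addr0 ?subrr ?normr0 ?ltW // => i /negbTE ->.
Qed.

Lemma hnorm_delta y : hnorm (delta y) = 1.
Proof.
rewrite /hnorm -{2}[delta y]scale1r dot_delta deltaE eqxx /cdot /= mulr1 mulr0 addr0.
exact: sqrtr1.
Qed.

Lemma normc_coef (T : opalg H) y z : Normc.normc (coef T y z) <= rnorm T.
Proof.
rewrite rnorm_op -[opnorm T]mulr1 -(hnorm_delta y) (le_trans _ (opnorm_bound _ _)) //.
rewrite /hnorm -[Normc.normc _]ger0_norm ?normc_ge0 // -sqrtr_sqr ler_wsqrtr //.
apply: le_trans (cdot_le_l2dot (T (delta y) : l2 R S) z); rewrite le_eqVlt.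
apply/orP; left; apply/eqP; rewrite /coef; case: (_ z) => a b /=.
by rewrite sqr_sqrtr ?addr_ge0 ?sqr_ge0 // !expr2.
Qed.

(** Testing against complex multiples of a point mass recovers an entry from the
    real part of the inner product. *)
Lemma coef_star (T : opalg H) y z : coef T z y = 0 -> coef (cstar T) y z = 0.
Proof.
move=> c0; apply: cdot_eq0; rewrite -{2}[coef _ _ _]/(coef (cstar T) y z) -dot_delta.
have -> : dot (cstar T (delta y)) (coef (cstar T) y z *: delta z) =
    dot (T (coef (cstar T) y z *: delta z)) (delta y).
  by rewrite dotC dot_opl.
rewrite -[delta y]scale1r dot_delta op_scale l2Z -/(coef T z y) c0 mulr0.
by rewrite /cdot /= !mul0r addr0.
Qed.

Lemma coefL (k : R[i]) (T U : opalg H) y z :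
  coef (k *: T + U) y z = k * coef T y z + coef U y z.
Proof. by rewrite /coef opD opZ l2D l2Z. Qed.

Lemma coefB (T U : opalg H) y z : coef (T - U) y z = coef T y z - coef U y z.
Proof. by rewrite /coef opB l2B. Qed.

Lemma coef_repr_lipschitz y z a b :
  Normc.normc (coef (repr a) y z - coef (repr b) y z) <= rnorm (a - b).
Proof.
have -> : coef (repr a) y z - coef (repr b) y z = coef (repr (a - b)) y z.
  by rewrite (homB repr_hom) coefB.
by rewrite (le_trans (normc_coef _ _ _)) // (rep_contractive repr_hom).
Qed.

Lemma coef_repr_cts y z : continuous ((fun b => coef (repr b) y z) : O -> R[i]^o).
Proof.
apply: (@lipschitz_cts _ _ R[i]^o _ 1) => a b.
by rewrite rnorm_complex mul1r coef_repr_lipschitz.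
Qed.

Definition diagonal (T : opalg H) : Prop := forall y z, y <> z -> coef T y z = 0.

Lemma diagonalE T y : diagonal T -> T (delta y) = coef T y y *: delta y.
Proof.
move=> Td; apply: l2_eq => z; rewrite l2Z deltaE; case: eqP => [->|zy].
  by rewrite mulr1.
by rewrite mulr0; apply: Td => yz; apply: zy.
Qed.

Lemma coefM_diagonal (T U : opalg H) y z : diagonal U ->
  coef (cmul T U) y z = coef T y z * coef U y y.
Proof.
move=> Ud; rewrite -[LHS]/((T (U (delta y)) : l2 R S) z) (diagonalE _ Ud).
by rewrite op_scale l2Z mulrC.
Qed.

(** The diagonal operators form a closed algebra, and the vertices act by
    projections onto spaces of functions with given support. *)
Lemma repr_diagonal b : Bo b -> diagonal (repr b).
Proof.
suff sub : Bo `<=` [set b | diagonal (repr b)] by move/sub.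
apply: B0_ind => {b} [|n v y z yz]; last first.
  rewrite repr_pv /coef /vert_op; have [vz|nvz] := pselect (sv (Y n) v z).
    rewrite (@popE _ _ (pdiag _) _ z) // deltaE; case: eqP => // zy.
    by case: yz.
  by rewrite pop0 // => y' [vy' yz']; apply: nvz; rewrite -yz'.
split=> /=.
- have -> : [set b | diagonal (repr b)] =
      [set b | forall y z, y <> z -> coef (repr b) y z = 0] by [].
  apply: closed_forall => y; apply: closed_forall => z; apply: closed_forall => _.
  apply: (@closed_eqfun _ _ R[i]^o _ (fun=> 0)); first exact: coef_repr_cts.
  exact: cst_continuous.
- by move=> y z _; rewrite (hom0 repr_hom).
- move=> k a b ad bd y z yz.
  by rewrite (homL repr_hom) coefL ad // bd // mulr0 addr0.
- by move=> a b ad bd y z yz; rewrite (homM repr_hom) coefM_diagonal // ad // mul0r.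
- move=> a ad y z yz; rewrite (hom_star repr_hom); apply: coef_star; apply: ad.
  by move=> zy; apply: yz.
Qed.

Definition diag_coef (y : S) (b : O) : R[i] := coef (repr b) y y.

Lemma diag_coefP y b : Bo b -> repr b (delta y) = diag_coef y b *: delta y.
Proof. by move=> Bb; apply: diagonalE; exact: repr_diagonal. Qed.

Lemma diag_coef_eq y b k : repr b (delta y) = k *: delta y -> diag_coef y b = k.
Proof. by move=> e; rewrite /diag_coef /coef e l2Z deltaE eqxx mulr1. Qed.

Lemma pop_delta (r : pinj S) y z : r y z -> pop R r (delta y) = delta z.
Proof.
move=> yz; apply: l2_eq => z'; rewrite deltaE; case: eqP => [->|zz].
  by rewrite (popE _ yz) deltaE eqxx.
have [[y' yz']|n] := pselect (exists y', r y' z'); last first.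
  by rewrite pop0 // => y' ?; apply: n; exists y'.
rewrite (popE _ yz') deltaE; case: eqP => // yy; rewrite yy in yz'.
by case: zz; exact: prel_fun yz' yz.
Qed.

Lemma diag_coef_pv y n v : diag_coef y (p n v) = (`[< sv (Y n) v y >])%:R.
Proof.
apply: diag_coef_eq; rewrite repr_pv /vert_op; case: asboolP => vy.
  by rewrite (@pop_delta _ _ y) // scale1r.
rewrite scale0r; apply: l2_eq => z; have [zy|zy] := pselect (z = y); last first.
  have [vz|vz] := pselect (sv (Y n) v z).
    by rewrite (@popE _ _ (pdiag _) _ z) // deltaE; case: eqP.
  by rewrite pop0 // => z' [vz' e]; apply: vz; rewrite -e.
by rewrite pop0 // => z' [vz' e]; apply: vy; rewrite -zy -e.
Qed.

Lemma diag_coef_char y : {xi : Omega M | forall b, Bo b -> ev xi b = diag_coef y b}.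
Proof.
apply: character_of => [|k a b Ba Bb|a b Ba Bb].
- have : [set: S] y by [].
  rewrite -(dyn_vert_cover SP) => -[v _ vy]; exists (p 0 v); first exact: B0_pv.
  by rewrite diag_coef_pv asboolT // oner_eq0.
- by rewrite /diag_coef (homL repr_hom) coefL.
- by rewrite /diag_coef (homM repr_hom) coefM_diagonal //; exact: repr_diagonal.
Qed.

Definition to_Omega (y : S) : Omega M := projT1 (diag_coef_char y).

Lemma to_OmegaP y b : Bo b -> ev (to_Omega y) b = diag_coef y b.
Proof. by rewrite /to_Omega; case: (diag_coef_char y) => xi h /h. Qed.

Lemma indicator_cts (T : topologicalType) (D : set T) : clopen D ->
  continuous ((fun y => (`[< D y >])%:R) : T -> R[i]^o).
Proof.
move=> [oD cD] y B By.
have [Dy|nDy] := pselect (D y).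
  apply: (@filterS _ _ _ D); last exact: open_nbhs_nbhs.
  by move=> z Dz; rewrite /= asboolT //; move: (nbhs_singleton By); rewrite asboolT.
apply: (@filterS _ _ _ (~` D)); last by apply: open_nbhs_nbhs; split=> //; rewrite openC.
by move=> z Dz; rewrite /= asboolF //; move: (nbhs_singleton By); rewrite asboolF.
Qed.

(** Since [repr] is contractive, the elements with continuous diagonal entries
    form a closed algebra. Requiring the same of the adjoint makes it closed
    under the star. *)
Lemma diag_coef_cts b : Bo b -> continuous ((diag_coef^~ b) : S -> R[i]^o).
Proof.
pose C b := continuous ((diag_coef^~ b) : S -> R[i]^o).
suff sub : Bo `<=` Bo `&` ([set b | C b] `&` [set b | C (cstar b)]).
  by move=> Bb; have [_ [Cb _]] := sub _ Bb; exact: Cb.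
move=> {b}; have [clB B00 BL BM Bs] := BS.
have clC : closed [set b | C b].
  apply/closed_rnormP => a aP y B /nbhs_rnormP[e e0 eB].
  have e3 : 0 < e / 3 by rewrite divr_gt0.
  have [c Cc ac] := aP _ e3.
  have near_c : nbhs y
      [set z | rnorm ((diag_coef y c : R[i]^o) - (diag_coef z c : R[i]^o)) < e / 3].
    apply: (Cc y [set w : R[i]^o | rnorm ((diag_coef y c : R[i]^o) - w) < e / 3]).
    by apply/nbhs_rnormP; exists (e / 3).
  apply: (@filterS _ (nbhs y) _ _ _ _ near_c) => z /= cz; apply: eB.
  have -> : e = e / 3 + (e / 3 + e / 3) by field.
  rewrite (le_lt_trans (ler_rnorm_dist (diag_coef y c : R[i]^o) _ _)) // ler_ltD //.
    by rewrite rnorm_complex (le_trans (coef_repr_lipschitz _ _ _ _)) // ltW.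
  rewrite (le_lt_trans (ler_rnorm_dist (diag_coef z c : R[i]^o) _ _)) // ltr_leD //.
  rewrite rnorm_complex (le_trans (coef_repr_lipschitz _ _ _ _)) //.
  by rewrite rnormB ltW.
have clCs : closed [set b | C (cstar b)].
  exact: (@closed_comp _ _ (cstar : O -> O) _ (fun b _ => @cstar_cts _ _ b) clC).
have CL (k : R[i]) a b : C a -> C b -> C (k *: a + b).
  move=> Ca Cb; rewrite /C; have -> : diag_coef^~ (k *: a + b) =
      (fun y => k * diag_coef y a + diag_coef y b).
    by apply/funext => y; rewrite /diag_coef (homL repr_hom) coefL.
  apply: (@cts_add R S (fun y => k * diag_coef y a) (diag_coef^~ b)); last exact: Cb.
  apply: (@cts_mul R S (fun=> k) (diag_coef^~ a)); last exact: Ca.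
  exact: cst_continuous.
have CM a b : Bo b -> C a -> C b -> C (cmul a b).
  move=> Bb Ca Cb; rewrite /C; have -> : diag_coef^~ (cmul a b) =
      (fun y => diag_coef y a * diag_coef y b).
    apply/funext => y; rewrite /diag_coef (homM repr_hom) coefM_diagonal //.
    exact: repr_diagonal.
  exact: (@cts_mul R S (diag_coef^~ a) (diag_coef^~ b) Ca Cb).
apply: B0_ind => [|n v]; last first.
  have Cp : C (p n v).
    rewrite /C; have -> : (diag_coef^~ (p n v)) = (fun y => (`[< sv (Y n) v y >])%:R).
      by apply/funext => y; exact: diag_coef_pv.
    by apply: indicator_cts; have [] := canon_clopen n dyn_clopen.
  by split; [exact: B0_pv | split; rewrite /= ?pv_star].
split=> /=.
- by apply: closedI => //; exact: closedI.
- have C0 : C 0.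
    rewrite /C; have -> : diag_coef^~ 0 = (fun=> 0); last exact: cst_continuous.
    by apply/funext => y; rewrite /diag_coef (hom0 repr_hom).
  by split; [exact: B00 | split; [exact: C0 | rewrite /= cstar0; exact: C0]].
- move=> k a b [Ba [Ca Csa]] [Bb [Cb Csb]].
  split; [exact: BL | split; first exact: CL].
  by rewrite /= cstarD cstarZ; exact: CL.
- move=> a b [Ba [Ca Csa]] [Bb [Cb Csb]].
  split; [exact: BM | split; first exact: CM].
  by rewrite /= cstarM; apply: CM; [exact: Bs | exact: Csb | exact: Csa].
- move=> a [Ba [Ca Csa]].
  by split; [exact: Bs | split; [exact: Csa | rewrite /= cstarK; exact: Ca]].
Qed.

Lemma to_Omega_cts : continuous (to_Omega : S -> Omega_dyn M).
Proof.
apply: spectrum_cts => b Bb.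
have -> : (fun y => ev (to_Omega y) b) = diag_coef^~ b.
  by apply/funext => y; rewrite to_OmegaP.
exact: diag_coef_cts.
Qed.

(** As [x] maps the point mass at [y] to the one at [theta_x y], the diagonal
    entries of [x^* b x] at [y] and of [b] at [theta_x y] are equal. *)
Lemma to_Omega_equivariant : equivariant (to_Omega : S -> Omega_dyn M).
Proof.
have edge_delta (x : edge G) y : dvert S (src x) y ->
    repr (t 0 x) (delta y) = delta (dtheta x y).
  by move=> yx; rewrite repr_te; apply: pop_delta.
have edge_star_delta (x : edge G) y : dvert S (src x) y ->
    repr (cstar (t 0 x)) (delta (dtheta x y)) = delta y.
  move=> yx; rewrite (hom_star repr_hom) repr_te /edge_op pop_star.
  by apply: pop_delta.
have vertE w y : dvert S w y -> ev (to_Omega y) (p 0 w) = 1.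
  by move=> wy; rewrite to_OmegaP ?diag_coef_pv ?asboolT //; exact: B0_pv.
split=> [w y wy|x y /theta_surj[y' yx <-]|x y yx].
- by apply/Omega_vertP; exact: vertE.
- apply/Omega_edgeP; rewrite to_OmegaP; last exact: (@B0_eproj _ _ M 0).
  apply: diag_coef_eq; rewrite (homM repr_hom) scale1r.
  rewrite -[LHS]/(repr (t 0 x) (repr (cstar (t 0 x)) (delta (dtheta x y')))).
  by rewrite edge_star_delta // edge_delta.
- apply: ev_inj => b Bb /=; rewrite Omega_thetaP ?vertE //.
  rewrite !to_OmegaP //; last exact: B0_conj_star.
  apply/esym/diag_coef_eq; rewrite !(homM repr_hom).
  rewrite -[LHS]/(repr (cstar (t 0 x)) (repr b (repr (t 0 x) (delta y)))).
  by rewrite edge_delta // diag_coefP // op_scale edge_star_delta.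
Qed.

End Universal.

Section NextVertices.
Variables (R : realType) (G : bipSepGraph) (M : limitAlgebra R G).
Local Notation O := (la_lim M).
Local Notation Bo := (@B0 R G M).
Local Notation CG := (canon_graph G).
Local Notation p := (pv M).
Local Notation t := (te M).

Let BS : cstar_subalg Bo := @B0_subalg R G M.

Lemma eproj_next n (v : next_vert1 (CG n)) (X : block (tag v)) :
  cmul (eproj M (val ((tagged v : choices (tag v)) X))) (p n.+1 (inr v)) = p n.+1 (inr v).
Proof.
pose a : next_edge (CG n) := existT (fun v : next_vert1 (CG n) => block (tag v)) v X.
rewrite -[val _]/(marked a) /eproj te_proj cmul_suml (bigD1 a) //=.
rewrite (repV (limit_rep M n.+1)) big1 ?addr0 // => b /andP[/eqP ba nba].
rewrite (repVV (limit_rep M n.+1)); case: eqP => // -[bv].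
by rewrite (@next_edge_eq _ b a bv ba) eqxx in nba.
Qed.

(** The vertex of a tuple of edges is the product of their final projections.
    Evaluating it at characters dispenses with an order on the factors. *)
Lemma ev_next_vert (xi : Omega M) n (v : next_vert1 (CG n)) :
  ev xi (p n.+1 (inr v)) = 1 <->
  forall X : block (tag v), ev xi (eproj M (val ((tagged v : choices (tag v)) X))) = 1.
Proof.
have fwd (w : next_vert1 (CG n)) : ev xi (p n.+1 (inr w)) = 1 ->
    forall X, ev xi (eproj M (val ((tagged w : choices (tag w)) X))) = 1.
  move=> w1 X; apply: ev_absorb w1; [exact: B0_eproj|exact: B0_pv|exact: eproj_next].
split=> [|v1]; first exact: fwd.
have [X] : exists X : block (tag v), True.
  have [x xv] := brng_surj (tag v); rewrite -xv.
  by have [X _] := block_of_edge x; exists X.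
move=> _; have := v1 X; rewrite /eproj te_proj => s1.
have [a /eqP ax a1] : exists2 a, marked a == val ((tagged v : choices (tag v)) X) &
    ev xi (p n.+1 (inr (next_src a))) = 1.
  apply: ev_sum1 s1 => a _; [exact: B0_pv | exact: ev_pv].
suff <- : next_src a = v by [].
have : tag (next_src a) = tag v.
  by rewrite -brng_marked ax; apply: (@block_edge _ _ X); exact: valP.
move: (next_src a) (fwd _ a1) => w w1 {s1 a ax a1}.
case: v w v1 X w1 => u c [u' c'] /= c1 _ w1 uu; case: u / uu c c1 => c c1.
congr existT; apply/ffunP => X; apply: val_inj.
apply: (ev_eproj_disj (xi := xi) (valP X)); [exact: valP|exact: valP|exact: w1|exact: c1].
Qed.

End NextVertices.

Section Uniqueness.
Variables (R : realType) (G : bipSepGraph) (M : limitAlgebra R G).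
Variables (S : dynData G).
Hypothesis SP : is_dynsys S.
Variables (g h : S -> Omega_dyn M).
Hypotheses (gE : equivariant g) (hE : equivariant h).
Local Notation O := (la_lim M).
Local Notation Bo := (@B0 R G M).
Local Notation CG := (canon_graph G).
Local Notation p := (pv M).
Local Notation t := (te M).

Let BS : cstar_subalg Bo := @B0_subalg R G M.

(** The elements of [B0] on which all characters [g y] and [h y] agree form a
    closed algebra, which contains the vertices of the first level and is stable
    under conjugation by the edges of the first level; by induction the same
    holds for all levels. *)
Definition agree (b : O) : Prop :=
  forall y, ev (g y : Omega M) b = ev (h y : Omega M) b.

Definition coincidence : set O := [set b | [/\ Bo b, agree b & agree (cstar b)]].

Lemma coincidence_subalg : cstar_subalg coincidence.
Proof.
have [clB B00 BL BM Bs] := BS; split.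
- have ag a : Bo a ->
      (forall e : R, 0 < e -> exists2 c, Bo c /\ agree c & rnorm (a - c) < e) ->
      agree a.
    move=> Ba aP y; apply/eqP; rewrite -subr_eq0; apply/eqP.
    apply: (@rnorm_le_eq0 _ R[i]^o) => e e0.
    have [c [Bc cy] ac] := aP _ (divr_gt0 e0 (ltr0n R 2)).
    rewrite (le_trans (ler_rnorm_dist (ev (g y : Omega M) c : R[i]^o) _ _)) //.
    rewrite (splitr e) lerD //.
      by rewrite rnorm_complex (le_trans (ev_lipschitz BS _ Ba Bc)) // ltW.
    by rewrite cy rnorm_complex (le_trans (ev_lipschitz BS _ Bc Ba)) // rnormB ltW.
  apply/closed_rnormP => a aP.
  have Ba : Bo a.
    by move/closed_rnormP: clB; apply => e /aP[c [Bc _ _] ac]; exists c.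
  split; [exact: Ba|apply: ag|apply: ag]; [exact: Ba| |exact: Bs|].
    by move=> e /aP[c [Bc cy _] ac]; exists c.
  move=> e /aP[c [Bc _ cy] ac]; exists (cstar c); first by split; [exact: Bs | exact: cy].
  by rewrite -cstarN -cstarD rnorm_star.
- by split; [exact: B00| |rewrite cstar0] => y; rewrite !ev0.
- move=> k a b [Ba aa as_] [Bb ab bs]; split; first exact: BL.
    by move=> y; rewrite !evL // aa ab.
  move=> y; rewrite cstarD cstarZ !evL ?as_ ?bs //; exact: Bs.
- move=> a b [Ba aa as_] [Bb ab bs]; split; first exact: BM.
    by move=> y; rewrite !evM // aa ab.
  move=> y; rewrite cstarM !evM ?as_ ?bs //; exact: Bs.
- by move=> a [Ba aa as_]; split; [exact: Bs | exact: as_ | rewrite cstarK; exact: aa].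
Qed.

Section Values.
Variable f : S -> Omega_dyn M.
Hypothesis fE : equivariant f.

Lemma equivariant_vert y v : dvert S v y -> ev (f y : Omega M) (p 0 v) = 1.
Proof. by have [fv _ _] := fE; move=> /fv /Omega_vertP. Qed.

Lemma equivariant_vert0 y v : ~ dvert S v y -> ev (f y : Omega M) (p 0 v) = 0.
Proof.
move=> nvy; have : [set: S] y by [].
rewrite -(dyn_vert_cover SP) => -[w _ wy]; have w1 := equivariant_vert wy.
apply: ev_orth w1; [exact: B0_pv|exact: B0_pv|].
by rewrite (repVV (limit_rep M 0)); case: eqP => // wv; rewrite wv in wy.
Qed.

Lemma equivariant_edge0 y (x : edge G) :
  ~ dedge S x y -> ev (f y : Omega M) (@eproj _ _ M 0 x) = 0.
Proof.
move=> nxy; have [ry|nry] := pselect (dvert S (rng x) y); last first.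
  rewrite -(@eprojV _ _ M 0 x) (evM BS); [|exact: B0_pv|exact: (@B0_eproj _ _ M 0)].
  by rewrite (equivariant_vert0 nry) mul0r.
have [X xX] := block_of_edge x.
move: ry; rewrite -(dyn_edge_cover SP (valP X)) => -[x' x'X x'y].
have [_ fe _] := fE; have /Omega_edgeP x1 := fe _ _ x'y.
apply: ev_orth x1; [exact: (@B0_eproj _ _ M 0)|exact: (@B0_eproj _ _ M 0)|].
apply: (@eproj_orth _ _ M 0 _ (val X)) => //; first exact: valP.
by move=> xx; rewrite xx in x'y.
Qed.

(** For [y] outside of the domain of [theta_x], the character vanishes at the
    initial projection of [x], which absorbs [x^* b x]. *)
Lemma equivariant_conj_star y (x : edge G) b : Bo b ->
  (dvert S (src x) y ->
    ev (f y : Omega M) (cmul (cmul (cstar (t 0 x)) b) (t 0 x)) =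
    ev (f (dtheta x y) : Omega M) b) /\
  (~ dvert S (src x) y ->
    ev (f y : Omega M) (cmul (cmul (cstar (t 0 x)) b) (t 0 x)) = 0).
Proof.
move=> Bb; split=> xy.
  have [_ _ ft] := fE; rewrite ft //= Omega_thetaP //; exact: equivariant_vert.
rewrite -(repVEs (limit_rep M 0) x) -!cmulA evM //.
- by rewrite (equivariant_vert0 xy) mul0r.
- exact: B0_pv.
- by rewrite cmulA; exact: B0_conj_star.
Qed.

Lemma equivariant_conj y (x : edge G) b : Bo b ->
  (dvert S (src x) y ->
    ev (f (dtheta x y) : Omega M) (cmul (cmul (t 0 x) b) (cstar (t 0 x))) =
    ev (f y : Omega M) b) /\
  (~ dedge S x y ->
    ev (f y : Omega M) (cmul (cmul (t 0 x) b) (cstar (t 0 x))) = 0).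
Proof.
move=> Bb; split=> xy.
  have [_ _ ft] := fE; have x1 := equivariant_vert xy.
  rewrite ft //= Omega_thetaP //; last exact: B0_conjr.
  rewrite !cmulA (@te_starM _ _ M 0) -cmulA (@te_starM _ _ M 0) ev_cut //.
  exact: B0_pv.
have -> : cmul (cmul (t 0 x) b) (cstar (t 0 x)) =
    cmul (@eproj _ _ M 0 x) (cmul (cmul (t 0 x) b) (cstar (t 0 x))).
  by rewrite 2!(cmulA (@eproj _ _ M 0 x)) (@eprojE _ _ M 0).
rewrite (evM BS); [|exact: (@B0_eproj _ _ M 0)|exact: B0_conjr].
by rewrite (equivariant_edge0 xy) mul0r.
Qed.

End Values.

Lemma coincidence_pv n v : agree (p n v) -> coincidence (p n v).
Proof. by move=> a; split; [exact: B0_pv | exact: a | rewrite pv_star; exact: a]. Qed.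

Lemma agree_level n :
  (forall v, coincidence (p n v)) /\
  (forall (x : bedge (CG n)) b, coincidence b ->
     coincidence (cmul (cmul (cstar (t n x)) b) (t n x)) /\
     coincidence (cmul (cmul (t n x) b) (cstar (t n x)))).
Proof.
elim: n => [|n [IHv IHe]].
  split=> [v|x b [Bb ab bs]].
    apply: coincidence_pv => y; have [vy|nvy] := pselect (dvert S v y).
      by rewrite !equivariant_vert.
    by rewrite !equivariant_vert0.
  have ag_star c : Bo c -> agree c -> agree (cmul (cmul (cstar (t 0 x)) c) (t 0 x)).
    move=> Bc ac y; have [g1 g0] := equivariant_conj_star gE y x Bc.
    have [h1 h0] := equivariant_conj_star hE y x Bc.
    by have [xy|xy] := pselect (dvert S (src (x : edge G)) y);
      [rewrite g1 // h1 // ac | rewrite g0 // h0].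
  have ag c : Bo c -> agree c -> agree (cmul (cmul (t 0 x) c) (cstar (t 0 x))).
    move=> Bc ac y; have [xy|xy] := pselect (dedge S (x : edge G) y).
      have [[_ _ surj] _] := dyn_theta SP (x : edge G); have [y' y'x <-] := surj _ xy.
      have [g1 _] := equivariant_conj gE y' x Bc.
      by have [h1 _] := equivariant_conj hE y' x Bc; rewrite g1 // h1 // ac.
    have [_ g0] := equivariant_conj gE y x Bc.
    by have [_ h0] := equivariant_conj hE y x Bc; rewrite g0 // h0.
  have Bsb : Bo (cstar b) by exact: (subalg_star BS).
  split; split; rewrite ?cstarM ?cstarK ?[cmul _ (cmul (cstar b) _)]cmulA.
  - exact: B0_conj_star.
  - exact: ag_star.
  - exact: ag_star.
  - exact: B0_conjr.
  - exact: ag.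
  - exact: ag.
have WS := coincidence_subalg.
have proj_agree (x : bedge (CG n)) : coincidence (eproj M x).
  have [_] := IHe x _ (IHv (inr (bsrc x))).
  by rewrite (repEV (limit_rep M n) x).
have Wv v : coincidence (p n.+1 v).
  case: v => [w|v]; first by rewrite -pvV1; exact: IHv.
  apply: coincidence_pv => y.
  have iff1 : ev (g y : Omega M) (p n.+1 (inr v)) = 1 <->
      ev (h y : Omega M) (p n.+1 (inr v)) = 1.
    have ag X : ev (g y : Omega M) (eproj M (val ((tagged v : choices (tag v)) X))) =
        ev (h y : Omega M) (eproj M (val ((tagged v : choices (tag v)) X))).
      by have [_ a _] := proj_agree (val ((tagged v : choices (tag v)) X)); exact: a.
    by split=> /ev_next_vert v1; apply/ev_next_vert => X; [rewrite -ag | rewrite ag].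
  have [g0|g1] := ev_pv (g y) (inr v : vert (CG n.+1)); last first.
    by rewrite g1; apply/esym/iff1.
  have [h0|h1] := ev_pv (h y) (inr v : vert (CG n.+1)); first by rewrite g0 h0.
  by move: h1 => /iff1 g1; rewrite g1 in g0; move/eqP: g0; rewrite oner_eq0.
split=> // a b Wb; pose q := p n.+1 (inr (next_src a)); pose x := marked a.
have aE : t n.+1 a = cmul (cstar (t n x)) q by exact: te_next.
have asE : cstar (t n.+1 a) = cmul q (t n x) by rewrite aE cstarM cstarK pv_star.
have Wq : coincidence q by exact: Wv.
have Wqbq : coincidence (cmul (cmul q b) q).
  by apply: (subalgM WS) => //; exact: (subalgM WS).
rewrite asE aE; split.
  have -> : cmul (cmul (cmul q (t n x)) b) (cmul (cstar (t n x)) q) =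
      cmul (cmul q (cmul (cmul (t n x) b) (cstar (t n x)))) q by rewrite !cmulA.
  apply: (subalgM WS) => //; apply: (subalgM WS) => //.
  by have [] := IHe x b Wb.
have -> : cmul (cmul (cmul (cstar (t n x)) q) b) (cmul q (t n x)) =
    cmul (cmul (cstar (t n x)) (cmul (cmul q b) q)) (t n x) by rewrite !cmulA.
by have [] := IHe x _ Wqbq.
Qed.

Lemma equivariant_unique : g = h.
Proof.
apply/funext => y; apply: (@ev_inj _ _ Bo) => b Bb.
have sub : Bo `<=` coincidence.
  apply: B0_ind => [|n v]; first exact: coincidence_subalg.
  by have [Wv _] := agree_level n; exact: Wv.
by have [_ ab _] := sub _ Bb; exact: ab.
Qed.

End Uniqueness.

Theorem corollary6p11 (R : realType) (G : bipSepGraph) (M : limitAlgebra R G) :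
  is_dynsys (Omega_dyn M) /\
  (forall S : dynData G, is_dynsys S ->
     exists! f : S -> Omega_dyn M, continuous f /\ equivariant f).
Proof.
split=> [|S SP]; first exact: Omega_dynsys.
exists (to_Omega M SP); split=> [|f [_ fE]].
  by split; [exact: to_Omega_cts | exact: to_Omega_equivariant].
exact: (equivariant_unique SP (to_Omega_equivariant M SP) fE).
Qed.
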